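(* Let $F$ be a $C_1$-field, let $A$ be a finite-dimensional associative $F$-algebra, let $K/F$ be a separable algebraic field extension, and let $M$ be a finitely generated $A_K$-module. Then $M$ has a minimal field of definition $F \subset K_0 \subset K$, and this $K_0$ satisfies $[K_0:F] < \infty$.
   Context: For a field extension $K/F$, $A_K := K \otimes_F A$. An intermediate field $F \subset K_0 \subset K$ is a field of definition for an $A_K$-module $M$ (equivalently, $M$ descends to $K_0$) if there exists a finitely generated $A_{K_0}$-module $M_0$ with $M \cong K \otimes_{K_0} M_0$ as $A_K$-modules. A field of definition $K_0$ of $M$ is minimal if whenever $M$ descends to an intermediate field $F \subset L \subset K$, we have $K_0 \subset L$. A field $F$ is a $C_1$-field if every homogeneous polynomial $f(x_1,\dots,x_n)$ with coefficients in $F$ of degree $d$ with $0<d<n$ has a non-trivial zero in $F^n$. *)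

(* Defs.v *)
From HB Require Import structures.
From mathcomp Require Import mpoly.
From mathcomp Require Import all_boot all_order all_algebra all_field.
From mathcomp Require Import generic_quotient.
From mathcomp Require Import boolp.

Set Implicit Arguments.
Unset Strict Implicit.
Unset Printing Implicit Defensive.

Import GRing.Theory.
Local Open Scope ring_scope.
Local Open Scope quotient_scope.

Definition finitely_generated (R : pzRingType) (M : lmodType R) : Prop :=
  exists (n : nat) (e : 'I_n -> M),
    forall x : M, exists c : 'I_n -> R, x = \sum_(i < n) c i *: e i.

Definition restrict_scalars (R B : pzRingType) (f : {rmorphism R -> B})
  (M : lmodType B) : Type := M.

Section RestrictScalars.
Variables (R B : pzRingType) (f : {rmorphism R -> B}) (M : lmodType B).
Local Notation rM := (restrict_scalars f M).

HB.instance Definition _ := GRing.Zmodule.on rM.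

Definition restrict_scale (a : R) (m : rM) : rM := f a *: (m : M).

Fact restrict_scaleA a b m :
  restrict_scale a (restrict_scale b m) = restrict_scale (a * b) m.
Proof. by rewrite /restrict_scale scalerA rmorphM. Qed.
Fact restrict_scale1 : left_id 1 restrict_scale.
Proof. by move=> m; rewrite /restrict_scale rmorph1 scale1r. Qed.
Fact restrict_scaleDr : right_distributive restrict_scale +%R.
Proof. by move=> a m n; rewrite /restrict_scale scalerDr. Qed.
Fact restrict_scaleDl m : {morph restrict_scale^~ m : a b / a + b}.
Proof. by move=> a b; rewrite /restrict_scale rmorphD scalerDl. Qed.

HB.instance Definition _ := GRing.Zmodule_isLmodule.Build R rM
  restrict_scaleA restrict_scale1 restrict_scaleDr restrict_scaleDl.

Lemma restrict_scaleE (a : R) (m : rM) : a *: m = f a *: (m : M) :> M.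
Proof. by []. Qed.
End RestrictScalars.

(* Associative unital R-algebras, as rings with a central structure morphism. *)
(* Unlike [algType R] and [falgType R], this does not exclude the zero ring.  *)
Record assoc_algebra (R : comPzRingType) := AssocAlgebra {
  alg_ring :> pzRingType;
  alg_const : {rmorphism R -> alg_ring};
  alg_constC : forall (a : R) (x : alg_ring),
    alg_const a * x = x * alg_const a
}.

Definition alg_module (R : comPzRingType) (A : assoc_algebra R) : lmodType R :=
  restrict_scalars (alg_const A) (A : pzRingType)^o.

(* The S-module S (x)_R V, where S is an R-algebra via f: formal sums of      *)
(* pairs (s, v), identified when every R-balanced biadditive map into an      *)
(* abelian group takes the same value on them.                                *)
Section Tensor.
Variables (R S : comPzRingType) (f : {rmorphism R -> S}) (V : lmodType R).

Record balanced (Z : zmodType) (g : S -> V -> Z) : Prop := Balanced {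
  balancedDl : forall s t v, g (s + t) v = g s v + g t v;
  balancedDr : forall s u v, g s (u + v) = g s u + g s v;
  balancedZ : forall s r v, g (s * f r) v = g s (r *: v)
}.

Definition formal_eval (Z : zmodType) (g : S -> V -> Z) (x : seq (S * V)) : Z :=
  \sum_(p <- x) g p.1 p.2.

Definition tensor_eq (x y : seq (S * V)) : bool :=
  `[< forall (Z : zmodType) (g : S -> V -> Z), balanced g ->
        formal_eval g x = formal_eval g y >].

Fact tensor_eq_refl : reflexive tensor_eq.
Proof. by move=> x; apply/asboolP. Qed.
Fact tensor_eq_sym : symmetric tensor_eq.
Proof. by move=> x y; apply/asboolP/asboolP=> h Z g bg; rewrite h. Qed.
Fact tensor_eq_trans : transitive tensor_eq.
Proof.
by move=> y x z /asboolP h1 /asboolP h2; apply/asboolP=> Z g bg; rewrite h1 ?h2.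
Qed.

Canonical tensor_equiv :=
  EquivRel tensor_eq tensor_eq_refl tensor_eq_sym tensor_eq_trans.

Definition tensor : Type := {eq_quot tensor_equiv}.
HB.instance Definition _ := Choice.on tensor.
HB.instance Definition _ := EqQuotient.on tensor.

Lemma tensor_eqP (x y : seq (S * V)) :
  (forall (Z : zmodType) (g : S -> V -> Z), balanced g ->
     formal_eval g x = formal_eval g y) <-> \pi_tensor x = \pi_tensor y.
Proof.
split=> [h|/eqP]; first by apply/eqP; rewrite piE; apply/asboolP.
by rewrite piE => /asboolP.
Qed.

Definition tensor_lift (Z : zmodType) (g : S -> V -> Z) (x : tensor) : Z :=
  formal_eval g (repr x).

Lemma tensor_lift_pi (Z : zmodType) (g : S -> V -> Z) (x : seq (S * V)) :
  balanced g -> tensor_lift g (\pi_tensor x) = formal_eval g x.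
Proof. by move=> bg; apply: (proj2 (tensor_eqP _ _)) bg; rewrite reprK. Qed.

Definition tensor0 : tensor := \pi_tensor [::].
Definition tensor_add (x y : tensor) : tensor := \pi_tensor (repr x ++ repr y).
Definition tensor_opp (x : tensor) : tensor :=
  \pi_tensor [seq (- p.1, p.2) | p <- repr x].

Lemma formal_eval_cat (Z : zmodType) (g : S -> V -> Z) x y :
  formal_eval g (x ++ y) = formal_eval g x + formal_eval g y.
Proof. exact: big_cat. Qed.

Lemma balancedNl (Z : zmodType) (g : S -> V -> Z) s v :
  balanced g -> g (- s) v = - g s v.
Proof.
move=> bg; have g0 : g 0 v = 0.
  by apply: (addrI (g 0 v)); rewrite -balancedDl // !addr0.
by apply: (addrI (g s v)); rewrite -balancedDl // !subrr.
Qed.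

Lemma formal_eval_opp (Z : zmodType) (g : S -> V -> Z) x : balanced g ->
  formal_eval g [seq (- p.1, p.2) | p <- x] = - formal_eval g x.
Proof.
move=> bg; rewrite /formal_eval big_map -sumrN.
by apply: eq_bigr => p _; rewrite balancedNl.
Qed.

Lemma tensor_lift_inj (x y : tensor) :
  (forall (Z : zmodType) (g : S -> V -> Z), balanced g ->
     tensor_lift g x = tensor_lift g y) -> x = y.
Proof. by move=> h; rewrite -[x]reprK -[y]reprK; apply/tensor_eqP. Qed.

Lemma tensor_lift_add0 (Z : zmodType) (g : S -> V -> Z) :
  balanced g -> {morph tensor_lift g : x y / tensor_add x y >-> x + y}.
Proof. by move=> bg x y; rewrite tensor_lift_pi // formal_eval_cat. Qed.

Lemma tensor_lift_opp0 (Z : zmodType) (g : S -> V -> Z) :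
  balanced g -> {morph tensor_lift g : x / tensor_opp x >-> - x}.
Proof. by move=> bg x; rewrite tensor_lift_pi // formal_eval_opp. Qed.

Lemma tensor_lift_zero0 (Z : zmodType) (g : S -> V -> Z) :
  balanced g -> tensor_lift g tensor0 = 0.
Proof. by move=> bg; rewrite tensor_lift_pi // /formal_eval big_nil. Qed.

Fact tensor_addA : associative tensor_add.
Proof.
by move=> x y z; apply: tensor_lift_inj => Z g bg; rewrite !tensor_lift_add0 ?addrA.
Qed.
Fact tensor_addC : commutative tensor_add.
Proof.
by move=> x y; apply: tensor_lift_inj => Z g bg; rewrite !tensor_lift_add0 // addrC.
Qed.
Fact tensor_add0 : left_id tensor0 tensor_add.
Proof.
move=> x; apply: tensor_lift_inj => Z g bg.
by rewrite tensor_lift_add0 // tensor_lift_zero0 // add0r.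
Qed.
Fact tensor_addN : left_inverse tensor0 tensor_opp tensor_add.
Proof.
move=> x; apply: tensor_lift_inj => Z g bg.
by rewrite tensor_lift_add0 // tensor_lift_opp0 // tensor_lift_zero0 // addNr.
Qed.

HB.instance Definition _ := GRing.isZmodule.Build tensor
  tensor_addA tensor_addC tensor_add0 tensor_addN.

Definition pure_tensor (s : S) (v : V) : tensor := \pi_tensor [:: (s, v)].

Lemma tensor_liftE (Z : zmodType) (g : S -> V -> Z) s v :
  balanced g -> tensor_lift g (pure_tensor s v) = g s v.
Proof. by move=> bg; rewrite tensor_lift_pi // /formal_eval big_seq1. Qed.

Lemma tensor_liftD (Z : zmodType) (g : S -> V -> Z) :
  balanced g -> {morph tensor_lift g : x y / x + y}.
Proof. exact: tensor_lift_add0. Qed.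

Lemma pure_tensor_balanced : balanced pure_tensor.
Proof.
split=> [s t v|s u v|s r v]; apply: tensor_lift_inj => Z g bg;
  rewrite ?(tensor_liftD bg) !tensor_liftE //.
- exact: balancedDl.
- exact: balancedDr.
- exact: balancedZ.
Qed.

Lemma tensor_ind (P : tensor -> Prop) :
  P 0 -> (forall s v x, P x -> P (pure_tensor s v + x)) -> forall x, P x.
Proof.
move=> P0 PS x; rewrite -[x]reprK; elim: (repr x) => [//|[s v] l IH].
suff -> : \pi_tensor ((s, v) :: l) = pure_tensor s v + \pi_tensor l by exact: PS.
apply: tensor_lift_inj => Z g bg.
rewrite tensor_liftD // tensor_liftE // !tensor_lift_pi //.
by rewrite /formal_eval big_cons.
Qed.

Lemma tensor_additive_ext (Z : zmodType) (h k : tensor -> Z) :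
  {morph h : x y / x + y} -> {morph k : x y / x + y} ->
  (forall s v, h (pure_tensor s v) = k (pure_tensor s v)) -> h =1 k.
Proof.
move=> hD kD hk.
have z0 (l : tensor -> Z) : {morph l : x y / x + y} -> l 0 = 0.
  by move=> lD; apply: (addrI (l 0)); rewrite -lD !addr0.
by elim/tensor_ind => [|s v x IH]; rewrite ?z0 // hD kD hk IH.
Qed.

Fact tensor_scale_balanced (a : S) :
  balanced (fun s v => pure_tensor (a * s) v).
Proof.
have [pDl pDr pZ] := pure_tensor_balanced.
by split=> [s t v|s u v|s r v]; rewrite ?mulrDr ?mulrA.
Qed.

Definition tensor_scale (a : S) (x : tensor) : tensor :=
  tensor_lift (fun s v => pure_tensor (a * s) v) x.

Lemma tensor_scaleE0 a s v :
  tensor_scale a (pure_tensor s v) = pure_tensor (a * s) v.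
Proof. exact: tensor_liftE (tensor_scale_balanced a). Qed.

Fact tensor_scaleDr : right_distributive tensor_scale +%R.
Proof. by move=> a x y; apply: (tensor_liftD (tensor_scale_balanced a)). Qed.
Fact tensor_scaleA a b x :
  tensor_scale a (tensor_scale b x) = tensor_scale (a * b) x.
Proof.
move: x; apply: tensor_additive_ext => [x y|x y|s v]; rewrite ?tensor_scaleDr //.
by rewrite !tensor_scaleE0 mulrA.
Qed.
Fact tensor_scale1 : left_id 1 tensor_scale.
Proof.
apply: tensor_additive_ext => [x y|x y|s v]; rewrite ?tensor_scaleDr //.
by rewrite tensor_scaleE0 mul1r.
Qed.
Fact tensor_scaleDl x : {morph tensor_scale^~ x : a b / a + b}.
Proof.
move=> a b; move: x; apply: tensor_additive_ext => [x y|x y|s v].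
- exact: tensor_scaleDr.
- by rewrite !tensor_scaleDr addrACA.
- by rewrite !tensor_scaleE0 mulrDl; apply: balancedDl pure_tensor_balanced _ _ _.
Qed.

HB.instance Definition _ := GRing.Zmodule_isLmodule.Build S tensor
  tensor_scaleA tensor_scale1 tensor_scaleDr tensor_scaleDl.

Lemma tensor_scaleE (a s : S) (v : V) :
  a *: pure_tensor s v = pure_tensor (a * s) v.
Proof. exact: tensor_scaleE0. Qed.

End Tensor.

Arguments pure_tensor {R S} f {V} s v.
Arguments tensor_lift {R S} f {V Z} g x.
Arguments balanced {R S} f {V Z} g.

Section ScalarExtension.
Variables (R S : comPzRingType) (f : {rmorphism R -> S}) (A : assoc_algebra R).

(* S (x)_R A, with (s (x) a) * (t (x) b) = st (x) ab.                         *)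
Definition scalar_ext : Type := tensor f (alg_module A).
HB.instance Definition _ := GRing.Zmodule.on scalar_ext.

Definition ext_tensor (s : S) (a : A) : scalar_ext :=
  pure_tensor f s (a : alg_module A).

Fact ext_mul_balanced0 (s : S) (a : A) :
  balanced f (fun t (b : alg_module A) => ext_tensor (s * t) (a * (b : A))).
Proof.
have [pDl pDr pZ] := pure_tensor_balanced f (alg_module A).
split=> [t u b|t b c|t r b]; rewrite /ext_tensor.
- by rewrite mulrDr; exact: pDl.
- by rewrite [X in a * X]/(_ + _) mulrDr; exact: pDr.
- rewrite mulrA pZ; congr pure_tensor.
  by rewrite !restrict_scaleE /= /GRing.scale /= !mulrA alg_constC.
Qed.

Definition ext_mul_pure (s : S) (a : alg_module A) (y : scalar_ext) :
    scalar_ext :=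
  tensor_lift f
    (fun t (b : alg_module A) => ext_tensor (s * t) ((a : A) * (b : A))) y.

Lemma ext_mul_pureE s a t b :
  ext_mul_pure s a (ext_tensor t b) = ext_tensor (s * t) ((a : A) * b).
Proof. exact: tensor_liftE (ext_mul_balanced0 s a). Qed.

Lemma ext_mul_pureD s a : {morph ext_mul_pure s a : x y / x + y}.
Proof. exact: tensor_liftD (ext_mul_balanced0 s a). Qed.

Fact ext_mul_balanced (y : scalar_ext) :
  balanced f (fun s a => ext_mul_pure s a y).
Proof.
have [pDl pDr pZ] := pure_tensor_balanced f (alg_module A).
split=> [s t a|s a b|s r a]; move: y; apply: tensor_additive_ext => [x y|x y|u c];
  first [exact: ext_mul_pureD | rewrite !ext_mul_pureD; exact: addrACA
        | rewrite -/(ext_tensor u c)].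
- by rewrite !ext_mul_pureE mulrDl; exact: pDl.
- by rewrite !ext_mul_pureE [X in X * c]/(_ + _) mulrDl; exact: pDr.
- rewrite !ext_mul_pureE mulrAC [LHS]pZ; congr pure_tensor.
  by rewrite !restrict_scaleE /= /GRing.scale /= !mulrA.
Qed.

Definition ext_mul (x y : scalar_ext) : scalar_ext :=
  tensor_lift f (fun s a => ext_mul_pure s a y) x.
Definition ext_one : scalar_ext := ext_tensor 1 1.

Lemma ext_mulE0 s a y : ext_mul (ext_tensor s a) y = ext_mul_pure s a y.
Proof. exact: tensor_liftE (ext_mul_balanced y). Qed.

Fact ext_mulDl : left_distributive ext_mul +%R.
Proof. by move=> x y z; apply: tensor_liftD (ext_mul_balanced z) _ _. Qed.

Fact ext_mulDr : right_distributive ext_mul +%R.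
Proof.
move=> x y z; move: x; apply: tensor_additive_ext => [u v|u v|s a].
- exact: ext_mulDl.
- by rewrite !ext_mulDl addrACA.
- by rewrite !ext_mulE0 ext_mul_pureD.
Qed.

Fact ext_mulA : associative ext_mul.
Proof.
move=> x y z; move: x; apply: tensor_additive_ext => [u v|u v|s a];
  rewrite ?ext_mulDl //.
rewrite -/(ext_tensor s a).
move: y; apply: tensor_additive_ext => [u v|u v|t b];
  rewrite ?(ext_mulDl, ext_mulDr) // -/(ext_tensor t b).
move: z; apply: tensor_additive_ext => [u v|u v|w c]; rewrite ?ext_mulDr //.
by rewrite -/(ext_tensor w c) !(ext_mulE0, ext_mul_pureE) !mulrA.
Qed.

Fact ext_mul1r : left_id ext_one ext_mul.
Proof.
apply: tensor_additive_ext => [u v|u v|s a]; rewrite ?ext_mulDr //.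
by rewrite -/(ext_tensor s a) ext_mulE0 ext_mul_pureE !mul1r.
Qed.

Fact ext_mulr1 : right_id ext_one ext_mul.
Proof.
apply: tensor_additive_ext => [u v|u v|s a]; rewrite ?ext_mulDl //.
by rewrite -/(ext_tensor s a) ext_mulE0 ext_mul_pureE !mulr1.
Qed.

HB.instance Definition _ := GRing.Zmodule_isPzRing.Build scalar_ext
  ext_mulA ext_mul1r ext_mulr1 ext_mulDl ext_mulDr.

Lemma ext_tensorM s t a b :
  ext_tensor s a * ext_tensor t b = ext_tensor (s * t) (a * b).
Proof. by rewrite -ext_mul_pureE -ext_mulE0. Qed.

Definition ext_const (s : S) : scalar_ext := ext_tensor s 1.

Fact ext_const_zmod_morphism : zmod_morphism ext_const.
Proof.
move=> s t; have [pDl _ _] := pure_tensor_balanced f (alg_module A).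
by apply: (addIr (ext_const t)); rewrite addrNK -[LHS]pDl addrNK.
Qed.
Fact ext_const_monoid_morphism : monoid_morphism ext_const.
Proof. by split=> // s t; rewrite ext_tensorM mulr1. Qed.

HB.instance Definition _ := GRing.isZmodMorphism.Build S scalar_ext ext_const
  ext_const_zmod_morphism.
HB.instance Definition _ := GRing.isMonoidMorphism.Build S scalar_ext ext_const
  ext_const_monoid_morphism.

End ScalarExtension.

Arguments ext_tensor {R S} f {A} s a.
Arguments ext_const {R S} f A s.

(* For R -i-> S -j-> T with composite k, the (T (x)_R A)-module T (x)_S M,    *)
(* where M is an (S (x)_R A)-module:                                          *)
(* (t (x) a) *: (u (x) m) = tu (x) (1 (x) a) *: m.                            *)
Section ModuleExtension.
Variables (R S T : comPzRingType).
Variables (i : {rmorphism R -> S}) (j : {rmorphism S -> T}).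
Variables (k : {rmorphism R -> T}) (kE : forall r, k r = j (i r)).
Variables (A : assoc_algebra R) (M : lmodType (scalar_ext i A)).

Local Notation sM := (restrict_scalars (ext_const i A) M).

Definition module_ext of (forall r, k r = j (i r)) : Type := tensor j sM.
Local Notation eM := (module_ext kE).
HB.instance Definition _ := GRing.Zmodule.on eM.

Definition module_tensor (t : T) (m : M) : eM := pure_tensor j t (m : sM).

Fact act_balanced0 (t : T) (a : A) :
  balanced j (fun u (m : sM) => module_tensor (t * u) (ext_tensor i 1 a *: (m : M))).
Proof.
have [pDl pDr pZ] := pure_tensor_balanced j sM.
split=> [u v m|u m n|u c m]; rewrite /module_tensor.
- by rewrite mulrDr; exact: pDl.
- by rewrite [X in _ *: X]/(_ + _) scalerDr; exact: pDr.
- rewrite mulrA pZ; congr pure_tensor.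
  by rewrite !restrict_scaleE /= !scalerA !ext_tensorM !mulr1 !mul1r.
Qed.

Definition act_pure (t : T) (a : alg_module A) (x : eM) : eM :=
  tensor_lift j
    (fun u (m : sM) => module_tensor (t * u) (ext_tensor i 1 (a : A) *: (m : M))) x.

Lemma act_pureE t a u m :
  act_pure t a (module_tensor u m) = module_tensor (t * u) (ext_tensor i 1 (a : A) *: m).
Proof. exact: tensor_liftE (act_balanced0 t a). Qed.

Lemma act_pureD t a : {morph act_pure t a : x y / x + y}.
Proof. exact: tensor_liftD (act_balanced0 t a). Qed.

Fact act_balanced (x : eM) : balanced k (fun t a => act_pure t a x).
Proof.
have [pDl pDr pZ] := pure_tensor_balanced j sM.
have [_ qDr qZ] := pure_tensor_balanced i (alg_module A).
split=> [s t a|s a b|s r a]; move: x; apply: tensor_additive_ext => [x y|x y|u m];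
  first [exact: act_pureD | rewrite !act_pureD; exact: addrACA
        | rewrite -/(module_tensor u m)].
- by rewrite !act_pureE mulrDl; exact: pDl.
- rewrite !act_pureE; have -> : ext_tensor i 1 (a + b : alg_module A)
    = ext_tensor i 1 (a : A) + ext_tensor i 1 (b : A) by exact: qDr.
  by rewrite scalerDl; exact: pDr.
- rewrite !act_pureE mulrAC kE [LHS]pZ restrict_scaleE /= scalerA ext_tensorM.
  by rewrite mulr1 mul1r /ext_tensor -qZ mul1r.
Qed.

Definition ext_act (z : scalar_ext k A) (x : eM) : eM :=
  tensor_lift k (fun t a => act_pure t a x) z.

Lemma ext_actE0 t a x : ext_act (ext_tensor k t a) x = act_pure t a x.
Proof. exact: tensor_liftE (act_balanced x). Qed.

Fact ext_actDl x : {morph ext_act^~ x : z w / z + w}.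
Proof. exact: tensor_liftD (act_balanced x). Qed.

Fact ext_actDr : right_distributive ext_act +%R.
Proof.
move=> z x y; move: z; apply: tensor_additive_ext => [u v|u v|s a].
- exact: ext_actDl.
- by rewrite !ext_actDl addrACA.
- by rewrite !ext_actE0 act_pureD.
Qed.

Fact ext_actA z w x : ext_act z (ext_act w x) = ext_act (z * w) x.
Proof.
move: z; apply: tensor_additive_ext => [u v|u v|s a];
  rewrite ?mulrDl ?ext_actDl // -/(ext_tensor k s a).
move: w; apply: tensor_additive_ext => [u v|u v|t b];
  rewrite ?mulrDr ?ext_actDl ?ext_actDr // -/(ext_tensor k t b).
move: x; apply: tensor_additive_ext => [u v|u v|w m]; rewrite ?ext_actDr //.
rewrite -/(module_tensor w m) ext_tensorM !(ext_actE0, act_pureE).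
by rewrite scalerA ext_tensorM mulr1 mulrA.
Qed.

Fact ext_act1 : left_id 1 ext_act.
Proof.
apply: tensor_additive_ext => [u v|u v|s m]; rewrite ?ext_actDr //.
by rewrite -/(module_tensor s m) [1]/(ext_tensor k 1 1) ext_actE0 act_pureE
  mul1r scale1r.
Qed.

HB.instance Definition _ := GRing.Zmodule_isLmodule.Build (scalar_ext k A) eM
  ext_actA ext_act1 ext_actDr ext_actDl.

Lemma module_ext_scaleE t a u m :
  ext_tensor k t a *: module_tensor u m
    = module_tensor (t * u) (ext_tensor i 1 a *: m).
Proof. by rewrite -act_pureE -ext_actE0. Qed.

End ModuleExtension.

(* Intermediate fields F <= L <= K, with F embedded in K by iota.             *)
Record intermediate_field (F K : fieldType) (iota : {rmorphism F -> K}) :=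
  IntermediateField {
    ifield_pred :> {pred K};
    ifield_closed : divring_closed ifield_pred;
    ifield_base : forall x : F, iota x \in ifield_pred
  }.

Section IntermediateField.
Variables (F K : fieldType) (iota : {rmorphism F -> K}).
Variable L : intermediate_field iota.

HB.instance Definition _ :=
  GRing.isDivringClosed.Build K (ifield_pred L) (ifield_closed L).

Record ifield : Type := IField { ifield_val : K; _ : ifield_val \in L }.
HB.instance Definition _ := [isSub for ifield_val].
HB.instance Definition _ := [Choice of ifield by <:].
HB.instance Definition _ := [SubChoice_isSubIntegralDomain of ifield by <:].
HB.instance Definition _ := [SubIntegralDomain_isSubField of ifield by <:].

Definition ifield_in (x : F) : ifield := IField (ifield_base L x).

Fact ifield_in_zmod_morphism : zmod_morphism ifield_in.
Proof. by move=> x y; apply: val_inj; rewrite /= rmorphB. Qed.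
Fact ifield_in_monoid_morphism : monoid_morphism ifield_in.
Proof. by split=> [|x y]; apply: val_inj; rewrite /= ?rmorph1 ?rmorphM. Qed.

HB.instance Definition _ := GRing.isZmodMorphism.Build F ifield ifield_in
  ifield_in_zmod_morphism.
HB.instance Definition _ := GRing.isMonoidMorphism.Build F ifield ifield_in
  ifield_in_monoid_morphism.

Definition from_base : {rmorphism F -> ifield} := ifield_in.
Definition into_top : {rmorphism ifield -> K} := \val.

Lemma from_baseK (x : F) : iota x = into_top (from_base x).
Proof. by []. Qed.

End IntermediateField.

Definition separable_algebraic (F K : fieldType) (iota : {rmorphism F -> K}) :=
  forall x : K, exists p : {poly F},
    [/\ irreducible_poly p, root (map_poly iota p) x & separable_poly p].

Definition C1_field (F : fieldType) : Prop :=
  forall (n d : nat) (p : {mpoly F[n]}),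
    (0 < d < n)%N -> p \is d.-homog ->
    exists2 v : 'I_n -> F, (exists i, v i != 0) & p.@[v] = 0.

Section FieldOfDefinition.
Variables (F K : fieldType) (iota : {rmorphism F -> K}) (A : assoc_algebra F).
Variable M : lmodType (scalar_ext iota A).

(* Here phi is an isomorphism of scalar_ext iota A -modules (not just of       *)
(* K-spaces): both M and module_ext carry that structure.                     *)
Definition field_of_definition (L : intermediate_field iota) : Prop :=
  exists M0 : lmodType (scalar_ext (from_base L) A),
    finitely_generated M0 /\
    exists phi : {linear M -> module_ext M0 (from_baseK L)}, bijective phi.

Definition minimal_field_of_definition (L : intermediate_field iota) : Prop :=
  field_of_definition L /\
  forall L' : intermediate_field iota,
    field_of_definition L' -> {subset L <= L'}.

End FieldOfDefinition.

Definition finite_degree (F L : fieldType) (f : {rmorphism F -> L}) : Prop :=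
  finitely_generated (restrict_scalars f L^o).

Definition finite_dimensional (F : fieldType) (A : assoc_algebra F) : Prop :=
  finitely_generated (alg_module A).

(* Main.v *)
From HB Require Import structures.
Require Import Defs.
From mathcomp Require Import mpoly.
From mathcomp Require Import all_boot all_order all_algebra all_field.
From mathcomp Require Import perm generic_quotient boolp ring mxtens.

Set Implicit Arguments.
Unset Strict Implicit.
Unset Printing Implicit Defensive.

Import GRing.Theory.
Local Open Scope ring_scope.

(** In a basis of [M] over [K] the generators of [A] act by a family [X] of
    matrices, and [M] descends to [L] exactly when [X] is isomorphic to a
    family with entries in [L] ([field_of_definitionP]).  So it is enough to
    find a finite set [S] of elements of [K] such that [X] is defined over [L]
    if and only if [L] contains [S] ([family_descent]): the field generated
    by [S] over [F] is then the smallest field of definition, and it has finite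
    degree because [K] is algebraic.

    Such an [S] is built by induction on the size of [X].  As [K] is separable
    over [F], the family [X] is a direct summand of the extension of a family
    over [F] ([summand_over_base]).  Hence there is an indecomposable family [Y]
    over [F] such that [X] and the extension [Y_K] have a nonzero summand in
    common ([linked_indecomposable]).

    The ring [End Y] is local, and its residue ring is a division algebra [D]
    over [F].  If [D] has dimension [m], its norm is a form of degree [m] in [m]
    variables without nontrivial zeros, and it is a proper power of another form
    unless [D] is commutative; the C1 property excludes a proper power, so [D] is
    commutative ([infinite_division_comm]; for finite [F] this is Wedderburn's
    theorem, [finite_division_comm]).  A commutative division algebra stays
    reduced under separable extension of scalars ([division_reduced]).  So the
    radical of [End Y] extends to the radical of [End Y_K], and modulo the radical
    [End Y_K] is a product of fields: [Y_K] is multiplicity-free.  This is expressed by one row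
    vector [w] over [F] such that the radical consists of the endomorphisms [x]
    with [w *m x = 0], over every separable extension ([radrow_ext]).

    Since [Y_K] is multiplicity-free, its part [V] shared with [X] is the
    image of an idempotent [e] that is unique modulo the radical
    ([linked_exists], [linked_unique]).  So the row [w *m e] depends only on the
    isomorphism class of [X].  If [X] is defined over [L], then [e] can be found
    over [L], hence the entries of [w *m e] lie in [L].  Conversely, if these
    entries lie in [L], an idempotent over [L] with the same row [w *m e] exists
    ([descend_hom], [radrow_lift_idem]) and its image is a form of [V] over [L]
    ([radrow_iso]).  Write [X] as the direct sum of [V] and a family [X2], which
    is unique up to isomorphism by cancellation ([mxdsum_cancel]).  Then [X] is
    defined over [L] if and only if [w *m e] has entries in [L] and [X2] is
    defined over [L], and the induction hypothesis applies to [X2]. *)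

(** * Nilpotent matrices *)

Definition nilmx (k : fieldType) n (x : 'M[k]_n) : Prop := exists e, x ^+ e = 0.

Section Nilpotent.
Variables (k : fieldType).

Lemma nilmxC m n (a : 'M[k]_(m, n)) (b : 'M[k]_(n, m)) :
  nilmx (a *m b) -> nilmx (b *m a).
Proof.
case=> e h; exists e.+1.
suff -> : (b *m a) ^+ e.+1 = b *m (a *m b) ^+ e *m a by rewrite h mulmx0 mul0mx.
elim: e {h} => [|e IH]; first by rewrite expr1 expr0 mulmx1.
by rewrite exprS IH exprS -!mulmxE !mulmxA.
Qed.

Lemma nil_unitmx n (x : 'M[k]_n) : nilmx x -> 1%:M + x \in unitmx.
Proof.
case=> e h; apply: (@mulmx1_unit _ _ _ (\sum_(i < e) (- x) ^+ i) _).1.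
have := subrXX_comm e (esym (commr1 (- x))).
rewrite exprNn h mulr0 expr1n subr0 opprK => E; rewrite mulmxE.
apply: etrans (esym E); congr (_ * _).
by apply: eq_bigr => i _; rewrite expr1n mul1r.
Qed.

Lemma nil0mx n : nilmx (0 : 'M[k]_n).
Proof. by exists 1%N; rewrite expr1. Qed.

(** Fitting's lemma: [x *m y] projects onto the part where [x] is invertible,
    along the part where [x] is nilpotent.  Writing the characteristic polynomial
    as [g * 'X^a] with [g.[0] != 0], the idempotent comes from a Bezout relation
    between ['X^(a.+1)] and [g].  As [y] is a polynomial in [x], it commutes with
    all that commutes with [x]; this makes it an endomorphism when [x] is. *)
Lemma fitting n (x : 'M[k]_n) : exists y : 'M[k]_n,
  [/\ x *m y = y *m x, x *m y *m (x *m y) = x *m y,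
      nilmx ((1%:M - x *m y) *m x)
    & forall t, comm_mx t x -> comm_mx t y].
Proof.
case: n x => [|n] x.
  exists 0; split; rewrite ?mulmx0 ?mul0mx //; first by exists 1%N; exact: flatmx0.
  by move=> t _; rewrite /comm_mx mulmx0 mul0mx.
have nz : char_poly x != 0 by rewrite monic_neq0 // char_poly_monic.
have [a [g g0 Eg]] := multiplicity_XsubC (char_poly x) 0.
move: g0; rewrite nz subr0 /= in Eg * => g0.
have cop : coprimep ('X^(a.+1)) g.
  by rewrite coprimep_expl // coprimep_sym -[X in coprimep _ X]subr0 -polyC0 coprimep_XsubC.
have [[u v] uv] : exists uv : {poly k} * {poly k}, uv.1 * 'X^(a.+1) + uv.2 * g = 1.
  by apply/Bezout_eq1_coprimepP.
rewrite /= in uv.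
pose H := horner_mx x.
have CH : H (g * 'X^a) = 0 by rewrite -Eg; exact: Cayley_Hamilton.
have xH p : x *m H p = H ('X * p) by rewrite /H rmorphM /= horner_mx_X mulmxE.
have Hx p : H p *m x = H (p * 'X) by rewrite /H rmorphM /= horner_mx_X mulmxE.
have HM p q : H p *m H q = H (p * q) by rewrite /H rmorphM mulmxE.
have HXn p e : H p ^+ e = H (p ^+ e) by rewrite /H rmorphXn.
have Hf : x *m H (u * 'X^a) = H (u * 'X^(a.+1)) by rewrite xH exprS mulrCA.
have H1f : 1%:M - x *m H (u * 'X^a) = H (v * g).
  rewrite Hf; have <- : H 1 = 1%:M by rewrite /H rmorph1.
  by rewrite -rmorphB -uv addrC addKr.
exists (H (u * 'X^a)); split.
- by rewrite xH Hx mulrC.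
- apply/eqP; rewrite -subr_eq0 -[X in _ - X]mulmx1 -mulmxBr -opprB mulmxN oppr_eq0.
  rewrite H1f Hf HM.
  have -> : u * 'X^(a.+1) * (v * g) = (u * v * 'X) * (g * 'X^a) by rewrite exprS; ring.
  by rewrite -HM CH mulmx0.
- exists a.+1; rewrite H1f Hx -[LHS]/(H (v * g * 'X) ^+ a.+1) HXn.
  have -> : (v * g * 'X) ^+ a.+1 = (v ^+ a.+1 * g ^+ a * 'X) * (g * 'X^a).
    by rewrite !exprMn !exprS; ring.
  by rewrite -HM CH mulmx0.
- by move=> t ht; apply: comm_mx_horner.
Qed.

End Nilpotent.

(** * Families of matrices as modules *)

(** Vectors are rows and endomorphisms act on the right, so [X] is a module
    with generators acting by [X i], and [a] is linear when it intertwines them. *)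
Definition mxhom (k : fieldType) (I : Type) m n (X : I -> 'M[k]_m)
  (Y : I -> 'M[k]_n) (a : 'M[k]_(m, n)) : Prop :=
  forall i, X i *m a = a *m Y i.

Definition mxiso (k : fieldType) (I : Type) m n (X : I -> 'M[k]_m)
  (Y : I -> 'M[k]_n) : Prop :=
  exists (a : 'M[k]_(m, n)) (b : 'M[k]_(n, m)),
    [/\ mxhom X Y a, mxhom Y X b, a *m b = 1%:M & b *m a = 1%:M].

(** The sum is a relation, given by inclusions and projections, because
    complements are known only up to isomorphism. *)
Definition mxdsum (k : fieldType) (I : Type) n n1 n2 (X : I -> 'M[k]_n)
  (X1 : I -> 'M[k]_n1) (X2 : I -> 'M[k]_n2) : Prop :=
  exists (a : 'M[k]_(n1, n)) (a' : 'M[k]_(n, n1))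
         (b : 'M[k]_(n2, n)) (b' : 'M[k]_(n, n2)),
    [/\ mxhom X1 X a, mxhom X X1 a', mxhom X2 X b & mxhom X X2 b'] /\
    [/\ a *m a' = 1%:M, b *m b' = 1%:M, a *m b' = 0, b *m a' = 0
      & a' *m a + b' *m b = 1%:M].

Definition mapfam (k K : fieldType) (f : {rmorphism k -> K}) (I : Type) n
  (X : I -> 'M[k]_n) : I -> 'M[K]_n := fun i => map_mx f (X i).

Section Hom.
Variables (k : fieldType) (I : Type).

Section Two.
Variables (m n : nat) (X : I -> 'M[k]_m) (Y : I -> 'M[k]_n).

Lemma mxhom0 : mxhom X Y 0.
Proof. by move=> i; rewrite mulmx0 mul0mx. Qed.
Lemma mxhomD a b : mxhom X Y a -> mxhom X Y b -> mxhom X Y (a + b).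
Proof. by move=> ha hb i; rewrite mulmxDl mulmxDr ha hb. Qed.
Lemma mxhomN a : mxhom X Y a -> mxhom X Y (- a).
Proof. by move=> ha i; rewrite mulmxN mulNmx ha. Qed.
Lemma mxhomB a b : mxhom X Y a -> mxhom X Y b -> mxhom X Y (a - b).
Proof. by move=> ha hb; apply: mxhomD (mxhomN hb). Qed.
Lemma mxhomZ c a : mxhom X Y a -> mxhom X Y (c *: a).
Proof. by move=> ha i; rewrite -scalemxAr -scalemxAl ha. Qed.
Lemma mxhom_sum (J : finType) (F : J -> 'M[k]_(m, n)) :
  (forall j, mxhom X Y (F j)) -> mxhom X Y (\sum_j F j).
Proof. by move=> h; apply: big_ind => //; [exact: mxhom0 | exact: mxhomD]. Qed.
End Two.

Lemma mxhom1 n (X : I -> 'M[k]_n) : mxhom X X 1%:M.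
Proof. by move=> i; rewrite mulmx1 mul1mx. Qed.

Lemma mxhomM m n p (X : I -> 'M[k]_m) (Y : I -> 'M[k]_n) (Z : I -> 'M[k]_p) a b :
  mxhom X Y a -> mxhom Y Z b -> mxhom X Z (a *m b).
Proof. by move=> ha hb i; rewrite mulmxA ha -!mulmxA hb. Qed.

Lemma mxhomV n (X : I -> 'M[k]_n) a : mxhom X X a -> mxhom X X (invmx a).
Proof.
move=> ha; case: (boolP (a \in unitmx)) => [ua i|ua]; last by rewrite /invmx (negbTE ua).
by rewrite -[LHS](mulKmx ua) (mulmxA a) -ha -mulmxA mulmxV // mulmx1.
Qed.

Lemma mxhom_fitting n (X : I -> 'M[k]_n) (x : 'M[k]_n) : mxhom X X x ->
  exists y : 'M[k]_n, let f := x *m y in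
  [/\ mxhom X X y, x *m y = y *m x, f *m f = f & nilmx ((1%:M - f) *m x)].
Proof.
move=> hx; have [y [h1 h2 h3 h4]] := fitting x; exists y; split=> //.
by move=> i; apply: h4; exact: hx.
Qed.

Lemma mxiso_refl n (X : I -> 'M[k]_n) : mxiso X X.
Proof. by exists 1%:M, 1%:M; rewrite mulmx1; split=> //; apply: mxhom1. Qed.

Lemma mxiso_sym m n (X : I -> 'M[k]_m) (Y : I -> 'M[k]_n) : mxiso X Y -> mxiso Y X.
Proof. by case=> a [b [*]]; exists b, a. Qed.

(** Used to recognize isomorphisms between images of idempotents, where both
    composites are only known to be invertible. *)
Lemma mxiso_unit m n (X : I -> 'M[k]_m) (Y : I -> 'M[k]_n) a b :
  mxhom X Y a -> mxhom Y X b -> a *m b \in unitmx -> b *m a \in unitmx -> mxiso X Y.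
Proof.
move=> ha hb u1 u2; exists a, (b *m invmx (a *m b)).
have hb' : mxhom Y X (b *m invmx (a *m b)) by apply: mxhomM hb (mxhomV (mxhomM ha hb)).
split=> //; first by rewrite mulmxA mulmxV.
have E : a *m (b *m invmx (a *m b)) = 1%:M by rewrite mulmxA mulmxV.
apply: (can_inj (mulKmx u2)).
by rewrite mulmx1 mulmxA -(mulmxA b a) E mulmx1.
Qed.

(** The rank factorization of an idempotent gives the inclusion and the
    projection of its image. *)
Lemma mxhom_split n (X : I -> 'M[k]_n) E : mxhom X X E -> E *m E = E ->
  exists (Z : I -> 'M[k]_(\rank E)) (i : 'M_(\rank E, n)) (p : 'M_(n, \rank E)),
    [/\ mxhom Z X i, mxhom X Z p, i *m p = 1%:M & p *m i = E].
Proof.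
move=> hE EE.
have [i [p [pi ri cp]]] : exists (i : 'M_(\rank E, n)) (p : 'M_(n, \rank E)),
    [/\ p *m i = E, row_free i & row_full p].
  by exists (row_base E), (col_base E); rewrite mulmx_base row_base_free col_base_full.
have ip : i *m p = 1%:M.
  apply: (row_full_inj cp); apply: (row_free_inj ri) => /=.
  by rewrite mulmx1 pi !mulmxA pi -mulmxA pi EE.
have iE : i *m E = i by rewrite -[X in _ *m X]pi mulmxA ip mul1mx.
have Ep : E *m p = p by rewrite -[X in X *m _]pi -mulmxA ip mulmx1.
exists (fun t => i *m X t *m p), i, p; split=> // t.
- by rewrite -!mulmxA pi hE mulmxA iE.
- by rewrite !mulmxA pi -hE -mulmxA Ep.
Qed.
End Hom.

Lemma mxhom_map (k K : fieldType) (f : {rmorphism k -> K}) (I : Type) m n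
    (X : I -> 'M[k]_m) (Y : I -> 'M[k]_n) a :
  mxhom X Y a -> mxhom (mapfam f X) (mapfam f Y) (map_mx f a).
Proof. by move=> h i; rewrite /mapfam -!map_mxM h. Qed.

Section DirectSum.
Variables (k : fieldType) (I : Type).

Lemma mxdsum_isol n n1 m1 n2 (X : I -> 'M[k]_n) (X1 : I -> 'M[k]_n1)
    (Y1 : I -> 'M[k]_m1) (X2 : I -> 'M[k]_n2) :
  mxiso X1 Y1 -> mxdsum X X1 X2 -> mxdsum X Y1 X2.
Proof.
move=> [c [d [hc hd cd dc]]] [a [a' [b [b' [[ha ha' hb hb'] [e1 e2 e3 e4 e5]]]]]].
exists (d *m a), (a' *m c), b, b'; split; split=> //.
- exact: mxhomM hd ha.
- exact: mxhomM ha' hc.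
- by rewrite mulmxA -(mulmxA d) e1 mulmx1.
- by rewrite -mulmxA e3 mulmx0.
- by rewrite mulmxA e4 mul0mx.
- by rewrite mulmxA -(mulmxA a') cd mulmx1.
Qed.

Lemma mxdsum_iso n m n1 n2 (X : I -> 'M[k]_n) (Y : I -> 'M[k]_m)
    (X1 : I -> 'M[k]_n1) (X2 : I -> 'M[k]_n2) :
  mxiso X Y -> mxdsum X X1 X2 -> mxdsum Y X1 X2.
Proof.
move=> [c [d [hc hd cd dc]]] [a [a' [b [b' [[ha ha' hb hb'] [e1 e2 e3 e4 e5]]]]]].
exists (a *m c), (d *m a'), (b *m c), (d *m b'); split; split.
- exact: mxhomM ha hc.
- exact: mxhomM hd ha'.
- exact: mxhomM hb hc.
- exact: mxhomM hd hb'.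
- by rewrite mulmxA -(mulmxA a) cd mulmx1.
- by rewrite mulmxA -(mulmxA b) cd mulmx1.
- by rewrite mulmxA -(mulmxA a) cd mulmx1.
- by rewrite mulmxA -(mulmxA b) cd mulmx1.
- by rewrite !mulmxA -mulmxDl -!(mulmxA d) -mulmxDr e5 mulmx1 dc.
Qed.

Lemma mxdsum_sym n n1 n2 (X : I -> 'M[k]_n)
    (X1 : I -> 'M[k]_n1) (X2 : I -> 'M[k]_n2) :
  mxdsum X X1 X2 -> mxdsum X X2 X1.
Proof.
move=> [a [a' [b [b' [[ha ha' hb hb'] [e1 e2 e3 e4 e5]]]]]].
by exists b, b', a, a'; split; split=> //; rewrite addrC.
Qed.

Lemma mxdsum_unique n m n1 n2 (X : I -> 'M[k]_n) (Y : I -> 'M[k]_m)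
    (X1 : I -> 'M[k]_n1) (X2 : I -> 'M[k]_n2) :
  mxdsum X X1 X2 -> mxdsum Y X1 X2 -> mxiso X Y.
Proof.
move=> [a [a' [b [b' [[ha ha' hb hb'] [e1 e2 e3 e4 e5]]]]]].
move=> [c [c' [d [d' [[hc hc' hd hd'] [f1 f2 f3 f4 f5]]]]]].
exists (a' *m c + b' *m d), (c' *m a + d' *m b); split.
- by apply: mxhomD; [apply: mxhomM ha' hc | apply: mxhomM hb' hd].
- by apply: mxhomD; [apply: mxhomM hc' ha | apply: mxhomM hd' hb].
- rewrite mulmxDl !mulmxDr !mulmxA -!(mulmxA a') -!(mulmxA b') f1 f2 f3 f4.
  by rewrite !(mulmx1, mul1mx, mulmx0, mul0mx) addr0 add0r.
- rewrite mulmxDl !mulmxDr !mulmxA -!(mulmxA c') -!(mulmxA d') e1 e2 e3 e4.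
  by rewrite !(mulmx1, mul1mx, mulmx0, mul0mx) addr0 add0r.
Qed.

Lemma mxdsum_block n1 n2 (X1 : I -> 'M[k]_n1) (X2 : I -> 'M[k]_n2) :
  mxdsum (fun i => block_mx (X1 i) 0 0 (X2 i)) X1 X2.
Proof.
exists (row_mx 1%:M 0), (col_mx 1%:M 0), (row_mx 0 1%:M), (col_mx 0 1%:M).
split; split; try (move=> i);
  rewrite ?mul_mx_row ?mul_col_mx ?mul_row_block ?mul_block_col ?mul_row_col;
  rewrite ?(mulmx0, mul0mx, mulmx1, mul1mx, addr0, add0r) //.
by rewrite add_row_mx !add_col_mx !(addr0, add0r) scalar_mx_block block_mxEh.
Qed.

(** A retract is a summand: its complement is the image of [1%:M - p *m i].
    The bound on the size makes induction on the size possible. *)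
Lemma mxdsum_split n (X : I -> 'M[k]_n) r (V : I -> 'M[k]_r) i p :
  mxhom V X i -> mxhom X V p -> i *m p = 1%:M ->
  exists s (Z : I -> 'M[k]_s), mxdsum X V Z /\ ((0 < r)%N -> (s < n)%N).
Proof.
move=> hi hp ip; pose E := p *m i.
have EE : E *m E = E by rewrite /E mulmxA -(mulmxA p) ip mulmx1.
have hE : mxhom X X (1%:M - E) by apply: mxhomB (@mxhom1 _ _ _ X) (mxhomM hp hi).
have EE1 : (1%:M - E) *m (1%:M - E) = 1%:M - E.
  by rewrite mulmxBl mul1mx mulmxBr mulmx1 EE subrr subr0.
have [Z [j [q [hj hq jq qj]]]] := mxhom_split hE EE1.
have iE : i *m (1%:M - E) = 0 by rewrite mulmxBr mulmx1 /E mulmxA ip mul1mx subrr.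
have Ep : (1%:M - E) *m p = 0 by rewrite mulmxBl mul1mx /E -mulmxA ip mulmx1 subrr.
exists (\rank (1%:M - E)), Z; split.
  exists i, p, j, q; split; split=> //.
  - have -> : i *m q = i *m (q *m j) *m q by rewrite -!mulmxA jq mulmx1.
    by rewrite qj iE mul0mx.
  - have -> : j *m p = j *m (q *m j *m p) by rewrite !mulmxA jq mul1mx.
    by rewrite qj Ep mulmx0.
  - by rewrite qj addrC subrK.
move=> r0; rewrite ltn_neqAle rank_leq_row andbT; apply/negP => /eqP rk.
have fr : row_free (1%:M - E) by apply/eqP.
have p0 : p = 0.
  have u : (1%:M - E) \in unitmx by rewrite -row_free_unit.
  by rewrite -[p](mulKmx u) Ep mulmx0.
move: ip; rewrite p0 mulmx0 => /matrixP /(_ (Ordinal r0) (Ordinal r0)).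
by rewrite !mxE eqxx => /esym /eqP; rewrite oner_eq0.
Qed.
End DirectSum.

(** * Cancellation *)
Section Cancellation.
Variables (k : fieldType) (I : Type).

(** The nilpotent endomorphisms form a two-sided ideal, which is then the
    radical of [End V]; the product in the other order is covered by [nilmxC]. *)
Definition nil_ideal r (V : I -> 'M[k]_r) : Prop :=
  forall x y, mxhom V V x -> mxhom V V y -> nilmx x ->
    (nilmx y -> nilmx (x + y)) /\ nilmx (x *m y).

(** The stable range 1 property of [End V].  Adding to [x] the projection onto its
    nilpotent part gives a unit modulo the radical, and the remaining term
    [x *m x' *m (1%:M - f)] is in the radical. *)
Lemma stable_range r (V : I -> 'M[k]_r) x x' : nil_ideal V ->
  mxhom V V x -> mxhom V V x' ->
  exists2 s, mxhom V V s & x + (1%:M - x *m x') *m s \in unitmx.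
Proof.
move=> red hx hx'; have [y] := mxhom_fitting hx.
set f := x *m y => - [hy yx ff nil1].
have hf : mxhom V V f by exact: mxhomM.
have h1 := @mxhom1 _ _ _ V.
have h1f : mxhom V V (1%:M - f) by apply: mxhomB.
have fx : f *m x = x *m f by rewrite /f -mulmxA -yx.
exists (1%:M - f) => //.
pose z := f *m y + (1%:M - f).
have hz : mxhom V V z by apply: mxhomD => //; apply: mxhomM.
pose n1 := x *m x' *m (1%:M - f); pose n2 := (1%:M - f) *m x.
have nn1 : nilmx n1.
  apply: nilmxC; rewrite mulmxA.
  by apply: (red _ _ _ hx' nil1).2; apply: mxhomM.
have hn1 : mxhom V V n1 by apply: mxhomM => //; apply: mxhomM.
have hn2 : mxhom V V n2 by apply: mxhomM.
have E : (x + (1%:M - x *m x') *m (1%:M - f)) *m z = 1%:M + (n2 + (- n1) *m z).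
  have e1 : (x + (1%:M - f)) *m z = 1%:M + n2.
    have xfy : x *m (f *m y) = f by rewrite mulmxA -fx -mulmxA -/f ff.
    have xg : x *m (1%:M - f) = n2 by rewrite /n2 mulmxBl mulmxBr mulmx1 mul1mx fx.
    have gfy : (1%:M - f) *m (f *m y) = 0 by rewrite mulmxA mulmxBl mul1mx ff subrr mul0mx.
    have gg : (1%:M - f) *m (1%:M - f) = 1%:M - f.
      by rewrite mulmxBl mul1mx mulmxBr mulmx1 ff subrr subr0.
    rewrite /z mulmxDl !(mulmxDr _ (f *m y)) xfy xg gfy gg add0r.
    by rewrite addrC addrA subrK addrC.
  rewrite [in LHS]mulmxBl mul1mx -/n1 addrA mulmxDl e1 mulNmx -addrA.
  by [].
have nn : nilmx (n2 + - n1 *m z).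
  have hN : mxhom V V (- n1) by apply: mxhomN.
  have nN : nilmx (- n1).
    have := (red _ _ hn1 (mxhomN h1) nn1).2.
    by rewrite mulmxN mulmx1.
  apply: (red _ _ hn2 _ nil1).1; first exact: mxhomM.
  exact: (red _ _ hN hz nN).2.
have := nil_unitmx nn; rewrite -E unitmx_mul.
by case/andP.
Qed.

(** If the composite of the inclusion of [V] in one decomposition with the
    projection to [V] of the other is invertible, then the Schur complement of
    that corner is an isomorphism between the two complements of [V]. *)
Lemma schur_iso n r n1 n2 (X : I -> 'M[k]_n) (V : I -> 'M[k]_r)
    (X1 : I -> 'M[k]_n1) (X2 : I -> 'M[k]_n2) a a' b b' c c' d d' :
  [/\ mxhom V X a, mxhom X1 X b & mxhom X X1 b'] ->
  [/\ b *m b' = 1%:M, a *m b' = 0, b *m a' = 0 & a' *m a + b' *m b = 1%:M] ->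
  [/\ mxhom X V c', mxhom X2 X d & mxhom X X2 d'] ->
  [/\ d *m d' = 1%:M, c *m d' = 0, d *m c' = 0 & c' *m c + d' *m d = 1%:M] ->
  a *m c' \in unitmx -> mxiso X1 X2.
Proof.
move=> [ha hb hb'] [e2 e3 e4 e5] [hc' hd hd'] [f2 f3 f4 f5].
have hu : mxhom V V (a *m c') by exact: mxhomM ha hc'.
move: hu (erefl (a *m c')); move: {1 3 4}(a *m c') => u hu uE uu.
have hiu := mxhomV hu.
pose t := b *m d' - b *m c' *m invmx u *m (a *m d').
have ht : mxhom X1 X2 t.
  apply: mxhomB; first exact: mxhomM hb hd'.
  exact: mxhomM (mxhomM (mxhomM hb hc') hiu) (mxhomM ha hd').
have bd : d' *m d = 1%:M - c' *m c by rewrite -f5 addrC addKr.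
have bb : b' *m b = 1%:M - a' *m a by rewrite -e5 addrC addKr.
exists t, (d *m b'); split=> //; first exact: mxhomM hd hb'.
- rewrite /t mulmxBl.
  have -> : b *m d' *m (d *m b') = 1%:M - b *m c' *m (c *m b').
    rewrite mulmxA -(mulmxA b d') bd mulmxBr mulmx1 mulmxBl e2.
    by rewrite !mulmxA.
  have -> : b *m c' *m invmx u *m (a *m d') *m (d *m b') =
            - (b *m c' *m (c *m b')).
    rewrite -(mulmxA _ (a *m d')) (mulmxA (a *m d')) -(mulmxA a d') bd.
    rewrite mulmxBr mulmx1 mulmxBl e3 sub0r mulmxN; congr (- _).
    by rewrite (mulmxA a) uE -!mulmxA (mulmxA (invmx u)) mulVmx // mul1mx.
  by rewrite opprK subrK.
- rewrite /t mulmxBr.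
  have -> : d *m b' *m (b *m d') = 1%:M - d *m a' *m (a *m d').
    rewrite mulmxA -(mulmxA d b') bb mulmxBr mulmx1 mulmxBl f2.
    by rewrite !mulmxA.
  have -> : d *m b' *m (b *m c' *m invmx u *m (a *m d')) =
            - (d *m a' *m (a *m d')).
    rewrite -!(mulmxA (b *m c')) (mulmxA (d *m b')) (mulmxA (d *m b')).
    rewrite -(mulmxA d b') bb mulmxBr mulmx1 mulmxBl f4 sub0r.
    rewrite mulNmx; congr (- _); rewrite -!mulmxA (mulmxA a c') uE.
    by rewrite (mulmxA u) mulmxV // mul1mx.
  by rewrite opprK subrK.
Qed.

(** Two decompositions give [a *m c0 : V -> V], which need not be invertible;
    stable range 1 allows the second projection [c0] to be changed by a map [g]
    through the complement so that it becomes invertible. *)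
Theorem mxdsum_cancel n r n1 n2 (X : I -> 'M[k]_n) (V : I -> 'M[k]_r)
    (X1 : I -> 'M[k]_n1) (X2 : I -> 'M[k]_n2) : nil_ideal V ->
  mxdsum X V X1 -> mxdsum X V X2 -> mxiso X1 X2.
Proof.
move=> red [a [a' [b [b' [[ha ha' hb hb'] [e1 e2 e3 e4 e5]]]]]].
move=> [c [c0 [d0 [d' [[hc hc0 hd0 hd'] [f1 f2 f3 f4 f5]]]]]].
have [s hs us] := stable_range red (mxhomM ha hc0) (mxhomM hc ha').
have [g gE] : exists g, g = d0 *m a' *m s by exists (d0 *m a' *m s).
have hg : mxhom X2 V g by rewrite gE; exact: mxhomM (mxhomM hd0 ha') hs.
have cc' : c *m (c0 + d' *m g) = 1%:M.
  by rewrite mulmxDr f1 mulmxA f3 mul0mx addr0.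
apply: (@schur_iso n r n1 n2 X V X1 X2 a a' b b' c (c0 + d' *m g) (d0 - g *m c) d') => //.
- split=> //; first by apply: mxhomD => //; exact: mxhomM hd' hg.
  by apply: mxhomB => //; exact: mxhomM hg hc.
- split=> //.
  + by rewrite mulmxBl f2 -mulmxA f3 mulmx0 subr0.
  + by rewrite mulmxBl -mulmxA cc' mulmx1 mulmxDr f4 add0r mulmxA f2 mul1mx subrr.
  + rewrite -[RHS]f5 mulmxDl mulmxBr -mulmxA -addrA; congr (_ + _).
    by rewrite addrC subrK.
- have E : d' *m d0 = 1%:M - c0 *m c by rewrite -f5 addrC addKr.
  suff -> : a *m (c0 + d' *m g) = a *m c0 + (1%:M - a *m c0 *m (c *m a')) *m s by [].
  rewrite mulmxDr gE !mulmxA; congr (_ + _ *m s).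
  by rewrite -(mulmxA a d') E mulmxBr mulmx1 mulmxBl e1 !mulmxA.
Qed.
End Cancellation.

(** * Expansion of matrices along a free family of scalars *)

Definition freefam (k K : fieldType) (f : {rmorphism k -> K}) s (b : 'I_s -> K) :=
  forall c : 'I_s -> k, \sum_i f (c i) * b i = 0 -> forall i, c i = 0.

Section Expand.
Variables (k K : fieldType) (f : {rmorphism k -> K}).

Lemma freefam_mx s (b : 'I_s -> K) p q (B : 'I_s -> 'M[k]_(p, q)) :
  freefam f b -> \sum_l b l *: map_mx f (B l) = 0 -> forall l, B l = 0.
Proof.
move=> fb h l; apply/matrixP => i j; rewrite mxE.
apply: (fb (fun l => B l i j)); move/matrixP/(_ i j): h; rewrite summxE [RHS]mxE => h; apply: etrans h.
by apply: eq_bigr => t _; rewrite !mxE mulrC.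
Qed.

(** An expansion with the smallest number of terms has free scalars, since a
    relation would eliminate a term. *)
Lemma expand_mx p q (A : 'M[K]_(p, q)) :
  exists s (b : 'I_s -> K) (B : 'I_s -> 'M[k]_(p, q)),
    freefam f b /\ A = \sum_l b l *: map_mx f (B l).
Proof.
pose P s := `[< exists (b : 'I_s -> K) (B : 'I_s -> 'M[k]_(p, q)),
    A = \sum_l b l *: map_mx f (B l) >].
have exP : exists s, P s.
  exists #|{: 'I_p * 'I_q}|; apply/asboolP.
  exists (fun l => A (enum_val l).1 (enum_val l).2).
  exists (fun l => delta_mx (enum_val l).1 (enum_val l).2).
  rewrite [LHS]matrix_sum_delta pair_bigA /= (reindex _ (onW_bij _ (enum_val_bij _))) /=.
  by apply: eq_bigr => l _; rewrite map_delta_mx.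
case: (ex_minnP exP) => s /asboolP [b [B AE]] smin.
exists s, b, B; split=> // c c0 i0; apply/eqP/negPn/negP => ci0.
case: s b B AE smin c c0 i0 ci0 => [|s] b B AE smin c c0 i0 ci0; first by case: i0 ci0.
suff /smin : P s by rewrite ltnn.
apply/asboolP; exists (fun l => b (lift i0 l)).
exists (fun l => B (lift i0 l) - (c (lift i0 l) / c i0) *: B i0).
have bE : b i0 = - \sum_l f (c (lift i0 l) / c i0) * b (lift i0 l).
  have fc : f (c i0) != 0 by rewrite fmorph_eq0.
  apply: (mulfI fc); rewrite mulrN mulr_sumr.
  move: c0; rewrite (bigD1_ord i0) //= => /eqP; rewrite addr_eq0 => /eqP ->; congr (- _).
  by apply: eq_bigr => l _; rewrite fmorph_div mulrA; congr (_ * _); rewrite mulrC divfK.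
rewrite AE (bigD1_ord i0) //= bE scaleNr scaler_suml addrC -sumrB.
apply: eq_bigr => l _; rewrite map_mxB map_mxZ scalerBr; congr (_ - _).
by rewrite scalerA mulrC.
Qed.

(** Homomorphisms commute with extension of scalars: the equations that define
    them have coefficients in [k], so they hold for each component. *)
Lemma expand_hom (I : Type) p q (X : I -> 'M[k]_p) (Y : I -> 'M[k]_q) (A : 'M[K]_(p, q)) :
  mxhom (mapfam f X) (mapfam f Y) A ->
  exists s (b : 'I_s -> K) (B : 'I_s -> 'M[k]_(p, q)),
    [/\ freefam f b, (forall l, mxhom X Y (B l)) & A = \sum_l b l *: map_mx f (B l)].
Proof.
move=> hA; have [s [b [B [fb AE]]]] := expand_mx A; exists s, b, B; split=> // l i.
apply/eqP; rewrite -subr_eq0; apply/eqP; move: l.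
apply: (freefam_mx fb); under eq_bigr do rewrite map_mxB !map_mxM scalerBr.
rewrite sumrB.
have -> : \sum_l b l *: (map_mx f (X i) *m map_mx f (B l)) = mapfam f X i *m A.
  by rewrite AE mulmx_sumr; apply: eq_bigr => l _; rewrite scalemxAr.
have -> : \sum_l b l *: (map_mx f (B l) *m map_mx f (Y i)) = A *m mapfam f Y i.
  by rewrite AE mulmx_suml; apply: eq_bigr => l _; rewrite scalemxAl.
by rewrite hA subrr.
Qed.

(** The conditions on [B] form a linear system over [k], solvable over [K].  The
    matrix [A] is expanded together with the scalar 1, put below it as a row:
    a component where 1 has a nonzero coordinate [c l] gives a solution after
    division by [c l]. *)
Lemma descend_hom (I : Type) p q (X : I -> 'M[k]_p) (Y : I -> 'M[k]_q)
    (w : 'rV[k]_p) (u : 'rV[k]_q) (A : 'M[K]_(p, q)) :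
  mxhom (mapfam f X) (mapfam f Y) A -> map_mx f w *m A = map_mx f u ->
  exists2 B, mxhom X Y B & w *m B = u.
Proof.
move=> hA wA.
have [s [b [B [fb E]]]] := expand_mx (col_mx A (const_mx 1 : 'rV_q)).
case: q Y u A hA wA B E => [|q] Y u A hA wA B E.
  by exists 0; [exact: mxhom0 | exact: thinmx0 || rewrite [LHS]thinmx0 [RHS]thinmx0].
pose B1 l := usubmx (B l); pose c l := dsubmx (B l) 0 0.
have A1 : A = \sum_l b l *: map_mx f (B1 l).
  have -> : A = usubmx (col_mx A (const_mx 1 : 'rV_q.+1)) by rewrite col_mxKu.
  by rewrite E linear_sum; apply: eq_bigr => l _; rewrite linearZ /= map_usubmx.
have h1 l : mxhom X Y (B1 l).
  move=> i; apply/eqP; rewrite -subr_eq0; apply/eqP; move: l.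
  apply: (freefam_mx fb); under eq_bigr do rewrite map_mxB !map_mxM scalerBr.
  rewrite sumrB.
  have -> : \sum_l b l *: (map_mx f (X i) *m map_mx f (B1 l)) = mapfam f X i *m A.
    by rewrite A1 mulmx_sumr; apply: eq_bigr => l _; rewrite scalemxAr.
  have -> : \sum_l b l *: (map_mx f (B1 l) *m map_mx f (Y i)) = A *m mapfam f Y i.
    by rewrite A1 mulmx_suml; apply: eq_bigr => l _; rewrite scalemxAl.
  by rewrite hA subrr.
have c1 : 1 = \sum_l b l * f (c l).
  have -> : 1 = dsubmx (col_mx A (const_mx 1 : 'rV_q.+1)) 0 0 by rewrite col_mxKd mxE.
  rewrite E linear_sum summxE; apply: eq_bigr => l _.
  by rewrite linearZ /= mxE; congr (_ * _); rewrite /c !mxE.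
have wB l : w *m B1 l = c l *: u.
  apply/eqP; rewrite -subr_eq0; apply/eqP; move: l.
  apply: (freefam_mx fb); under eq_bigr do rewrite map_mxB map_mxM map_mxZ scalerBr.
  rewrite sumrB.
  have -> : \sum_l b l *: (map_mx f w *m map_mx f (B1 l)) = map_mx f w *m A.
    by rewrite A1 mulmx_sumr; apply: eq_bigr => l _; rewrite scalemxAr.
  have -> : \sum_l b l *: (f (c l) *: map_mx f u) = map_mx f u.
    by rewrite -[RHS]scale1r [in RHS]c1 scaler_suml; apply: eq_bigr => l _; rewrite scalerA.
  by rewrite wA subrr.
have [l0 cl0] : exists l, c l != 0.
  apply: contrapT => h; have /eqP := c1; rewrite big1 ?oner_eq0 // => l _.
  case: (eqVneq (c l) 0) => [->|cl]; first by rewrite rmorph0 mulr0.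
  by case: h; exists l.
exists ((c l0)^-1 *: B1 l0); first exact: mxhomZ.
by rewrite -scalemxAr wB scalerA mulVf // scale1r.
Qed.
End Expand.

(** * Rows that detect the radical of an endomorphism ring *)
Section RadicalRow.
Variables (k : fieldType) (I : Type) (N : nat) (Y : I -> 'M[k]_N) (w : 'rV[k]_N).

(** A linear test for membership in the radical: the nilpotent endomorphisms are
    those that kill [w].  In particular [End Y] is reduced modulo its radical. *)
Definition radrow := forall x, mxhom Y Y x -> (nilmx x <-> w *m x = 0).

Hypothesis hw : radrow.

(** The kernel of [w] is a right ideal of [End Y], and the nilpotency that
    describes it is symmetric, so it is a two-sided ideal. *)
Lemma radrowM x y : mxhom Y Y x -> mxhom Y Y y -> w *m x = 0 ->
  w *m (x *m y) = 0 /\ w *m (y *m x) = 0.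
Proof.
move=> hx hy wx; have wxy : w *m (x *m y) = 0 by rewrite mulmxA wx mul0mx.
split=> //; apply/(hw (mxhomM hy hx)); apply: nilmxC.
by apply/(hw (mxhomM hx hy)).
Qed.

(** The endomorphisms of a retract [V] of [Y] are a corner of [End Y], so the
    radical of [End V] is detected by the same row. *)
Lemma radrow_corner r (V : I -> 'M[k]_r) i p :
  mxhom V Y i -> mxhom Y V p -> i *m p = 1%:M -> nil_ideal V.
Proof.
move=> hi hp ip.
pose L (x : 'M[k]_r) := p *m x *m i.
have hL x : mxhom V V x -> mxhom Y Y (L x).
  by move=> hx; apply: mxhomM (mxhomM hp hx) hi.
have LM x y : L x *m L y = L (x *m y).
  by rewrite /L -!mulmxA (mulmxA i) ip mul1mx.
have LX x e : L x ^+ e.+1 = L (x ^+ e.+1).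
  elim: e => [|e IH]; first by rewrite !expr1.
  by rewrite exprS IH -mulmxE LM mulmxE -exprS.
have nL x : mxhom V V x -> nilmx x <-> w *m L x = 0.
  move=> hx; split=> [[e h]|wx].
    apply/(hw (hL _ hx)); exists e.+1.
    by rewrite LX exprS h mulr0 /L mulmx0 mul0mx.
  have [e h] := (hw (hL _ hx)).2 wx; exists e.+1.
  have E : L (x ^+ e.+1) = 0 by rewrite -LX exprS h mulr0.
  have -> : x ^+ e.+1 = i *m L (x ^+ e.+1) *m p.
    by rewrite /L !mulmxA ip mul1mx -mulmxA ip mulmx1.
  by rewrite E mulmx0 mul0mx.
move=> x y hx hy nx; have wx := (nL _ hx).1 nx; split.
  move=> ny; have wy := (nL _ hy).1 ny.
  by apply/(nL _ (mxhomD hx hy)); rewrite /L mulmxDr mulmxDl mulmxDr wx wy addr0.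
apply/(nL _ (mxhomM hx hy)).
by rewrite -LM mulmxA wx mul0mx.
Qed.

(** The composites of the inclusions and projections of two images are the
    identity plus a nilpotent map when the idempotents agree modulo the radical. *)
Lemma radrow_iso r r' (V : I -> 'M[k]_r) (V' : I -> 'M[k]_r') i p i' p' :
  mxhom V Y i -> mxhom Y V p -> i *m p = 1%:M ->
  mxhom V' Y i' -> mxhom Y V' p' -> i' *m p' = 1%:M ->
  w *m (p *m i) = w *m (p' *m i') -> mxiso V V'.
Proof.
move=> hi hp ip hi' hp' ip' wE.
have h := mxhomM hp hi; have h' := mxhomM hp' hi'.
suff H q q' (Z : I -> 'M[k]_q) (Z' : I -> 'M[k]_q') j j' t t' :
    mxhom Z Y j -> mxhom Y Z t -> j *m t = 1%:M ->
    mxhom Z' Y j' -> mxhom Y Z' t' -> j' *m t' = 1%:M ->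
    w *m (t *m j) = w *m (t' *m j') -> j *m t' *m (j' *m t) \in unitmx.
  apply: (mxiso_unit (mxhomM hi hp') (mxhomM hi' hp)).
    exact: (H _ _ V V').
  exact: (H _ _ V' V).
move=> hj ht jt hj' ht' jt' E.
pose n := t' *m j' - t *m j.
have hn : mxhom Y Y n by apply: mxhomB; [exact: mxhomM ht' hj' | exact: mxhomM ht hj].
have wn : w *m n = 0 by rewrite mulmxBr E subrr.
have -> : j *m t' *m (j' *m t) = 1%:M + j *m (n *m t).
  rewrite /n mulmxBl mulmxBr !mulmxA jt mul1mx jt -!mulmxA.
  by rewrite addrC subrK.
apply: nil_unitmx; apply: nilmxC; rewrite -mulmxA.
apply/hw; first exact: mxhomM hn (mxhomM ht hj).
by rewrite mulmxA wn mul0mx.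
Qed.
End RadicalRow.

(** * The largest multiplicity-free common summand *)
Section Linked.
Variables (k : fieldType) (I : Type).

(** The image of [e] is a summand of both [Y] and [X].  By the last condition
    every map of [Y] through [X] is, modulo the radical, absorbed by [e], so this
    image contains each indecomposable common summand.  Only the row [w] of the
    radical appears, so that the condition is preserved by extension of
    scalars. *)
Definition linked n N (X : I -> 'M[k]_n) (Y : I -> 'M[k]_N) (w : 'rV[k]_N) e :=
  [/\ e *m e = e,
      exists b a, [/\ mxhom Y X b, mxhom X Y a & e = b *m a]
    & forall b a, mxhom Y X b -> mxhom X Y a -> w *m ((1%:M - e) *m (b *m a)) = 0].

Lemma linked_hom n N (X : I -> 'M[k]_n) (Y : I -> 'M[k]_N) w e :
  linked X Y w e -> mxhom Y Y e.
Proof. by case=> _ [b [a [hb ha ->]]] _; exact: mxhomM hb ha. Qed.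

(** An idempotent through [X] of largest rank has the property: otherwise some
    map [x] through [X] is not nilpotent on the complement of [e], and its Fitting
    idempotent, made orthogonal to [e], enlarges [e]. *)
Lemma linked_exists n N (X : I -> 'M[k]_n) (Y : I -> 'M[k]_N) w :
  radrow Y w -> exists e, linked X Y w e.
Proof.
move=> hw.
pose good e := e *m e = e /\ exists b a, [/\ mxhom Y X b, mxhom X Y a & e = b *m a].
pose P r := `[< exists2 e, good e & \rank e = r >].
have exP : exists r, P r.
  exists 0%N; apply/asboolP; exists 0; last by rewrite mxrank0.
  split; first by rewrite mulmx0.
  by exists 0, 0; split; [exact: mxhom0 | exact: mxhom0 | rewrite mulmx0].
have bP r : P r -> (r <= N)%N by move=> /asboolP [e _ <-]; exact: rank_leq_row.
case: (ex_maxnP exP bP) => r /asboolP [e [ee [b [a [hb ha eE]]]] er] rmax.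
exists e; split=> //; first by exists b, a.
have he : mxhom Y Y e by rewrite eE; exact: mxhomM hb ha.
have h1 := @mxhom1 _ _ _ Y.
have h1e : mxhom Y Y (1%:M - e) by apply: mxhomB.
move=> b1 a1 hb1 ha1; apply: contrapT => ne.
pose x := (1%:M - e) *m (b1 *m a1).
have hx : mxhom Y Y x by apply: mxhomM h1e (mxhomM hb1 ha1).
have nx : ~ nilmx x by move=> /(hw _ hx).
have [y [hy xy]] := mxhom_fitting hx.
set f := x *m y => ff nf.
have hf : mxhom Y Y f by exact: mxhomM.
have f0 : f <> 0 by move=> f0; apply: nx; move: nf; rewrite f0 subr0 mul1mx.
have e1e : e *m (1%:M - e) = 0 by rewrite mulmxBr mulmx1 ee subrr.
have ef : e *m f = 0 by rewrite /f /x !mulmxA e1e !mul0mx.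
have ef1 : (1%:M - e) *m f = f by rewrite mulmxBl mul1mx ef subr0.
pose g := f *m (1%:M - e).
have hg : mxhom Y Y g by exact: mxhomM.
have gg : g *m g = g by rewrite /g -mulmxA (mulmxA (1%:M - e)) ef1 mulmxA ff.
have eg : e *m g = 0 by rewrite /g mulmxA ef mul0mx.
have ge : g *m e = 0 by rewrite /g -mulmxA mulmxBl mul1mx ee subrr mulmx0.
have g0 : g <> 0 by move=> g0; apply: f0; rewrite -ff -{2}ef1 mulmxA -/g g0 mul0mx.
pose b2 := g *m ((1%:M - e) *m b1); pose a2 := a1 *m y *m (1%:M - e) *m g.
have hb2 : mxhom Y X b2 by apply: mxhomM hg (mxhomM h1e hb1).
have ha2 : mxhom X Y a2 by apply: mxhomM (mxhomM (mxhomM ha1 hy) h1e) hg.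
have ba2 : b2 *m a2 = g.
  have -> : b2 *m a2 = g *m (f *m (1%:M - e)) *m g by rewrite /b2 /a2 /f /x !mulmxA.
  by rewrite -/g !gg.
pose b3 := e *m b; pose a3 := a *m e.
have ba3 : b3 *m a3 = e by rewrite /b3 /a3 -mulmxA (mulmxA b) -eE !ee.
have hb3 : mxhom Y X b3 by exact: mxhomM.
have ha3 : mxhom X Y a3 by exact: mxhomM.
have a2b3 : a2 *m b3 = 0 by rewrite /a2 /b3 -mulmxA (mulmxA g) ge mul0mx mulmx0.
have a3b2 : a3 *m b2 = 0 by rewrite /a3 /b2 -mulmxA (mulmxA e) eg mul0mx mulmx0.
have eb3 : e *m b3 = b3 by rewrite /b3 mulmxA ee.
have eb2 : e *m b2 = 0 by rewrite /b2 (mulmxA e) eg mul0mx.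
have gb3 : g *m b3 = 0 by rewrite /b3 (mulmxA g) ge mul0mx.
have gb2 : g *m b2 = b2 by rewrite /b2 (mulmxA g) gg.
(* [E] factors through [X] only up to the correction [j] by the two cross terms.
   Each of them has square 0, so is killed by [w], so [j] is nilpotent. *)
pose E := e + g.
have EE : E *m E = E by rewrite /E mulmxDl !mulmxDr ee gg eg ge addr0 add0r.
have hE : mxhom Y Y E by exact: mxhomD.
pose j := b3 *m a2 + b2 *m a3.
have hj1 : mxhom Y Y (b3 *m a2) by exact: mxhomM.
have hj2 : mxhom Y Y (b2 *m a3) by exact: mxhomM.
have hj : mxhom Y Y j by exact: mxhomD.
have nj : nilmx j.
  apply/(hw _ hj); rewrite mulmxDr.
  have -> : w *m (b3 *m a2) = 0.
    apply/(hw _ hj1); exists 2; rewrite expr2 -mulmxE.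
    by rewrite -mulmxA (mulmxA a2) a2b3 mul0mx mulmx0.
  have -> : w *m (b2 *m a3) = 0.
    apply/(hw _ hj2); exists 2; rewrite expr2 -mulmxE.
    by rewrite -mulmxA (mulmxA a3) a3b2 mul0mx mulmx0.
  by rewrite addr0.
have Ej : E *m j = j.
  rewrite /E /j mulmxDl !(mulmxDr _ (b3 *m a2)) (mulmxA e b3) (mulmxA e b2) (mulmxA g b3).
  by rewrite (mulmxA g b2) eb3 eb2 gb3 gb2 !mul0mx addr0 add0r.
have uj := nil_unitmx nj.
have Eprod : E = (b3 + b2) *m ((a3 + a2) *m invmx (1%:M + j)).
  have E1 : E *m (1%:M + j) = (b3 + b2) *m (a3 + a2).
    rewrite [LHS]mulmxDr Ej mulmx1 mulmxDl !mulmxDr ba3 ba2 /E /j.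
    by rewrite addrACA; congr (_ + _); rewrite addrC.
  by rewrite mulmxA -E1 mulmxK.
have /rmax : P (\rank E).
  apply/asboolP; exists E => //; split=> //.
  exists (b3 + b2), ((a3 + a2) *m invmx (1%:M + j)); split=> //.
    exact: mxhomD.
  by apply: mxhomM (mxhomD ha3 ha2) (mxhomV (mxhomD h1 hj)).
have eE' : e *m E = e by rewrite /E mulmxDr ee eg addr0.
have sub : (e <= E)%MS by rewrite -{1}eE' submxMl.
rewrite -er => leE.
have := mxrank_leqif_sup sub => - [le1 /esym]; rewrite eqn_leq le1 leE /= => /submxP [D DE].
have gE : g = g *m E by rewrite /E mulmxDr ge gg add0r.
by apply: g0; rewrite gE DE -ee !mulmxA -(mulmxA g) -DE -gE ge.
Qed.

(** Each of the two idempotents absorbs the other modulo the radical on one side,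
    and idempotents of a reduced ring are central. *)
Lemma linked_unique n N (X : I -> 'M[k]_n) (Y : I -> 'M[k]_N) w e e' :
  radrow Y w -> linked X Y w e -> linked X Y w e' -> w *m e = w *m e'.
Proof.
move=> hw le le'; have he := linked_hom le; have he' := linked_hom le'.
have H f f' : linked X Y w f -> linked X Y w f' -> w *m f' = w *m (f *m f').
  move=> [_ _ h] [_ [b [a [hb ha ->]]] _].
  by have /eqP := h b a hb ha; rewrite mulmxBl mul1mx mulmxBr subr_eq0 => /eqP.
case: (le) => ee _ _; case: (le') => ee' _ _.
rewrite (H _ _ le' le) (H _ _ le le').
have h1 := @mxhom1 _ _ _ Y.
(* Centrality of [e'] modulo the radical: both off-diagonal parts of [e] have
   square 0. *)
have nil1 : w *m (e' *m e *m (1%:M - e')) = 0.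
  apply/hw; first by do 2?apply: mxhomM => //; apply: mxhomB.
  apply: nilmxC; rewrite !mulmxA mulmxBl mul1mx ee' subrr !mul0mx; exact: nil0mx.
have nil2 : w *m ((1%:M - e') *m (e *m e')) = 0.
  apply/hw; first by apply: mxhomM; [apply: mxhomB | exact: mxhomM].
  apply: nilmxC; rewrite -!mulmxA mulmxBr mulmx1 ee' subrr !mulmx0; exact: nil0mx.
move: nil1 nil2; rewrite mulmxBr mulmx1 mulmxBl mul1mx !mulmxBr !mulmxA.
move=> /eqP; rewrite subr_eq0 => /eqP E1 /eqP; rewrite subr_eq0 => /eqP E2; exact: etrans E1 (esym E2).
Qed.

Lemma linked_iso n n' N (X : I -> 'M[k]_n) (X' : I -> 'M[k]_n') (Y : I -> 'M[k]_N) w e :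
  mxiso X X' -> linked X Y w e -> linked X' Y w e.
Proof.
move=> [c [d [hc hd cd dc]]] [ee [b [a [hb ha eE]]] h]; split=> //.
  exists (b *m c), (d *m a); split; [exact: mxhomM hb hc | exact: mxhomM hd ha |].
  by rewrite mulmxA -(mulmxA b) cd mulmx1.
move=> b' a' hb' ha'.
have := h _ _ (mxhomM hb' hd) (mxhomM hc ha').
by rewrite -(mulmxA b') (mulmxA d) dc mul1mx.
Qed.
End Linked.

(** A map through the extension of [X] is a combination of maps through [X], by
    [expand_hom], and the defining condition is linear. *)
Lemma linked_map (k K : fieldType) (f : {rmorphism k -> K}) (I : Type) n N
    (X : I -> 'M[k]_n) (Y : I -> 'M[k]_N) w e : linked X Y w e ->
  linked (mapfam f X) (mapfam f Y) (map_mx f w) (map_mx f e).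
Proof.
move=> [ee [b [a [hb ha eE]]] h]; split.
- by rewrite -map_mxM ee.
- by exists (map_mx f b), (map_mx f a); split; rewrite ?eE ?map_mxM //; exact: mxhom_map.
move=> b' a' /expand_hom [s [c [B [_ hB ->]]]] /expand_hom [t [d [A [_ hA ->]]]].
rewrite mulmx_suml !mulmx_sumr big1 // => i _.
rewrite !mulmx_sumr big1 // => j _.
rewrite -scalemxAl -!scalemxAr -(map_mx1 f) -map_mxB -!map_mxM h //.
by rewrite map_mx0 !scaler0.
Qed.

(** * Common summands with indecomposable modules over the base field *)

Lemma horner_mx_eigen (k : fieldType) n (C : 'M[k]_n.+1) (w : 'rV[k]_n.+1) x q :
  w *m C = x *: w -> w *m horner_mx C q = q.[x] *: w.
Proof.
move=> h; elim/poly_ind: q => [|q c IH].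
  by rewrite rmorph0 mulmx0 horner0 scale0r.
rewrite rmorphD rmorphM /= horner_mx_X horner_mx_C -mulmxE mulmxDr mulmxA IH.
rewrite -scalemxAl h !hornerE scalerA scalerDl mul_mx_scalar.
by [].
Qed.

(** For the companion matrix of the minimal polynomial of [x], left and right
    eigenvectors for [x] pair to a nonzero scalar because [x] is a simple root.
    Thus the line of [x] is a retract of the space on which [C] acts. *)
Lemma separable_eigen (F K : fieldType) (iota : {rmorphism F -> K}) (x : K) :
  (exists p : {poly F},
    [/\ irreducible_poly p, root (map_poly iota p) x & separable_poly p]) ->
  exists n (C : 'M[F]_n) (w : 'rV[K]_n) (v : 'cV[K]_n),
    [/\ w *m map_mx iota C = x *: w, map_mx iota C *m v = x *: v & w *m v = 1%:M].
Proof.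
case=> p0 [irr0 rt0 sep0].
have p0n : p0 != 0 by apply/negP => /eqP E; move: irr0.1; rewrite E size_poly0.
have lc : lead_coef p0 != 0 by rewrite lead_coef_eq0.
pose p := (lead_coef p0)^-1 *: p0.
have pm : p \is monic by rewrite monicE lead_coefZ mulVf.
have pp0 : p %= p0 by rewrite eqp_scale // invr_eq0.
have sep : separable_poly p by rewrite (eqp_separable pp0).
have rt : root (map_poly iota p) x by rewrite map_polyZ rootZ // fmorph_eq0 invr_eq0.
have sz : (1 < size p)%N by rewrite size_scale ?invr_eq0 //; exact: irr0.1.
have [d dE] : exists d, size p = d.+2 by case: (size p) sz => [|[|d]] // _; exists d.
have [C Cp] : exists C : 'M[F]_d.+1, char_poly C = p.
  have -> : d.+1 = (size p).-1 by rewrite dE.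
  by exists (companionmx p); apply: companionmxK.
pose CK := map_mx iota C.
have CKp : char_poly CK = map_poly iota p by rewrite -map_char_poly Cp.
have ev : eigenvalue CK x by rewrite eigenvalue_root_char CKp.
case/eigenvalueP: ev => w wC w0.
have /factor_theorem [g gE] := rt.
have gx : g.[x] != 0.
  have : separable_poly (map_poly iota p) by rewrite separable_map.
  by rewrite gE separable_root => /andP [].
pose G := horner_mx CK g.
(* By Cayley-Hamilton the columns of [G] are eigenvectors of [CK], since
   [('X - x%:P) * g] is its characteristic polynomial. *)
have GC : CK *m G = x *: G.
  have := Cayley_Hamilton CK; rewrite CKp gE mulrC rmorphM rmorphB /= horner_mx_X horner_mx_C.
  by rewrite mulrBl => /eqP; rewrite subr_eq0 => /eqP; rewrite -!mulmxE mul_scalar_mx.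
have [j wj] : exists j, w 0 j != 0.
  apply: contrapT => h; move/negP: w0; apply; apply/eqP/rowP => j; rewrite mxE.
  by apply/eqP/negPn/negP => wj; apply: h; exists j.
pose u : 'cV[K]_d.+1 := (g.[x] * w 0 j)^-1 *: delta_mx j 0.
exists d.+1, C, w, (G *m u); split=> //.
  by rewrite mulmxA GC -scalemxAl.
rewrite mulmxA (horner_mx_eigen _ wC) -scalemxAl -scalemxAr scalerA.
have -> : w *m delta_mx j 0 = (w 0 j)%:M.
  by rewrite -colE; apply/matrixP => a b; rewrite !mxE !ord1 eqxx mulr1n.
by rewrite scale_scalar_mx -mulrA mulrCA mulVf ?mulf_neq0.
Qed.

Lemma mxiso_cast (k : fieldType) (I : Type) m n (e : m = n) (X : I -> 'M[k]_m) :
  mxiso X (fun i => castmx (e, e) (X i)).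
Proof. by case: n / e; apply: mxiso_refl. Qed.

Section Existence.
Variables (F K : fieldType) (iota : {rmorphism F -> K}).
Hypothesis hK : separable_algebraic iota.

(** The entries [x] in [cs] are removed one at a time, by putting for [x] a matrix
    [C] over [F] with eigenvalue [x].  With the eigenvectors of [separable_eigen],
    [X] is a retract of the larger family obtained. *)
Lemma summand_over_base (I : Type) (cs : seq K) n (X : I -> 'M[K]_n) :
  (forall i a b, X i a b \in cs \/ exists y, X i a b = iota y) ->
  exists N (Y : I -> 'M[F]_N) a b,
    [/\ mxhom X (mapfam iota Y) a, mxhom (mapfam iota Y) X b & a *m b = 1%:M].
Proof.
elim: cs n X => [|x cs IH] n X hX.
  have hX' i a b : exists y, X i a b = iota y by case: (hX i a b).
  pose Y i : 'M[F]_n := \matrix_(a, b) sval (cid (hX' i a b)).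
  have YE : mapfam iota Y = X.
    apply: funext => i; apply/matrixP => a b; rewrite !mxE.
    by case: cid.
  exists n, Y, 1%:M, 1%:M; rewrite YE mulmx1.
  by split=> //; apply: mxhom1.
have [s [C [w [v [wC Cv wv]]]]] := separable_eigen (hK x).
pose X' i : 'M[K]_n := \matrix_(a, b) if X i a b == x then 0 else X i a b.
pose D i : 'M[K]_n := \matrix_(a, b) (X i a b == x)%:R.
have XE i : X i = X' i + x *: D i.
  apply/matrixP => a b; rewrite !mxE; case: eqP => [->|_].
    by rewrite mulr1 add0r.
  by rewrite mulr0 addr0.
pose Z i : 'M[K]_(s * n) := (1%:M : 'M_s) *t X' i + map_mx iota C *t D i.
have [|N [Y [a [b [ha hb ab]]]]] := IH _ Z.
  move=> i c d; case: (mxtens_indexP c) => c1 c2; case: (mxtens_indexP d) => d1 d2.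
  rewrite mxE !tensmxE !mxE; case: (hX i c2 d2) => [|[y yE]].
    rewrite inE; case: eqP => [_ _|_ /= h].
      by right; exists (C c1 d1); rewrite !(mulr0, add0r, mulr1).
    rewrite mulr0 addr0; case: (c1 == d1); first by left; rewrite mul1r.
    by right; exists 0; rewrite mul0r rmorph0.
  case: (X i c2 d2 =P x) => _; first by right; exists (C c1 d1); rewrite !(mulr0, add0r, mulr1).
  right; exists ((c1 == d1)%:R * y); rewrite yE mulr0 addr0 rmorphM /=.
  by rewrite rmorph_nat.
pose X1 i : 'M[K]_(1 * n) := 1%:M *t X i.
have isoX : mxiso X X1.
  rewrite (_ : X1 = fun i => castmx (esym (mul1n n), esym (mul1n n)) (X i)).
    exact: mxiso_cast.
  by apply: funext => i; rewrite /X1 tens_scalar1mx.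
pose al : 'M[K]_(1 * n, s * n) := w *t (1%:M : 'M_n).
pose be : 'M[K]_(s * n, 1 * n) := v *t (1%:M : 'M_n).
have tD p q (A : 'M[K]_(p, q)) i : A *t X i = A *t X' i + (x *: A) *t D i.
  by rewrite {1}XE; apply/matrixP => c d; rewrite !mxE mulrDr mulrCA mulrA.
have hal : mxhom X1 Z al.
  move=> i; rewrite /X1 /Z /al mulmxDr !tensmx_mul !mul1mx !mulmx1 wC.
  exact: tD.
have hbe : mxhom Z X1 be.
  move=> i; rewrite /X1 /Z /be mulmxDl !tensmx_mul !mul1mx !mulmx1 Cv.
  by rewrite -tD.
have albe : al *m be = 1%:M.
  by rewrite tensmx_mul wv mul1mx tens_scalar1mx; apply/matrixP => c d; rewrite castmxE !mxE.
have [c [d [hc hd cd dc]]] := isoX.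
exists N, Y, (c *m (al *m a)), (b *m be *m d); split.
- exact: mxhomM hc (mxhomM hal ha).
- exact: mxhomM (mxhomM hb hbe) hd.
have -> : c *m (al *m a) *m (b *m be *m d) = c *m (al *m (a *m b) *m be) *m d.
  by rewrite !mulmxA.
by rewrite ab mulmx1 albe mulmx1.
Qed.

(** Take [Y] over [F] of smallest size with [1%:M + a *m b] singular for some [a]
    and [b] through [Y_K].  An idempotent [f] of [End Y] other than 0 and 1 would
    split this map into two maps through smaller families, and [1%:M + a *m b]
    into a product of two units.  So by Fitting's lemma every endomorphism of
    [Y] is nilpotent or invertible. *)
Theorem linked_indecomposable r n (X : 'I_r -> 'M[K]_n) : (0 < n)%N ->
  exists N (Y : 'I_r -> 'M[F]_N),
    (forall x, mxhom Y Y x -> nilmx x \/ x \in unitmx) /\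
    exists a b, [/\ mxhom X (mapfam iota Y) a, mxhom (mapfam iota Y) X b &
      ~ nilmx (a *m b)].
Proof.
move=> n0.
pose bad N (Y : 'I_r -> 'M[F]_N) := exists a b,
  [/\ mxhom X (mapfam iota Y) a, mxhom (mapfam iota Y) X b &
      1%:M + a *m b \notin unitmx].
pose P N := `[< exists Y : 'I_r -> 'M[F]_N, bad N Y >].
have exP : exists N, P N.
  pose cs := [seq X t.1 t.2.1 t.2.2 | t : 'I_r * ('I_n * 'I_n)].
  have [|N [Y [a [b [ha hb ab]]]]] := @summand_over_base 'I_r cs n X.
    by move=> i a b; left; apply/imageP; exists (i, (a, b)).
  exists N; apply/asboolP; exists Y, (- a), b; split=> //; first exact: mxhomN.
  rewrite mulNmx ab subrr unitmxE; case: (n) n0 => // q _.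
  by rewrite det0 unitr0.
case: (ex_minnP exP) => N /asboolP [Y [a [b [ha hb nu]]]] Nmin.
exists N, Y; split; last first.
  by exists a, b; split=> // nl; case/negP: nu; apply: nil_unitmx.
have small f : mxhom Y Y f -> f *m f = f -> (\rank f < N)%N ->
    forall a b, mxhom X (mapfam iota Y) a -> mxhom (mapfam iota Y) X b ->
    1%:M + a *m map_mx iota f *m b \in unitmx.
  move=> hf ff rf {a b ha hb nu} a b ha hb; apply/negPn/negP => nu.
  have [Z [i [p [hi hp _ pi]]]] := mxhom_split hf ff.
  have : P (\rank f); last by move/Nmin; rewrite leqNgt rf.
  apply/asboolP; exists Z, (a *m map_mx iota p), (map_mx iota i *m b); split.
  - by apply: mxhomM ha _; apply: mxhom_map.
  - by apply: mxhomM _ hb; apply: mxhom_map.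
  - by rewrite !mulmxA -(mulmxA a) -map_mxM pi.
move=> x hx; have [y [hy xy]] := mxhom_fitting hx.
set f := x *m y => ff nf.
have hf : mxhom Y Y f by exact: mxhomM.
have h1f : mxhom Y Y (1%:M - f) by apply: mxhomB => //; exact: mxhom1.
have ff1 : (1%:M - f) *m (1%:M - f) = 1%:M - f.
  by rewrite mulmxBl mul1mx mulmxBr mulmx1 ff subrr subr0.
have idem1 (g : 'M[F]_N) : g *m g = g -> ~~ (\rank g < N)%N -> g = 1%:M.
  move=> gg; rewrite ltn_neqAle rank_leq_row andbT negbK => /eqP rg.
  have u : g \in unitmx by rewrite -row_free_unit; apply/eqP.
  by rewrite -[g](mulKmx u) gg mulVmx.
case: (boolP (\rank f < N)%N) => rf; last first.
  right; have := idem1 _ ff rf => f1.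
  by case/mulmx1_unit: f1.
case: (boolP (\rank (1%:M - f)%R < N)%N) => r1f; last first.
  left; have := idem1 _ ff1 r1f => f1.
  by move: nf; rewrite f1 mul1mx.
case/negP: nu.
have u1 := small f hf ff rf a b ha hb.
set s := 1%:M + _ in u1.
have hs : mxhom X X s.
  apply: mxhomD; first exact: mxhom1.
  by apply: mxhomM hb; apply: mxhomM ha _; apply: mxhom_map.
have u2 := small _ h1f ff1 r1f (invmx s *m a) b (mxhomM (mxhomV hs) ha) hb.
have -> : 1%:M + a *m b =
    s *m (1%:M + invmx s *m a *m map_mx iota (1%:M - f) *m b); last first.
  by rewrite unitmx_mul u1 u2.
rewrite mulmxDr mulmx1 !mulmxA mulmxV // mul1mx /s -addrA; congr (_ + _).
by rewrite -mulmxDl -mulmxDr -map_mxD addrC subrK map_mx1 mulmx1.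
Qed.
End Existence.

(** * The radical of the endomorphism ring of an indecomposable module *)

(** Turns a subspace given by a predicate into a row space, via a largest free
    family. *)
Lemma subspace_mx (k : fieldType) N (P : 'rV[k]_N -> Prop) :
  P 0 -> (forall a u v, P u -> P v -> P (a *: u + v)) ->
  exists m (B : 'M[k]_(m, N)), row_free B /\ forall u, (u <= B)%MS <-> P u.
Proof.
move=> P0 PD.
pose Q m := `[< exists2 B : 'M[k]_(m, N), row_free B & forall i, P (row i B) >].
have exQ : exists m, Q m.
  by exists 0%N; apply/asboolP; exists 0; [rewrite -row_leq_rank | case].
have bQ m : Q m -> (m <= N)%N.
  by case/asboolP => B fB _; rewrite -(eqP fB); exact: rank_leq_col.
case: (ex_maxnP exQ bQ) => m /asboolP [B fB hB] mmax.
have Psum (c : 'rV[k]_m) : P (c *m B).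
  rewrite mulmx_sum_row; apply: big_ind => //.
    by move=> u v hu hv; rewrite -[u]scale1r; apply: PD.
  by move=> i _; rewrite -[_ *: _]addr0; apply: PD.
exists m, B; split=> // u; split.
  by case/submxP => c ->.
move=> Pu; apply/negPn/negP => nu.
suff /mmax : Q (1 + m)%N by rewrite ltnn.
apply/asboolP; exists (col_mx u B); last first.
  move=> i; case: (splitP i) => j ij.
    have -> : i = lshift m j by apply: val_inj.
    by rewrite rowKu row_id.
  have -> : i = rshift 1 j by apply: val_inj.
  by rewrite rowKd.
rewrite -row_leq_rank -addsmxE add1n.
have := mxrank_leqif_sup (addsmxSr u B) => - [le ].
rewrite addsmx_sub submx_refl andbT (negbTE nu) => /negbT ne.
apply: (@leq_ltn_trans (\rank B)); first by rewrite (eqP fB).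
by rewrite ltn_neqAle ne.
Qed.

Section Local.
Variables (F : fieldType) (I : Type) (N : nat) (Y : I -> 'M[F]_N).
Hypothesis hloc : forall x, mxhom Y Y x -> nilmx x \/ x \in unitmx.
Hypothesis N0 : (0 < N)%N.

Lemma nil_nunit (x : 'M[F]_N) : nilmx x -> x \notin unitmx.
Proof.
case=> e xe; apply/negP => ux.
have : x ^+ e \in unitmx.
  elim: e {xe} => [|e IH]; first exact: unitmx1.
  by rewrite exprS -mulmxE unitmx_mul ux.
by rewrite xe unitmxE; case: (N) N0 => // q _; rewrite det0 unitr0.
Qed.

Lemma local_nilM x y : mxhom Y Y x -> mxhom Y Y y -> nilmx x ->
  nilmx (x *m y) /\ nilmx (y *m x).
Proof.
move=> hx hy nx; split.
  case: (hloc (mxhomM hx hy)) => //; rewrite unitmx_mul => /andP [ux _].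
  by case/negP: (nil_nunit nx).
case: (hloc (mxhomM hy hx)) => //; rewrite unitmx_mul => /andP [_ ux].
by case/negP: (nil_nunit nx).
Qed.

(** Here rows form a module over [End Y].  The rows of [B] span the cyclic
    submodule of [w] plus [V], taken of smallest dimension with [w] outside [V].
    If [w *m y] were not in [V], it would generate the same submodule modulo [V],
    so [w = w *m y *m z] modulo [V], and [1%:M - y *m z] is a unit when [y] is
    nilpotent: this is Nakayama's lemma. *)
Lemma simple_cyclic q (V : 'M[F]_(q, N)) :
  (forall y, mxhom Y Y y -> (V *m y <= V)%MS) -> ~~ row_full V ->
  exists (w : 'rV[F]_N) m (B : 'M[F]_(m, N)),
    [/\ ~~ (w <= V)%MS, row_free B,
        forall u, (u <= B)%MS <-> exists2 y, mxhom Y Y y & (u - w *m y <= V)%MS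
      & forall y, mxhom Y Y y -> nilmx y -> (w *m y <= V)%MS].
Proof.
move=> stV nV.
have cyc (w : 'rV[F]_N) : exists m (B : 'M[F]_(m, N)), row_free B /\
    forall u, (u <= B)%MS <-> exists2 y, mxhom Y Y y & (u - w *m y <= V)%MS.
  apply: subspace_mx; first by exists 0; rewrite ?mulmx0 ?subr0 ?sub0mx //; exact: mxhom0.
  move=> a u v [y hy yu] [z hz zv]; exists (a *: y + z).
    by apply: mxhomD => //; apply: mxhomZ.
  rewrite mulmxDr -scalemxAr opprD addrACA -scalerBr.
  by apply: addmx_sub => //; apply: scalemx_sub.
pose P m := `[< exists (w : 'rV[F]_N) (B : 'M[F]_(m, N)), [/\ ~~ (w <= V)%MS, row_free B &
    forall u, (u <= B)%MS <-> exists2 y, mxhom Y Y y & (u - w *m y <= V)%MS] >].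
have exP : exists m, P m.
  have [i wi] : exists i, ~~ (row i 1%:M <= V)%MS.
    by move: nV; rewrite -sub1mx => /row_subPn.
  have [m [B [fB hB]]] := cyc (row i 1%:M).
  by exists m; apply/asboolP; exists (row i 1%:M), B.
case: (ex_minnP exP) => m /asboolP [w [B [wV fB hB]]] mmin.
exists w, m, B; split=> // y hy ny; apply/negPn/negP => wy.
have [m' [B' [fB' hB']]] := cyc (w *m y).
have mm' : (m <= m')%N by apply: mmin; apply/asboolP; exists (w *m y), B'.
have sub : (B' <= B)%MS.
  apply/row_subP => i; apply/hB.
  have [z hz hi] := (hB' (row i B')).1 (row_sub i B').
  by exists (y *m z); [exact: mxhomM | rewrite mulmxA].
have := mxrank_leqif_sup sub => - [_ /esym].
rewrite eqn_leq mxrankS //= (eqP fB) (eqP fB') mm' => sub'.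
have /hB' [z hz hw] : (w <= B')%MS.
  apply: submx_trans sub'; apply/hB; exists 1%:M; first exact: mxhom1.
  by rewrite mulmx1 subrr sub0mx.
case/negP: wV.
have nyz : nilmx (- (y *m z)).
  by rewrite -mulmxN; apply: (local_nilM hy (mxhomN hz) ny).1.
have u := nil_unitmx nyz.
have hu := mxhomV (mxhomB (@mxhom1 _ _ _ Y) (mxhomM hy hz)).
rewrite -[w](mulmxK u) mulmxDr mulmx1 mulmxN mulmxA.
by apply: submx_trans (stV _ hu); apply: submxMr.
Qed.

(** The case [V = 0]: a row that generates a simple submodule is killed by the
    radical, and by nothing else, as units kill no nonzero row. *)
Lemma radical_row : exists (w : 'rV[F]_N) m (B : 'M[F]_(m, N)),
  [/\ w != 0, row_free B, radrow Y w &
      forall u, (u <= B)%MS <-> exists2 y, mxhom Y Y y & u = w *m y].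
Proof.
have [||w [m [B [w0 fB hB hw]]]] := @simple_cyclic N 0.
- by move=> y _; rewrite mul0mx.
- by rewrite /row_full mxrank0 eq_sym -lt0n.
have w0' : w != 0 by move: w0; rewrite submx0.
exists w, m, B; split=> //; last first.
  move=> u; rewrite hB; split=> - [y hy E]; exists y => //; last by rewrite E subrr sub0mx.
  by apply/eqP; rewrite -subr_eq0 -submx0.
move=> x hx; split; first by move=> nx; apply/eqP; rewrite -submx0; exact: hw.
move=> wx; case: (hloc hx) => // ux.
by case/negP: w0'; rewrite -[w](mulmxK ux) wx mul0mx.
Qed.

(** The radical moves each term of a chain of submodules, built by
    [simple_cyclic], into the preceding term.  This is a linear condition, so it
    holds for the combinations over [K] as well, and they are nilpotent. *)
Lemma radical_nil_ext (K : fieldType) (iota : {rmorphism F -> K}) s (b : 'I_s -> K)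
    (y : 'I_s -> 'M[F]_N) :
  (forall l, mxhom Y Y (y l) /\ nilmx (y l)) ->
  nilmx (\sum_l b l *: map_mx iota (y l)).
Proof.
move=> hy; set x := \sum_l _.
pose P m := `[< exists V : 'M[F]_(m, N), [/\ row_free V,
   forall z, mxhom Y Y z -> (V *m z <= V)%MS &
   exists e, map_mx iota V *m x ^+ e = 0] >].
have exP : exists m, P m.
  exists 0%N; apply/asboolP; exists 0; split; first by rewrite -row_leq_rank.
    by move=> z _; rewrite mul0mx sub0mx.
  by exists 0%N; rewrite map_mx0 mul0mx.
have bP m : P m -> (m <= N)%N.
  by case/asboolP => V [fV _ _]; rewrite -(eqP fV); exact: rank_leq_col.
case: (ex_maxnP exP bP) => m /asboolP [V [fV stV [e Ve]]] mmax.
case: (boolP (row_full V)) => [full|nfull].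
  exists e; have fullK : row_full (map_mx iota V) by rewrite row_full_map.
  by apply: (row_full_inj fullK); rewrite Ve mulmx0.
have [w [m' [B [wV fB hB hw]]]] := simple_cyclic stV nfull.
have VB : (V <= B)%MS.
  apply/row_subP => i; apply/hB; exists 0; first exact: mxhom0.
  by rewrite mulmx0 subr0 row_sub.
have wB : (w <= B)%MS.
  by apply/hB; exists 1%:M; [exact: mxhom1 | rewrite mulmx1 subrr sub0mx].
have mm' : (m < m')%N.
  have := mxrank_leqif_sup VB => - [le E].
  suff : (\rank V < \rank B)%N by rewrite (eqP fV) (eqP fB).
  rewrite ltn_neqAle le andbT E.
  by apply/negP => BV; case/negP: wV; apply: submx_trans BV.
have /mmax : P m'; last by rewrite leqNgt mm'.
apply/asboolP; exists B; split=> //.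
  move=> z hz; apply/row_subP => i; apply/hB; rewrite row_mul.
  have [t ht E] := (hB (row i B)).1 (row_sub i B).
  exists (t *m z); first exact: mxhomM.
  rewrite mulmxA -mulmxBl; apply: submx_trans (stV _ hz); exact: submxMr.
have Bx : (map_mx iota B *m x <= map_mx iota V)%MS.
  rewrite /x mulmx_sumr; apply: summx_sub => l _.
  rewrite -scalemxAr -map_mxM; apply: scalemx_sub; rewrite map_submx.
  have [hl nl] := hy l.
  apply/row_subP => i; rewrite row_mul.
  have [t ht E] := (hB (row i B)).1 (row_sub i B).
  rewrite -[row i B](subrK (w *m t)) mulmxDl; apply: addmx_sub.
    by apply: submx_trans (stV _ hl); exact: submxMr.
  rewrite -mulmxA; apply: hw; first exact: mxhomM.
  exact: (local_nilM hl ht nl).2.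
exists e.+1; rewrite exprS -mulmxE mulmxA.
by case/submxP: Bx => D ->; rewrite -mulmxA Ve mulmx0.
Qed.
End Local.

(** * Polynomials in several variables *)

Definition infinite_field (F : fieldType) := forall s : seq F, exists x, x \notin s.

Section Mmap.
Variables (n : nat) (R : comNzRingType).

Lemma rmorph_mmap (S T : comNzRingType) (f : {rmorphism R -> S}) (h : 'I_n -> S)
    (g : {rmorphism S -> T}) (p : {mpoly R[n]}) :
  g (mmap f h p) = mmap (g \o f) (g \o h) p.
Proof.
rewrite /mmap rmorph_sum; apply: eq_bigr => m _; rewrite rmorphM; congr (_ * _).
by rewrite /mmap1 rmorph_prod; apply: eq_bigr => i _; rewrite rmorphXn.
Qed.

Lemma eq_mmap (S : comNzRingType) (f f' : R -> S) (h h' : 'I_n -> S) (p : {mpoly R[n]}) :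
  f =1 f' -> h =1 h' -> mmap f h p = mmap f' h' p.
Proof.
move=> ff hh; apply: eq_bigr => m _; rewrite ff; congr (_ * _).
by apply: eq_bigr => i _; rewrite hh.
Qed.

Lemma mmap_id (p : {mpoly R[n]}) : mmap (@mpolyC n R) (fun i => 'X_i) p = p.
Proof.
rewrite -[RHS]comp_mpoly_id; apply: eq_mmap => // i.
by rewrite tnth_mktuple.
Qed.
End Mmap.

(** The variables are replaced by values one at a time; at each step the
    polynomial is one in a single variable over a domain, with finitely many
    roots. *)
Lemma meval_neq0 (F : fieldType) n (p : {mpoly F[n]}) : infinite_field F ->
  p != 0 -> exists v, p.@[v] != 0.
Proof.
move=> Finf p0.
pose sub j (v : 'I_n -> F) : 'I_n -> {mpoly F[n]} :=
  fun i => if (i < j)%N then (v i)%:MP else 'X_i.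
suff H j : (j <= n)%N -> exists v, mmap (@mpolyC n F) (sub j v) p != 0.
  have [v hv] := H n (leqnn n); exists v.
  suff E : mmap (@mpolyC n F) (sub n v) p = (p.@[v])%:MP by rewrite E mpolyC_eq0 in hv.
  rewrite /meval (rmorph_mmap _ _ (@mpolyC n F)); apply: eq_mmap => // i.
  by rewrite /sub ltn_ord.
elim: j => [_|j IH ltj].
  exists (fun=> 0); rewrite (_ : mmap _ _ p = p) // -[RHS]mmap_id.
  by apply: eq_mmap.
have [v hv] := IH (ltnW ltj).
pose h i : {poly {mpoly F[n]}} := if i == Ordinal ltj then 'X else (sub j v i)%:P.
pose Q := mmap (polyC \o @mpolyC n F) h p.
have QE (c : {mpoly F[n]}) : Q.[c] = mmap (@mpolyC n F) (fun i => (h i).[c]) p.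
  rewrite -horner_evalE /Q rmorph_mmap; apply: eq_mmap => // x /=.
  by rewrite horner_evalE hornerC.
have Q0 : Q != 0.
  apply/negP => /eqP E; case/negP: hv; apply/eqP.
  rewrite -[RHS](horner0 'X_(Ordinal ltj)) -E QE; apply: eq_mmap => // i.
  rewrite /h; case: eqP => [->|_]; last by rewrite hornerC.
  by rewrite hornerX /sub /= ltnn.
have [t ht] : exists t : F, Q.[t%:MP] != 0.
  apply: contrapT => hn.
  have hr t : root Q t%:MP by apply/negPn/negP => ht; apply: hn; exists t.
  have [s [us sz]] : exists s : seq F, uniq s /\ size s = size Q.
    elim: (size Q) => [|e [s [us sz]]]; first by exists [::].
    by have [x xs] := Finf s; exists (x :: s); rewrite /= xs us sz.
  suff : (size [seq (t%:MP : {mpoly F[n]}) | t <- s] < size Q)%N.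
    by rewrite size_map sz ltnn.
  apply: max_poly_roots => //; first by apply/allP => x /mapP [t _ ->].
  by rewrite map_inj_uniq //; apply: can_inj (@mpolyCK _ _).
exists (fun i => if i == Ordinal ltj then t else v i).
move: ht; rewrite QE; congr (_ != 0); apply: eq_mmap => // i.
rewrite /h /sub -val_eqE /= [(i < j.+1)%N]ltnS [(i <= j)%N]leq_eqVlt.
by case: eqP => _ /=; rewrite ?hornerX ?hornerC.
Qed.

(** A root of a polynomial in the fraction field is a polynomial.  The proof
    avoids unique factorization: along the lines through a point [x0] where [b]
    does not vanish, [a] and [b] become polynomials in one variable over the
    polynomial ring, and over the fraction field the second divides the first.
    The constant term of the divisor is a nonzero scalar, so the
    coefficients of the quotient are polynomials, by power series division. *)
Lemma root_closed (F : fieldType) n (a b p : {mpoly F[n]}) k x0 :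
  (0 < k)%N -> b.@[x0] != 0 -> a ^+ k = p * b ^+ k -> exists g, a = g * b.
Proof.
move=> k0 bx0 ab; pose R := {mpoly F[n]}.
(* [phi q] is [q] along the line that is at [x0] at time 0 and at the generic
   point at time 1. *)
pose h i : {poly R} := (x0 i)%:MP%:P + ('X_i - (x0 i)%:MP)%:P * 'X.
pose phi := mmap (polyC \o @mpolyC n F) h.
have phiE (q c : R) : (phi q).[c] = mmap (@mpolyC n F) (fun i => (h i).[c]) q.
  rewrite -horner_evalE /phi rmorph_mmap; apply: eq_mmap => // x /=.
  by rewrite horner_evalE hornerC.
have phi1 q : (phi q).[1] = q.
  rewrite phiE -[RHS]mmap_id; apply: eq_mmap => // i.
  by rewrite /h hornerD hornerM !hornerC hornerX mulr1 addrC subrK.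
have phi0 q : (phi q).[0] = (q.@[x0])%:MP.
  rewrite phiE /meval (rmorph_mmap _ _ (@mpolyC n F)); apply: eq_mmap => // i.
  by rewrite /h hornerD hornerM !hornerC hornerX mulr0 addr0.
have [Q [tf tfI]] : exists (Q : fieldType) (tf : {rmorphism R -> Q}), injective tf.
  by exists {fraction R}, (@tofrac R) => x y /eqP; rewrite tofrac_eq => /eqP.
pose psi q : {poly Q} := map_poly tf (phi q).
have E : psi a ^+ k = psi p * psi b ^+ k.
  have psiM q r : psi (q * r) = psi q * psi r by rewrite /psi /phi !rmorphM.
  have psiX q e : psi (q ^+ e) = psi q ^+ e by rewrite /psi /phi !rmorphXn.
  by apply: etrans (esym (psiX a k)) _; rewrite ab; apply: etrans (psiM _ _) _; congr (_ * _).
have impsi q j : exists c, (psi q)`_j = tf c by exists (phi q)`_j; rewrite coef_map.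
have b0 : (psi b)`_0 = tf (b.@[x0])%:MP by rewrite coef_map -horner_coef0 phi0.
have psi1 q : (psi q).[1] = tf q by rewrite /psi -(rmorph1 tf) horner_map phi1.
move: (psi) E impsi b0 psi1 => {phiE phi1 phi0 phi h} {}psi E impsi b0 psi1.
have : (psi b %| psi a)%R by rewrite -(dvdp_pexp2r _ _ k0) E dvdp_mull.
case/dvdpP => g gE.
pose im (x : Q) := exists c : R, x = tf c.
have im0 : im 0 by exists 0; rewrite rmorph0.
have imD x y : im x -> im y -> im (x + y).
  by case=> c -> [d ->]; exists (c + d); rewrite rmorphD.
have imM x y : im x -> im y -> im (x * y).
  by case=> c -> [d ->]; exists (c * d); rewrite rmorphM.
have imN x : im x -> im (- x) by case=> c ->; exists (- c); rewrite rmorphN.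
have img j : im g`_j.
  elim/ltn_ind: j => j IH.
  have : (psi a)`_j = \sum_(i < j) g`_i * (psi b)`_(j - i) + g`_j * (psi b)`_0.
    by rewrite gE coefM big_ord_recr /= subnn.
  set S := \sum_(i < j) _; rewrite b0 => aj.
  have -> : g`_j = ((psi a)`_j - S) * tf ((b.@[x0])^-1)%:MP.
    by rewrite aj addrC addKr -mulrA -rmorphM -mpolyCM mulfV // mpolyC1 rmorph1 mulr1.
  apply: (imM); last by exists ((b.@[x0])^-1)%:MP.
  apply: (imD) => //; apply: imN; apply: (big_ind im im0 imD) => i _.
  by apply: imM => //; apply: IH.
have [c cE] : im g.[1].
  rewrite horner_coef; apply: (big_ind im im0 imD) => i _.
  by rewrite expr1n mulr1.
by exists c; apply: tfI; rewrite -psi1 gE hornerM psi1 cE rmorphM.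
Qed.

(** Substituting ['X_i * 'X] for ['X_i] separates the homogeneous components as
    coefficients.  The power is then a monomial in ['X], so the root is one
    too. *)
Lemma homog_root (F : fieldType) n (q p : {mpoly F[n]}) r k :
  (0 < k)%N -> p != 0 -> p \is (r * k).-homog -> q ^+ k = p -> q \is r.-homog.
Proof.
move=> k0 p0 hp qp.
pose R := {mpoly F[n]}.
pose psi : R -> {poly R} := mmap (polyC \o @mpolyC n F) (fun i => ('X_i)%:P * 'X).
have psiE s : psi s = \sum_(m <- msupp s) (s@_m *: 'X_[m]) *: 'X^(mdeg m).
  rewrite /psi /mmap; apply: eq_bigr => m _ /=.
  rewrite -mul_polyC -mul_mpolyC rmorphM /= -mulrA; congr (_ * _).
  rewrite mpolyXE_id rmorph_prod mdegE -prodrXr -big_split /=.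
  by apply: eq_bigr => i _; rewrite exprMn rmorphXn.
have psic s d : (psi s)`_d = pihomog [measure of mdeg] d s.
  rewrite psiE coef_sum pihomogE [RHS]big_mkcond; apply: eq_bigr => m _.
  rewrite coefZ coefXn eq_sym; case: eqP => _; by rewrite ?mulr1 ?mulr0.
have psip : psi p = p *: 'X^(r * k).
  rewrite psiE -mul_polyC [in RHS](mpolyE p) rmorph_sum mulr_suml big_seq [RHS]big_seq.
  apply: eq_bigr => m hm; rewrite mul_polyC.
  by move/dhomogP: hp => /(_ m hm) /= ->.
have E : psi q ^+ k = p *: 'X^(r * k) by rewrite -psip -qp /psi rmorphXn.
have q0 : psi q != 0.
  apply/negP => /eqP q0; move: E; rewrite q0 expr0n gtn_eqF // => /esym/eqP.
  by rewrite scale_poly_eq0 (negbTE p0) -size_poly_eq0 size_polyXn.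
have [v [A A0 AE]] := multiplicity_XsubC (psi q) 0.
move: A0; rewrite q0 subr0 /= in AE * => A0.
have E2 : A ^+ k * 'X^(v * k) = p *: 'X^(r * k) by rewrite -E AE exprMn -exprM.
have Ak0 : (A ^+ k)`_0 != 0.
  rewrite -horner_coef0 horner_exp expf_eq0 k0 /=.
  by move: A0; rewrite rootE.
have vr : (v * k = r * k)%N.
  have := congr1 (fun s : {poly R} => s`_(v * k)) E2.
  rewrite coefMXn ltnn subnn coefZ coefXn; case: eqP => // _.
  by rewrite mulr0 => /eqP; rewrite (negbTE Ak0).
have vr' : v = r by apply/eqP; rewrite -(eqn_pmul2r k0) vr.
have Ac : A ^+ k = p%:P.
  apply: (mulIf (x := 'X^(v * k))); first by rewrite monic_neq0 // monicXn.
  by rewrite E2 vr mul_polyC.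
have sA : size A = 1%N.
  have := size_exp A k; rewrite Ac size_polyC p0 /= => /esym /eqP.
  rewrite muln_eq0 (gtn_eqF k0) orbF.
  have : A != 0 by apply/negP => /eqP A00; move: A0; rewrite A00 root0.
  by rewrite -size_poly_gt0; case: (size A) => [|[|]].
have psi1 : (psi q).[1] = q.
  rewrite -horner_evalE /psi rmorph_mmap -[RHS]mmap_id; apply: eq_mmap => x /=.
    by rewrite horner_evalE hornerC.
  by rewrite horner_evalE hornerM hornerC hornerX mulr1.
rewrite -psi1 AE hornerM hornerXn expr1n mulr1.
have -> : A = (A`_0)%:P by apply: size1_polyC; rewrite sA.
rewrite hornerC; have <- : (psi q)`_r = A`_0.
  by rewrite AE coefMXn vr' ltnn subnn.
by rewrite psic; apply: pihomogP.
Qed.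

(** * Division algebras over a C1-field are commutative *)

(** The [d i] span a unital subalgebra in which a combination is invertible unless
    all its coefficients vanish.  For [n > 0] this forces them to be linearly
    independent, and the span is a division algebra of dimension [m]. *)
Definition division_span (F : fieldType) m n (d : 'I_m -> 'M[F]_n) : Prop :=
  [/\ forall i j, exists c : 'I_m -> F, d i *m d j = \sum_l c l *: d l,
      exists c : 'I_m -> F, 1%:M = \sum_l c l *: d l
    & forall c : 'I_m -> F, \sum_l c l *: d l \in unitmx \/ forall l, c l = 0].

Lemma lincomb_mulmx (R : fieldType) m n (d : 'I_m -> 'M[R]_n) :
  (forall i j, exists c : 'I_m -> R, d i *m d j = \sum_l c l *: d l) ->
  forall c c' : 'I_m -> R, exists e : 'I_m -> R,
    (\sum_l c l *: d l) *m (\sum_l c' l *: d l) = \sum_l e l *: d l.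
Proof.
move=> hM c c'; pose a i j := sval (cid (hM i j)).
have aE i j : d i *m d j = \sum_l a i j l *: d l by rewrite /a; case: cid.
exists (fun l => \sum_i \sum_j c i * c' j * a i j l).
rewrite mulmx_suml; under [RHS]eq_bigr do rewrite scaler_suml.
rewrite [RHS]exchange_big; apply: eq_bigr => i _.
rewrite mulmx_sumr; under [RHS]eq_bigr do rewrite scaler_suml.
rewrite [RHS]exchange_big; apply: eq_bigr => j _.
rewrite -scalemxAl -scalemxAr scalerA aE scaler_sumr.
by apply: eq_bigr => l _; rewrite scalerA.
Qed.

Lemma fraction_ratio (R : idomainType) (x : {fraction R}) :
  exists a b : R, b != 0 /\ x * @tofrac R b = @tofrac R a.
Proof.
elim/quotW: x => -[[a b] /= b0]; exists a, b; split=> //.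
unlock tofrac.
rewrite [LHS]/GRing.mul /= -FracField.pi_mul.
apply/eqmodP; rewrite /= FracField.equivfE /FracField.mulf /= !numden_Ratio ?oner_eq0 ?mulr1 //=.
by rewrite mulrC.
Qed.

Lemma common_denominator (R : idomainType) m (c : 'I_m -> {fraction R}) :
  exists (a : 'I_m -> R) b, b != 0 /\ forall l, c l * @tofrac R b = @tofrac R (a l).
Proof.
have hc l : exists ab : R * R, ab.2 != 0 /\ c l * @tofrac R ab.2 = @tofrac R ab.1.
  by have [a [b h]] := fraction_ratio (c l); exists (a, b).
pose ab l := sval (cid (hc l)).
have habn l : (ab l).2 != 0 by rewrite /ab; case: cid => ? [].
have hab l : c l * @tofrac R (ab l).2 = @tofrac R (ab l).1 by rewrite /ab; case: cid => ? [].
exists (fun l => (ab l).1 * \prod_(j | j != l) (ab j).2), (\prod_j (ab j).2); split.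
  by apply/prodf_neq0 => l _.
by move=> l; rewrite (bigD1 l) //= !rmorphM /= mulrA hab.
Qed.

(** [mu] is prime, so it is the only monic prime factor of its powers. *)
Lemma monic_dvd_exp (Q : fieldType) (mu chi : {poly Q}) e :
  mu \is monic -> chi \is monic ->
  (forall f g, (mu %| f * g)%R -> (mu %| f)%R \/ (mu %| g)%R) ->
  (chi %| mu ^+ e)%R -> exists k, chi = mu ^+ k.
Proof.
move=> mm mc pr; elim: e chi mc => [|e IH] chi mc dv.
  exists 0%N; rewrite expr0 in dv *.
  by apply/eqP; rewrite -eqp_monic ?monic1 // /eqp dv dvd1p.
have mu0 : mu != 0 by exact: monic_neq0.
case: (boolP (mu %| chi)%R) => [/dvdpP [q qE]|nd].
  have mq : q \is monic by move: mc; rewrite qE monicMr.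
  have [|k kE] := IH q mq; first by move: dv; rewrite qE exprSr dvdp_mul2r.
  by exists k.+1; rewrite qE kE exprSr.
exists 0%N; rewrite expr0; apply/eqP; rewrite -eqp_monic ?monic1 // /eqp dvd1p andbT.
suff cop : coprimep chi mu.
  by rewrite -(Gauss_dvdpr 1 (coprimep_expr e.+1 cop)) mulr1.
have [h hE] := dvdpP _ _ (dvdp_gcdr chi mu).
have : (mu %| h * gcdp chi mu)%R by rewrite -hE.
case/pr => [muh|mug]; last by case/negP: nd; apply: dvdp_trans mug (dvdp_gcdl _ _).
rewrite /coprimep; have g0 : gcdp chi mu != 0 by rewrite gcdp_eq0 negb_and mu0 orbT.
have h0 : h != 0 by apply/negP => /eqP h0; move: mu0; rewrite hE h0 mul0r eqxx.
have := dvdp_leq h0 muh; rewrite {1}hE size_mul //.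
have : (0 < size h)%N by rewrite size_poly_gt0.
have : (0 < size (gcdp chi mu))%N by rewrite size_poly_gt0.
by case: (size (gcdp _ _)) => [|[|s]] //; case: (size h) => // t _ _; rewrite addSn /= !addnS ltnS ltnNge leq_addr.
Qed.

(** [f%:M - f(A)] is divisible by ['X - A] as a polynomial matrix, so [f(A) = 0]
    makes the scalar matrix [f%:M] a multiple of the characteristic matrix; take
    determinants. *)
Lemma char_poly_dvd_exp (Q : fieldType) n (A : 'M[Q]_n.+1) (f : {poly Q}) :
  horner_mx A f = 0 -> (char_poly A %| f ^+ n.+1)%R.
Proof.
move=> fA.
suff [B BE] : exists B : 'M[{poly Q}]_n.+1,
    f%:M - map_mx polyC (horner_mx A f) = char_poly_mx A *m B.
  move: BE; rewrite fA map_mx0 subr0 => /(congr1 determinant).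
  by rewrite det_scalar det_mulmx => ->; apply: dvdp_mulr.
elim/poly_ind: f {fA} => [|g c [B BE]].
  by exists 0; rewrite mulmx0 (rmorph0 (horner_mx A)) map_mx0 subr0 -scalemx1 scale0r.
set G := horner_mx A g in BE.
exists (B *m 'X%:M + map_mx polyC G).
have AG : map_mx polyC A *m map_mx polyC G = map_mx polyC G *m map_mx polyC A.
  by rewrite -!map_mxM; congr map_mx; rewrite /G; apply: comm_mx_horner.
have -> : horner_mx A (g * 'X + c%:P) = G *m A + c%:M.
  by rewrite rmorphD rmorphM /= horner_mx_X horner_mx_C.
rewrite map_mxD map_scalar_mx map_mxM raddfD /= scalar_mxM.
rewrite mulmxDr mulmxA -BE /char_poly_mx !mulmxBl AG (scalar_mxC 'X (map_mx polyC G)).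
by rewrite opprD addrACA subrr addr0 addrA subrK.
Qed.

Lemma prod_homog1 (R : comNzRingType) n (J : Type) (s : seq J) (G : J -> {mpoly R[n]}) :
  (forall j, G j \is 1.-homog) -> \prod_(j <- s) G j \is (size s).-homog.
Proof.
move=> hG; elim: s => [|j s IH]; first by rewrite big_nil; exact: dhomog1.
by rewrite big_cons; exact: dhomogM (hG j) IH.
Qed.

Lemma det_homog (R : comNzRingType) n m (A : 'M[{mpoly R[n]}]_m) :
  (forall i j, A i j \is 1.-homog) -> \det A \is m.-homog.
Proof.
move=> hA; rewrite /determinant; apply: rpred_sum => s _.
rewrite mulr_sign; suff h : \prod_i A i (s i) \is m.-homog by case: ifP => _; rewrite ?dhomogN.
by have := prod_homog1 (index_enum 'I_m) (fun i => hA i (s i)); rewrite -[index_enum _]enumT size_enum_ord.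
Qed.

(** The matrices have the size of the algebra, so [p] is the norm of the generic
    element [X], a form of degree [m] without nontrivial zeros.  Over the field of
    rational functions the span is still a division algebra, so the minimal
    polynomial [mu] of [X] is prime and the characteristic polynomial is [mu ^+ k].
    Comparing constant terms, [p] is up to sign the [k]-th power of a fraction,
    which is a form of degree [m / k] without nontrivial zeros.  The C1 property
    gives [k = 1].  Then the powers of [X] span the algebra, which is therefore
    commutative. *)
Theorem infinite_division_comm (F : fieldType) m (d : 'I_m -> 'M[F]_m) :
  C1_field F -> infinite_field F -> division_span d ->
  forall i j, d i *m d j = d j *m d i.
Proof.
case: m d => [|m] d hC1 Finf [hM h1 hU]; first by case.
pose R := {mpoly F[m.+1]}.
pose X : 'M[R]_m.+1 := \sum_l 'X_l *: map_mx (@mpolyC m.+1 F) (d l).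
pose p := \det X.
have pE v : p.@[v] = \det (\sum_l v l *: d l).
  rewrite /p -det_map_mx; congr determinant.
  rewrite /X raddf_sum; apply: eq_bigr => l _ /=.
  by apply/matrixP => i j; rewrite !mxE rmorphM /= mevalXU mevalC.
have hp : p \is m.+1.-homog.
  apply: det_homog => i j; rewrite summxE; apply: rpred_sum => l _.
  rewrite !mxE mulrC mul_mpolyC; apply: rpredZ; by rewrite dhomogX; apply/eqP/mdeg1.
pose Q := {fraction R}; pose tf : {rmorphism R -> Q} := @tofrac R.
pose fQ : {rmorphism F -> Q} := tf \o @mpolyC m.+1 F.
pose dQ l := map_mx fQ (d l).
pose S (x : 'M[Q]_m.+1) := exists c : 'I_m.+1 -> Q, x = \sum_l c l *: dQ l.
have S0 : S 0 by exists (fun=> 0); rewrite big1 // => l _; rewrite scale0r.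
have SD x y : S x -> S y -> S (x + y).
  case=> c -> [e ->]; exists (fun l => c l + e l); rewrite -big_split.
  by apply: eq_bigr => l _; rewrite scalerDl.
have SZ a x : S x -> S (a *: x).
  by case=> c ->; exists (fun l => a * c l); rewrite scaler_sumr; apply: eq_bigr => l _; rewrite scalerA.
have Sd (c : 'I_m.+1 -> F) : S (map_mx fQ (\sum_l c l *: d l)).
  exists (fun l => fQ (c l)); rewrite raddf_sum; apply: eq_bigr => l _.
  by rewrite -map_mxZ.
have S1 : S 1%:M by have [c cE] := h1; rewrite -(map_mx1 fQ) cE.
have SM x y : S x -> S y -> S (x *m y).
  case=> c -> [e ->]; apply: lincomb_mulmx => i j.
  have [a aE] := hM i j; exists (fun l => fQ (a l)); rewrite -map_mxM aE raddf_sum.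
  by apply: eq_bigr => l _; rewrite /= map_mxZ.
(* A nonzero element is, after clearing denominators, specialized at a point where
   one of its coefficients does not vanish, and becomes invertible there. *)
have SU x : S x -> x != 0 -> x \in unitmx.
  case=> c -> x0.
  have [a [b [b0 ab]]] := common_denominator c.
  have [l0 al0] : exists l, a l != 0.
    apply: contrapT => h; case/negP: x0; apply/eqP; apply: big1 => l _.
    suff -> : c l = 0 by rewrite scale0r.
    have al : a l = 0 by apply/eqP/negPn/negP => al; apply: h; exists l.
    have := ab l; rewrite al tofrac0 => /eqP; rewrite mulf_eq0 tofrac_eq0 (negbTE b0) orbF.
    by move/eqP.
  have [v hv] := meval_neq0 Finf al0.
  pose A : 'M[R]_m.+1 := \sum_l a l *: map_mx (@mpolyC m.+1 F) (d l).
  have AE : (\det A).@[v] = \det (\sum_l (a l).@[v] *: d l).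
    rewrite -det_map_mx; congr determinant.
    rewrite /A raddf_sum; apply: eq_bigr => l _ /=.
    by apply/matrixP => i j; rewrite !mxE rmorphM /= mevalC.
  have dA : \det A != 0.
    apply/negP => /eqP dA; move: AE; rewrite dA meval0 => /esym dt.
    case: (hU (fun l => (a l).@[v])); first by rewrite unitmxE dt unitr0.
    by move=> h; move: hv; rewrite h eqxx.
  have AtE : map_mx tf A = tf b *: \sum_l c l *: dQ l.
    rewrite /A raddf_sum scaler_sumr; apply: eq_bigr => l _ /=.
    rewrite map_mxZ -map_mx_comp scalerA mulrC; congr (_ *: _).
    by rewrite -[RHS]/(c l * tofrac b) ab.
  rewrite unitmxE unitfE; apply/negP => /eqP dx.
  have := congr1 determinant AtE; rewrite det_map_mx detZ dx mulr0 => /eqP.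
  by rewrite -[_ == 0]/(tofrac (\det A) == 0) tofrac_eq0 (negbTE dA).
pose xi := map_mx tf X.
have xiS : S xi.
  exists (fun l => tf 'X_l); rewrite /xi raddf_sum; apply: eq_bigr => l _ /=.
  by rewrite map_mxZ -map_mx_comp.
pose mu := mxminpoly xi; pose chi := char_poly xi.
have hornS f : S (horner_mx xi f).
  elim/poly_ind: f => [|f c IH]; first by rewrite (rmorph0 (horner_mx xi)).
  rewrite rmorphD rmorphM /= horner_mx_X horner_mx_C.
  by apply: (SD); [exact: SM | rewrite -scalemx1; exact: SZ].
(* [mu] is prime since [f(xi)] and [g(xi)] lie in a division algebra. *)
have pr f g : (mu %| f * g)%R -> (mu %| f)%R \/ (mu %| g)%R.
  rewrite /mu !dvd_mxminpoly rmorphM /= => /eqP fg.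
  case: (eqVneq (horner_mx xi f) 0) => [|f0]; [by left | right].
  by apply/eqP; rewrite -[LHS](mulKmx (SU _ (hornS f) f0)) mulmxE fg mulr0.
have mum : mu \is monic by exact: mxminpoly_monic.
have [k chiE] : exists k, chi = mu ^+ k.
  apply: (monic_dvd_exp mum (char_poly_monic _) pr).
  exact: char_poly_dvd_exp (mx_root_minpoly _).
have mu1 : (1 < size mu)%N by rewrite size_mxminpoly ltnS mxminpoly_nonconstant.
have szE : m.+1 = ((size mu).-1 * k)%N.
  have := size_char_poly xi; rewrite -/chi chiE => sz.
  by have := size_exp mu k; rewrite sz.
have k0 : (0 < k)%N by case: (k) szE => //; rewrite muln0.
case: (leqP 2 k) => hk; last first.
  have k1 : k = 1%N by apply/eqP; rewrite eqn_leq k0 -ltnS hk.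
  have dE : degree_mxminpoly xi = m.+1 by apply: esym; apply: etrans szE _; rewrite k1 muln1 /mu size_mxminpoly.
  pose D := \matrix_l mxvec (dQ l).
  have sub : (powers_mx xi (degree_mxminpoly xi) <= D)%MS.
    apply/row_subP => i; rewrite rowK.
    have [c cE] : S (xi ^+ i) by have := hornS ('X ^+ i); rewrite rmorphXn /= horner_mx_X.
    apply/submxP; exists (\row_l c l); rewrite cE raddf_sum mulmx_sum_row.
    apply: eq_bigr => l _; rewrite rowK mxE; exact: linearZ_LR.
  have DA : (D <= powers_mx xi (degree_mxminpoly xi))%MS.
    rewrite -(geq_leqif (mxrank_leqif_sup sub)) (eqP (minpoly_mx_free xi)) dE.
    exact: rank_leq_row.
  have hd l : exists f, dQ l = horner_mx xi f.
    exists (mx_inv_horner xi (dQ l)); rewrite mx_inv_hornerK //.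
    by apply: submx_trans DA; rewrite -(rowK (fun l => mxvec (dQ l))) row_sub.
  move=> i j; apply: (map_mx_inj (f := fQ)); rewrite !map_mxM.
  have [f fE] := hd i; have [g gE] := hd j.
  by rewrite -!/(dQ _) fE gE !mulmxE -!rmorphM mulrC.
exfalso.
have [a [b [b0 ab]]] := fraction_ratio mu`_0.
pose p' := (-1) ^+ m.+1 * p.
have ck : mu`_0 ^+ k = tf p'.
  have := char_poly_det xi; rewrite -/chi chiE -horner_coef0 horner_exp horner_coef0 => ->.
  by rewrite /xi det_map_mx rmorphM /= rmorphXn rmorphN1.
have abk : a ^+ k = p' * b ^+ k.
  apply/eqP; rewrite -tofrac_eq; apply/eqP.
  by rewrite tofracM !tofracXn -ab exprMn ck.
have [x0 bx0] := meval_neq0 Finf b0.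
have [g gE] := root_closed k0 bx0 abk.
have gk : g ^+ k = p'.
  apply: (mulIf (expf_neq0 k b0)); by rewrite -abk gE exprMn.
have p'E v : p'.@[v] = (-1) ^+ m.+1 * \det (\sum_l v l *: d l).
  by rewrite /p' rmorphM /= pE rmorphXn rmorphN1.
have p'0 : p' != 0.
  have [c cE] := h1; apply/negP => /eqP p0.
  have := p'E c; rewrite p0 meval0 -cE det1 mulr1 => /esym/eqP.
  by rewrite signr_eq0.
have hg : g \is (size mu).-1.-homog.
  apply: (homog_root k0 p'0 _ gk); rewrite -szE /p' -signr_odd mulr_sign.
  by case: ifP => _; rewrite ?dhomogN.
have [|v [i vi] gv] := hC1 m.+1 (size mu).-1 g _ hg.
  have d0 : (0 < (size mu).-1)%N by rewrite -subn1 subn_gt0.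
  by rewrite d0; have := ltn_Pmulr hk d0; rewrite -szE.
have : p'.@[v] = 0 by rewrite -gk rmorphXn /= gv expr0n gtn_eqF.
rewrite p'E => /eqP; rewrite mulf_eq0 signr_eq0 /= => /eqP dt.
case: (hU v); first by rewrite unitmxE dt unitr0.
by move=> v0; case/negP: vi; rewrite v0.
Qed.

(** A bundled predicate, so that the subring it defines carries canonical
    structures. *)
Record mx_divring (F : fieldType) n := MxDivring {
  mx_divring_pred :> {pred 'M[F]_n.+1};
  mx_divring_closed : divring_closed mx_divring_pred
}.

Section FiniteDivision.
Variables (F : finFieldType) (n : nat) (S : mx_divring F n).

HB.instance Definition _ :=
  GRing.isDivringClosed.Build 'M[F]_n.+1 (mx_divring_pred S) (mx_divring_closed S).

Record divsub : Type := DivSub { divsub_val : 'M[F]_n.+1; _ : divsub_val \in S }.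
HB.instance Definition _ := [isSub for divsub_val].
HB.instance Definition _ := [Finite of divsub by <:].
HB.instance Definition _ := [SubChoice_isSubUnitRing of divsub by <:].
End FiniteDivision.

(** Wedderburn's little theorem, applied to the span as a finite domain.  Inverses
    stay in the span since a unit of a finite ring has finite order. *)
Lemma finField_division_comm (F : finFieldType) m n (d : 'I_m -> 'M[F]_n) :
  division_span d -> forall i j, d i *m d j = d j *m d i.
Proof.
case: n d => [|n] d [hM h1 hU] i j; first by rewrite [LHS]flatmx0 [RHS]flatmx0.
pose P (x : 'M[F]_n.+1) := exists c : 'I_m -> F, x = \sum_l c l *: d l.
pose S : {pred 'M[F]_n.+1} := fun x => `[< P x >].
have SP x : reflect (P x) (x \in S) by exact: asboolP.
have P0 : P 0 by exists (fun=> 0); rewrite big1 // => l _; rewrite scale0r.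
have PD x y : P x -> P y -> P (x + y).
  case=> c -> [e ->]; exists (fun l => c l + e l); rewrite -big_split.
  by apply: eq_bigr => l _; rewrite scalerDl.
have PZ a x : P x -> P (a *: x).
  by case=> c ->; exists (fun l => a * c l); rewrite scaler_sumr; apply: eq_bigr => l _; rewrite scalerA.
have PM x y : P x -> P y -> P (x * y).
  by case=> c -> [e ->]; exact: lincomb_mulmx.
have Pd l : P (d l).
  exists (fun k => (k == l)%:R); rewrite (bigD1 l) //= eqxx scale1r big1 ?addr0 // => k kl.
  by rewrite (negbTE kl) scale0r.
have PX x e : P x -> P (x ^+ e).
  by move=> hx; elim: e => [|e IH]; rewrite ?expr0 // exprS; exact: PM.
have PU x : P x -> x != 0 -> x \is a GRing.unit.
  case=> c xE; case: (hU c) => [|c0]; [by rewrite -xE | case/negP].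
  by rewrite xE big1 // => l _; rewrite c0 scale0r.
have PV x : P x -> P x^-1.
  move=> hx; case: (eqVneq x 0) => [->|x0]; first by rewrite invr0.
  have [e [e0 xe]] : exists e, (0 < e)%N /\ x ^+ e = 1.
    have /injectivePn [a [b ab xab]] : ~~ injectiveb (fun i : 'I_#|'M[F]_n.+1|.+1 => x ^+ i).
      by apply/injectiveP => /leq_card; rewrite card_ord ltnn.
    wlog lt_ab : a b ab xab / (a < b)%N => [W|].
      case: (ltngtP a b) => [|ba|/val_inj /eqP]; [exact: W | | by rewrite (negbTE ab)].
      by apply: (W b a) => //; rewrite eq_sym.
    exists (b - a)%N; rewrite subn_gt0; split=> //.
    have ux := unitrX a (PU _ hx x0).
    apply: (mulrI ux); rewrite -exprD subnKC ?(ltnW lt_ab) // mulr1.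
    by rewrite xab.
  have -> : x^-1 = x ^+ e.-1.
    by apply: (mulrI (PU _ hx x0)); rewrite mulrV ?PU // -exprS prednK.
  exact: PX.
have hS : divring_closed S.
  split; first by apply/SP; have [c cE] := h1; exists c.
    by move=> x y /SP hx /SP hy; apply/SP/PD => //; rewrite -scaleN1r; apply: PZ.
  by move=> x y /SP hx /SP hy; apply/SP/PM => //; apply: PV.
pose T := MxDivring hS; pose E : finUnitRingType := divsub T.
have domE : GRing.integral_domain_axiom E.
  move=> x y xy; apply/orP.
  case: (eqVneq x 0) => [|x0]; [by left | right].
  have ux : divsub_val x \is a GRing.unit.
    by apply: PU; [apply/SP; exact: valP | rewrite -(inj_eq val_inj) in x0].
  rewrite -(inj_eq val_inj); apply/eqP/(mulrI ux); rewrite mulr0.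
  exact: (congr1 (@divsub_val F n T) xy).
have inS l : d l \in S by apply/SP.
have := finDomain_mulrC domE (@DivSub F n T (d i) (inS i)) (@DivSub F n T (d j) (inS j)).
by move/(congr1 (@divsub_val F n T)).
Qed.

Lemma finite_division_comm (F : fieldType) m n (d : 'I_m -> 'M[F]_n) :
  ~ infinite_field F -> division_span d -> forall i j, d i *m d j = d j *m d i.
Proof.
move=> nF; have [s hs] : exists s : seq F, forall x, x \in s.
  apply: contrapT => h; apply: nF => s; apply: contrapT => h2; apply: h.
  by exists s => x; apply/negPn/negP => xs; apply: h2; exists x.
have fK : pcancel (fun x : F => index x s) (onth s).
  move=> x; rewrite onthE (nth_map x) ?index_mem //.
  by rewrite nth_index.
have eK : Finite.axiom (undup s).
  by move=> x; rewrite count_uniq_mem ?undup_uniq // mem_undup hs.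
pose C := PCanIsCountable fK.
pose F1 : countType := HB.pack F C.
pose B : isFinite F1 := isFinite.Build F1 eK.
pose FF : finFieldType := HB.pack F C B.
exact: (@finField_division_comm FF m n d).
Qed.

(** * Finitely generated subfields *)

Section Span.
Variables (F K : fieldType) (iota : {rmorphism F -> K}).

(** Linear combinations over [F]; the coefficients enter [K] through [iota]. *)
Definition fspan (J : finType) (b : J -> K) (x : K) : Prop :=
  exists c : J -> F, x = \sum_j iota (c j) * b j.

Section FSpan.
Variables (J : finType) (b : J -> K).

Lemma fspan0 : fspan b 0.
Proof. by exists (fun=> 0); rewrite big1 // => j _; rewrite rmorph0 mul0r. Qed.
Lemma fspanD x y : fspan b x -> fspan b y -> fspan b (x + y).
Proof.
case=> c -> [d ->]; exists (fun j => c j + d j); rewrite -big_split.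
by apply: eq_bigr => j _; rewrite rmorphD mulrDl.
Qed.
Lemma fspanZ a x : fspan b x -> fspan b (iota a * x).
Proof.
case=> c ->; exists (fun j => a * c j); rewrite mulr_sumr.
by apply: eq_bigr => j _; rewrite rmorphM mulrA.
Qed.
Lemma fspan_sum (H : finType) (G : H -> K) :
  (forall h, fspan b (G h)) -> fspan b (\sum_h G h).
Proof. by move=> hG; apply: (big_ind (fspan b) fspan0 fspanD) => h _. Qed.
Lemma fspan_gen j : fspan b (b j).
Proof.
exists (fun k => (k == j)%:R); rewrite (bigD1 j) //= eqxx rmorph1 mul1r.
by rewrite big1 ?addr0 // => k /negbTE ->; rewrite rmorph0 mul0r.
Qed.
Lemma fspan_mul (H : finType) (b' : H -> K) x y :
  (forall i j, fspan b (b i * b' j)) -> fspan b x -> fspan b' y -> fspan b (x * y).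
Proof.
move=> h [c ->] [d ->]; rewrite mulr_suml; apply: fspan_sum => i.
rewrite mulr_sumr; apply: fspan_sum => j.
by rewrite mulrACA -rmorphM; apply: fspanZ.
Qed.
End FSpan.

Lemma fspan_sub (J H : finType) (b : J -> K) (b' : H -> K) x :
  (forall j, fspan b' (b j)) -> fspan b x -> fspan b' x.
Proof. by move=> h [c ->]; apply: fspan_sum => j; apply: fspanZ. Qed.

Lemma fspan_ord (J : finType) (b : J -> K) x :
  fspan b x <-> fspan (fun i : 'I_#|J| => b (enum_val i)) x.
Proof.
split; apply: fspan_sub => j; last exact: fspan_gen.
by rewrite -(enum_rankK j); apply: (fspan_gen (fun i : 'I_#|J| => b (enum_val i))).
Qed.

Lemma fspan_free s (b : 'I_s -> K) : exists s' (b' : 'I_s' -> K),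
  freefam iota b' /\ forall x, fspan b x <-> fspan b' x.
Proof.
elim: s b => [|s IH] b; first by exists 0%N, b; split=> // c _ [].
case: (pselect (freefam iota b)) => [fb|nfb]; first by exists s.+1, b.
have [c [c0 [i0 ci0]]] : exists c : 'I_s.+1 -> F,
    \sum_i iota (c i) * b i = 0 /\ exists i, c i != 0.
  apply: contrapT => h; apply: nfb => c c0 i; apply/eqP/negPn/negP => ci.
  by apply: h; exists c; split=> //; exists i.
have [s' [b' [fb' h]]] := IH (fun l => b (lift i0 l)).
exists s', b'; split=> // x; rewrite -h; split; apply: fspan_sub => j; last exact: fspan_gen.
case: (unliftP i0 j) => [l ->|->]; first exact: (fspan_gen (fun l => b (lift i0 l))).
have -> : b i0 = \sum_l iota (- (c (lift i0 l) / c i0)) * b (lift i0 l).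
  have fc : iota (c i0) != 0 by rewrite fmorph_eq0.
  apply: (mulfI fc); rewrite mulr_sumr.
  move: c0; rewrite (bigD1_ord i0) //= => /eqP; rewrite addr_eq0 -sumrN => /eqP ->.
  apply: eq_bigr => l _; rewrite mulrA -rmorphM -mulNr -rmorphN mulrN; congr (iota (- _) * _).
  by rewrite mulrC divfK.
by exists (fun l => - (c (lift i0 l) / c i0)).
Qed.

Hypothesis hK : separable_algebraic iota.

(** The span is a subring of [K], hence a field by [span_field]. *)
Definition span_ring (J : finType) (b : J -> K) : Prop :=
  fspan b 1 /\ forall x y, fspan b x -> fspan b y -> fspan b (x * y).

(** Adjoining [c], a root of [p], multiplies a spanning family by the powers of
    [c] below the degree of [p]. *)
Lemma algebraic_span (cs : seq K) : exists s (b : 'I_s -> K),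
  [/\ freefam iota b, span_ring b & forall c, c \in cs -> fspan b c].
Proof.
suff [s [b [hb hc]]] : exists s (b : 'I_s -> K),
    span_ring b /\ forall c, c \in cs -> fspan b c.
  have [s' [b' [fb' h]]] := fspan_free b; exists s', b'; split=> //.
    by split=> [|x y /h hx /h hy]; apply/h; [exact: hb.1 | exact: hb.2].
  by move=> c /hc /h.
elim: cs => [|c cs [s [b [[b1 bM] hc]]]].
  exists 1%N, (fun=> 1); split=> //; split.
    by exists (fun=> 1); rewrite big_ord1 rmorph1 mul1r.
  move=> x y hx hy; apply: fspan_mul hx hy => i j; rewrite mulr1.
  exact: (fspan_gen (fun _ : 'I_1 => 1)).
have [p [irr rt _]] := hK c.
have p0 : p != 0 by apply/negP => /eqP E; move: irr.1; rewrite E size_poly0.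
pose J : finType := ('I_s * 'I_(size p).-1)%type.
pose b2 (j : J) := b j.1 * c ^+ j.2.
suff [h1 h2] : span_ring b2 /\ forall x, x \in c :: cs -> fspan b2 x.
  exists #|J|, (fun i => b2 (enum_val i)); split; last by move=> x /h2 /(fspan_ord b2 x).1.
  split=> [|x y /(fspan_ord b2 _).2 hx /(fspan_ord b2 _).2 hy]; apply/(fspan_ord b2 _).1.
    exact: h1.1.
  exact: h1.2.
have powc N y : fspan b y -> fspan b2 (y * c ^+ N).
  move=> hy; have sz : (size ('X^N %% p)%R < size p)%N by rewrite ltn_modp.
  have -> : c ^+ N = \sum_(j < (size p).-1) iota ('X^N %% p)`_j * c ^+ j.
    have := congr1 (fun q => (map_poly iota q).[c]) (divp_eq 'X^N p).
    rewrite /= map_polyXn hornerXn rmorphD rmorphM hornerD hornerM (eqP rt) mulr0 add0r => ->.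
    rewrite (@horner_coef_wide _ (size p).-1); last first.
      rewrite size_map_poly -ltnS prednK ?size_poly_gt0 //.
    by apply: eq_bigr => j _; rewrite coef_map.
  rewrite mulr_sumr; apply: fspan_sum => j; rewrite mulrCA; apply: fspanZ.
  case: hy => d ->; rewrite mulr_suml; apply: fspan_sum => i; rewrite -mulrA; apply: fspanZ.
  exact: (fspan_gen b2 (i, j)).
split; last first.
  move=> x; rewrite inE => /orP [/eqP ->|/hc hx].
    by rewrite -[c]mul1r -[X in _ * X]expr1; apply: powc.
  by rewrite -[x]mulr1 -(expr0 c); apply: powc.
split; first by rewrite -[1]mulr1 -{2}(expr0 c); apply: powc.
move=> x y hx hy; apply: fspan_mul hx hy => i j; rewrite /b2 mulrACA -exprD.
by apply: powc; apply: bM; apply: fspan_gen.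
Qed.

(** If [x] is a root of [q * 'X + a%:P], then its inverse is [- q.[x] / a], a
    polynomial in [x]. *)
Lemma subring_inv (P : K -> Prop) x :
  (forall a, P (iota a)) -> (forall y z, P y -> P z -> P (y + z)) ->
  (forall y z, P y -> P z -> P (y * z)) -> P x -> P x^-1.
Proof.
move=> PF PD PM Px; case: (eqVneq x 0) => [->|x0]; first by rewrite invr0 -(rmorph0 iota); apply: PF.
have [p [irr rt _]] := hK x.
have [q [a pE]] : exists q a, p = q * 'X + a%:P.
  by elim/poly_ind: p {irr rt} => [|q a _]; [exists 0, 0; rewrite mul0r addr0 | exists q, a].
have a0 : a != 0.
  apply/negP => /eqP a0; have Xp : ('X %| p)%R by rewrite pE a0 addr0 dvdp_mull.
  have := irr.2 'X; rewrite size_polyX => /(_ isT Xp) Xe.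
  move: rt; have -> : root (map_poly iota p) x = root (map_poly iota 'X) x.
    by apply: eqp_root; rewrite eqp_map eqp_sym.
  by rewrite map_polyX rootE hornerX (negbTE x0).
have -> : x^-1 = iota (- a^-1) * (map_poly iota q).[x].
  apply: (mulIf x0); rewrite mulVf // rmorphN !mulNr -mulrA.
  move: rt; rewrite pE rmorphD rmorphM /= map_polyX map_polyC rootE hornerD hornerM hornerX hornerC.
  rewrite addr_eq0 => /eqP ->; rewrite mulrN opprK fmorphV mulVf //.
  by rewrite fmorph_eq0.
apply: (PM); [exact: PF | elim/poly_ind: {pE} q => [|q c IH]].
  by rewrite rmorph0 horner0 -(rmorph0 iota); apply: PF.
rewrite rmorphD rmorphM /= map_polyX map_polyC hornerD hornerM hornerX hornerC.
by apply: (PD); [apply: (PM) | exact: PF].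
Qed.

Lemma span_field s (b : 'I_s -> K) : span_ring b ->
  exists L : intermediate_field iota, forall x, x \in L <-> fspan b x.
Proof.
move=> [b1 bM]; pose P : {pred K} := fun x => `[< fspan b x >].
have PP x : reflect (fspan b x) (x \in P) by exact: asboolP.
have PF a : fspan b (iota a) by rewrite -[iota a]mulr1; apply: fspanZ.
have cl : divring_closed P.
  split; first exact/PP.
    move=> x y /PP hx /PP hy; apply/PP/fspanD => //.
    by rewrite -mulN1r -(rmorph1 iota) -rmorphN; apply: fspanZ.
  move=> x y /PP hx /PP hy; apply/PP/bM => //.
  by apply: (subring_inv PF) hy; [exact: fspanD | exact: bM].
have fl x : iota x \in P by apply/PP.
by exists (IntermediateField cl fl) => x; split=> [/PP|hx] //; apply/PP.
Qed.
End Span.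

(** * Separable extension of scalars keeps commutative division algebras reduced *)

(** The characteristic polynomial of a nilpotent matrix divides a power of ['X]. *)
Lemma nilmx_trace (K : fieldType) n (x : 'M[K]_n) : nilmx x -> \tr x = 0.
Proof.
case: n x => [|n] x; first by rewrite /mxtrace big_ord0.
case=> e xe.
have dv : (char_poly x %| ('X - 0%:P) ^+ (e * n.+1))%R.
  rewrite exprM; apply: char_poly_dvd_exp.
  by rewrite subr0 rmorphXn /= horner_mx_X.
have /dvdp_exp_XsubCP [j _] := dv.
rewrite eqp_monic ?char_poly_monic ?monic_exp ?monicXsubC // => /eqP; rewrite subr0 => cE.
have jE : j = n.+1.
  by have := size_char_poly x; rewrite cE size_polyXn => - [].
have := char_poly_trace x isT; rewrite cE jE coefXn /= => /esym/eqP.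
by rewrite eqn_leq ltnn andbF oppr_eq0 => /eqP.
Qed.

Section Frobenius.
Variables (R : nzRingType) (p : nat).
Hypothesis pR : p \in [pchar R].

Lemma frobenius_sum_comm (I : Type) (r : seq I) (f : I -> R) :
  (forall i j, GRing.comm (f i) (f j)) ->
  (\sum_(i <- r) f i) ^+ p = \sum_(i <- r) f i ^+ p.
Proof.
move=> cf; elim: r => [|i r IH].
  by rewrite !big_nil expr0n gtn_eqF // prime_gt0 // (pcharf_prime pR).
rewrite !big_cons -IH -!(pFrobenius_autE pR) pFrobenius_autD_comm //.
by apply: commr_sum => j _.
Qed.
End Frobenius.

Section InsepStep.
Variables (F K : fieldType) (iota : {rmorphism F -> K}).
Hypothesis hK : separable_algebraic iota.

(** Over [L], [x] is a common root of its separable polynomial and of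
    ['X^p - x ^+ p], whose [K]-factorization is [('X - x) ^+ p].  Their gcd has
    only the root [x], and it is simple, so the gcd has degree 1 and its
    coefficients give [x] in [L]. *)
Lemma separable_pth_root p (L : intermediate_field iota) x :
  p \in [pchar K] -> x ^+ p \in L -> x \in L.
Proof.
move=> pK xpL; have [mu [irr rt sep]] := hK x.
pose y : ifield L := IField xpL.
pose P1 := map_poly (from_base L) mu; pose P2 : {poly ifield L} := 'X^p - y%:P.
have [v [vF vy vL]] : exists v : {rmorphism ifield L -> K},
    [/\ forall a, v (from_base L a) = iota a, v y = x ^+ p & forall z, v z \in L].
  by exists (into_top L); split=> // z; exact: valP.
have P1E : map_poly v P1 = map_poly iota mu.
  by rewrite /P1 -map_poly_comp; apply: eq_map_poly => a; exact: vF.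
have pX : p \in [pchar {poly K}] by rewrite pchar_poly.
have P2E : map_poly v P2 = ('X - x%:P) ^+ p.
  rewrite /P2 rmorphB /= map_polyXn map_polyC /= vy -[RHS](pFrobenius_autE pX).
  by rewrite pFrobenius_autB_comm ?pFrobenius_autE ?rmorphXn //; apply: mulrC.
have sepK : separable_poly (map_poly iota mu) by rewrite separable_map.
pose g := gcdp P1 P2.
have gE : map_poly v g = gcdp (map_poly iota mu) (('X - x%:P) ^+ p).
  by rewrite /g gcdp_map P1E P2E.
have gdv : (map_poly v g %| ('X - x%:P) ^+ p)%R by rewrite gE dvdp_gcdr.
have gdv1 : (map_poly v g %| map_poly iota mu)%R by rewrite gE dvdp_gcdl.
have rg : root (map_poly v g) x.
  have p0 : (0 < p)%N by rewrite prime_gt0 // (pcharf_prime pK).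
  by rewrite gE root_gcd rt rootE horner_exp hornerXsubC subrr expr0n gtn_eqF //=.
have /dvdp_exp_XsubCP [j jp gj] := gdv.
have sg : size g = j.+1 by rewrite -(size_map_poly v) (eqp_size gj) size_exp_XsubC.
have j1 : j = 1%N.
  case: j {jp} gj sg => [|[|j]] // gj sg.
    by move: rg; rewrite (eqp_root gj) expr0 rootE hornerC oner_eq0.
  have : (('X - x%:P) ^+ 2 %| map_poly iota mu)%R.
    apply: dvdp_trans gdv1; rewrite (eqp_dvdr _ gj); exact: dvdp_exp2l.
  move=> h; have := separable_nosquare sepK (u := 'X - x%:P) (k := 2) isT.
  by rewrite size_XsubC h => /(_ isT).
rewrite j1 in sg.
have rg2 : v g`_1 * x = - v g`_0.
  move: rg; rewrite rootE horner_coef size_map_poly sg !big_ord_recr big_ord0 /=.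
  by rewrite !coef_map expr0 expr1 mulr1 add0r addrC addr_eq0 => /eqP.
have g1 : g`_1 != 0.
  have := lead_coef_eq0 g; rewrite /lead_coef sg /= => ->.
  by rewrite -size_poly_eq0 sg.
have vg1 : v g`_1 != 0 by rewrite fmorph_eq0.
have -> : x = v (- g`_0 / g`_1).
  by rewrite fmorph_div rmorphN -rg2 mulrC mulKf.
exact: vL.
Qed.

(** MacLane's criterion.  The [p]-th powers of the basis span a subfield that
    contains the [p]-th powers of the whole extension, so by [separable_pth_root]
    they span the whole extension; a spanning family of the right size is free. *)
Lemma pth_power_free p s (b : 'I_s -> K) : p \in [pchar K] ->
  freefam iota b -> span_ring iota b -> freefam iota (fun l => b l ^+ p).
Proof.
move=> pK fb [b1 bM].
have Kadd (I : finType) (f : I -> K) : (\sum_i f i) ^+ p = \sum_i f i ^+ p.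
  by apply: (frobenius_sum_comm pK) => i j; apply: mulrC.
have frobS x : fspan iota b x -> fspan iota (fun l => b l ^+ p) (x ^+ p).
  case=> c ->; exists (fun l => c l ^+ p); rewrite Kadd.
  by apply: eq_bigr => l _; rewrite exprMn rmorphXn.
have Mp : span_ring iota (fun l => b l ^+ p).
  split; first by rewrite -(expr1n K p); apply: frobS.
  move=> x y hx hy; apply: fspan_mul hx hy => i j.
  by rewrite -exprMn; apply/frobS/bM; apply: fspan_gen.
have [L hL] := span_field hK Mp.
have bL l : fspan iota (fun l => b l ^+ p) (b l).
  by apply/hL; apply: (separable_pth_root pK); apply/hL/fspan_gen.
have bV l : fspan iota b (b l ^+ p).
  elim: {1}p => [|q IH]; first by rewrite expr0.
  by rewrite exprS; apply: bM IH; apply: fspan_gen.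
pose T := \matrix_(l, k) sval (cid (bL l)) k.
pose T' := \matrix_(l, k) sval (cid (bV l)) k.
have TE l : b l = \sum_k iota (T l k) * b k ^+ p.
  by under eq_bigr do rewrite mxE; case: (cid (bL l)).
have TE' l : b l ^+ p = \sum_k iota (T' l k) * b k.
  by under eq_bigr do rewrite mxE; case: (cid (bV l)).
have comp (c : 'rV[F]_s) : \sum_k iota (c 0 k) * b k ^+ p = \sum_l iota ((c *m T') 0 l) * b l.
  under eq_bigr do rewrite TE' mulr_sumr.
  rewrite exchange_big; apply: eq_bigr => l _; rewrite mxE rmorph_sum mulr_suml.
  by apply: eq_bigr => k _; rewrite mulrA rmorphM.
have TT : T *m T' = 1%:M.
  apply/row_matrixP => l; apply/rowP => k; rewrite row_mul.
  apply/eqP; rewrite -subr_eq0; apply/eqP; move: k.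
  apply: (fb (fun k => (row l T *m T') 0 k - row l 1%:M 0 k)).
  under eq_bigr do rewrite rmorphB mulrBl.
  rewrite sumrB -comp; under eq_bigr do rewrite mxE.
  rewrite -TE (bigD1 l) //= !mxE eqxx rmorph1 mul1r big1 ?addr0 ?subrr // => k kl.
  by rewrite !mxE eq_sym (negbTE kl) rmorph0 mul0r.
move=> c c0 i.
have cT : (\row_k c k) *m T' = 0.
  apply/rowP => l; rewrite [RHS]mxE; move: l.
  apply: (fb (fun l => ((\row_k c k) *m T') 0 l)).
  by rewrite -comp; under eq_bigr do rewrite mxE.
have : \row_k c k = 0 by rewrite -[LHS]mulmx1 -(mulmx1C TT) mulmxA cT mul0mx.
by move/rowP/(_ i); rewrite !mxE.
Qed.
End InsepStep.

Lemma lincomb_comm (R : fieldType) m n (d : 'I_m -> 'M[R]_n) :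
  (forall i j, d i *m d j = d j *m d i) -> forall c c' : 'I_m -> R,
  (\sum_l c l *: d l) *m (\sum_l c' l *: d l) = (\sum_l c' l *: d l) *m (\sum_l c l *: d l).
Proof.
move=> dC c c'; rewrite mulmx_suml mulmx_sumr; apply: eq_bigr => i _.
rewrite mulmx_suml mulmx_sumr; apply: eq_bigr => j _.
by rewrite -!scalemxAl -!scalemxAr dC !scalerA mulrC.
Qed.

Section Reduced.
Variables (F K : fieldType) (iota : {rmorphism F -> K}).
Hypothesis hK : separable_algebraic iota.
Variables (m n : nat) (d : 'I_m -> 'M[F]_n.+1).
Hypotheses (hd : division_span d) (dC : forall i j, d i *m d j = d j *m d i).

Let comb (c : 'I_m -> K) := \sum_l c l *: map_mx iota (d l).

Let combKM c c' : exists e, comb c *m comb c' = comb e.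
Proof.
apply: lincomb_mulmx => i j; have [hM _ _] := hd; have [e eE] := hM i j.
exists (fun l => iota (e l)); rewrite -map_mxM eE raddf_sum.
by apply: eq_bigr => l _; rewrite /= map_mxZ.
Qed.

Let combKC c c' : comb c *m comb c' = comb c' *m comb c.
Proof. by apply: lincomb_comm => i j; rewrite -!map_mxM dC. Qed.

Let mapcomb (c : 'I_m -> F) : map_mx iota (\sum_l c l *: d l) = comb (fun l => iota (c l)).
Proof. by rewrite raddf_sum; apply: eq_bigr => l _; rewrite /= map_mxZ. Qed.

(** In characteristic 0 the trace form of a division algebra is not degenerate: if
    all multiples of a unit have trace 0, Cayley-Hamilton shows that a nonzero
    scalar has trace 0.  A nilpotent combination is orthogonal to the whole
    commutative algebra, so its components over [F] are zero. *)
Lemma division_reduced_char0 c : [pchar F] =i pred0 -> nilmx (comb c) -> forall l, c l = 0.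
Proof.
move=> F0 nz; have [hM h1 hU] := hd.
have [s [b [B [fb cE]]]] := expand_mx iota (\row_l c l).
have cl l : c l = \sum_t b t * iota (B t 0 l).
  by have /rowP/(_ l) := cE; rewrite mxE summxE => ->; apply: eq_bigr => t _; rewrite !mxE.
pose y t := \sum_l B t 0 l *: d l.
have zE : comb c = \sum_t b t *: map_mx iota (y t).
  rewrite /comb; under eq_bigr do rewrite cl scaler_suml.
  rewrite exchange_big; apply: eq_bigr => t _; rewrite /y raddf_sum scaler_sumr.
  by apply: eq_bigr => l _; rewrite /= map_mxZ scalerA.
have tr0 t e : \tr (y t *m (\sum_l e l *: d l)) = 0.
  move: t; apply: (fb (fun t => \tr (y t *m (\sum_l e l *: d l)))).
  have : \tr (comb c *m map_mx iota (\sum_l e l *: d l)) = 0.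
    apply: nilmx_trace; have [q zq] := nz; exists q; rewrite mapcomb.
    by rewrite mulmxE exprMn_comm ?zq ?mul0r //; apply: combKC.
  rewrite zE mulmx_suml raddf_sum /= => h; rewrite -[RHS]h; apply: eq_bigr => t _.
  by rewrite -scalemxAl mxtraceZ -map_mxM trace_map_mx mulrC.
have y0 t : forall l, B t 0 l = 0.
  case: (hU (fun l => B t 0 l)) => // u; exfalso.
  pose C := char_poly (y t).
  have spanX f : exists e, horner_mx (y t) f = \sum_l e l *: d l.
    elim/poly_ind: f => [|f a [e IH]].
      exists (fun=> 0); rewrite (rmorph0 (horner_mx (y t))) big1 // => l _.
      by rewrite scale0r.
    have [e1 e1E] := lincomb_mulmx hM e (fun l => B t 0 l); have [e2 e2E] := h1.
    exists (fun l => e1 l + a * e2 l).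
    rewrite rmorphD rmorphM /= horner_mx_X horner_mx_C IH -mulmxE e1E -scalemx1 e2E scaler_sumr -big_split.
    by apply: eq_bigr => l _; rewrite /= scalerDl scalerA.
  have [f [a CE]] : exists f a, C = f * 'X + a%:P.
    elim/poly_ind: C => [|f a _]; [exists 0, 0; rewrite mul0r addr0 | by exists f, a].
    by [].
  have a0 : a != 0.
    have := char_poly_det (y t); rewrite -/C CE coefD coefMX coefC /= add0r => ->.
    by rewrite mulf_neq0 ?signr_eq0 // -unitfE -unitmxE.
  have [e eE] := spanX f.
  have := Cayley_Hamilton (y t); rewrite -/C CE rmorphD rmorphM /= horner_mx_X horner_mx_C eE.
  move/(congr1 mxtrace); rewrite mxtraceD -mulmxE mxtrace_mulC tr0 add0r mxtrace_scalar mxtrace0.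
  move/eqP; rewrite -mulr_natr mulf_eq0 (negbTE a0) /=.
  by have /pcharf0P -> := F0.
by move=> l; rewrite cl big1 // => t _; rewrite y0 rmorph0 mulr0.
Qed.

(** If the [p]-th power of an element is zero, expand it along a basis of a finite
    subextension: by Frobenius the components [y t] satisfy a relation with the
    [p]-th powers of the basis as coefficients.  They are free, so
    [y t ^+ p = 0], and [y t = 0] in a division algebra. *)
Lemma division_reduced_charp p c : p \in [pchar F] -> nilmx (comb c) -> forall l, c l = 0.
Proof.
move=> pF; have pK : p \in [pchar K] by rewrite (fmorph_pchar iota).
have pp := pcharf_prime pF.
have pM : p \in [pchar 'M[K]_n.+1].
  by rewrite pchar_lalg.
have [_ _ hU] := hd.
have step c' : comb c' ^+ p = 0 -> forall l, c' l = 0.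
  move=> zp.
  have [s [b [fb bR hc]]] := algebraic_span hK [seq c' l | l : 'I_m].
  have cs l : fspan iota b (c' l) by apply: hc; apply: image_f.
  pose k l t := sval (cid (cs l)) t.
  have cl l : c' l = \sum_t iota (k l t) * b t by rewrite /k; case: cid.
  pose y t := \sum_l k l t *: d l.
  have zE : comb c' = \sum_t b t *: map_mx iota (y t).
    rewrite /comb; under eq_bigr do rewrite cl scaler_suml.
    rewrite exchange_big; apply: eq_bigr => t _; rewrite /y raddf_sum scaler_sumr.
    by apply: eq_bigr => l _; rewrite /= map_mxZ scalerA mulrC.
  have fbp := pth_power_free hK pK fb bR.
  have yp t : (y t) ^+ p = 0.
    move: t; apply: (freefam_mx fbp); rewrite -[RHS]zp zE.
    rewrite (frobenius_sum_comm pM).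
      by apply: eq_bigr => t _; rewrite exprZn -rmorphXn.
    move=> i j; rewrite /GRing.comm -!scalerAl -!scalerAr !mapcomb -!mulmxE combKC.
    by rewrite !scalerA mulrC.
  have k0 t l : k l t = 0.
    move: l; case: (hU (fun l => k l t)) => // u.
    by case/negP: (nil_nunit (isT : 0 < n.+1)%N (ex_intro _ p (yp t) : nilmx (y t))).
  by move=> l; rewrite cl big1 // => t _; rewrite k0 rmorph0 mul0r.
have p1 := prime_gt1 pp.
case=> q zq; have : comb c ^+ (p ^ q) = 0.
  have lq : (q <= p ^ q)%N by rewrite ltnW // ltn_expl.
  by rewrite -(subnK lq) exprD zq mulr0.
elim: q c {zq} => [|q IH] c; first by rewrite expn0 expr1 -[comb c]expr1 => z; apply: step;
  rewrite -(prednK (prime_gt0 pp)) exprS -(expr1 (comb c)) z mul0r.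
rewrite expnS exprM.
have [e eE] : exists e, comb c ^+ p = comb e.
  rewrite -(prednK (prime_gt0 pp)); elim: (p.-1) => [|r [e eE]]; first by exists c.
  by rewrite exprS eE -mulmxE; apply: combKM.
rewrite eE => /IH e0; apply: step; rewrite eE /comb big1 // => l _.
by rewrite e0 scale0r.
Qed.

Theorem division_reduced c : nilmx (comb c) -> forall l, c l = 0.
Proof.
case: (pselect (exists p, p \in [pchar F])) => [[p pF]|nF].
  exact: (division_reduced_charp pF).
apply: division_reduced_char0 => p; apply/negP => pF; apply: nF; by exists p.
Qed.
End Reduced.

(** * The radical commutes with separable extension of scalars *)

Lemma division_reduced0 (F K : fieldType) (iota : {rmorphism F -> K}) m
    (d : 'I_m -> 'M[F]_m) (c : 'I_m -> K) : separable_algebraic iota ->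
  division_span d -> (forall i j, d i *m d j = d j *m d i) ->
  nilmx (\sum_l c l *: map_mx iota (d l)) -> forall l, c l = 0.
Proof.
by case: m d c => [|m] d c hK hd dC nz l; [case: l | exact: (division_reduced hK hd dC nz)].
Qed.

(** The row [w] of [radical_row] does not depend on [K].  The endomorphism ring
    acts on the simple module generated by [w], through a division algebra [D]
    spanned by the [rho (X l)], which is commutative.  A combination of elements
    of [End Y] that kill [w] is nilpotent by [radical_nil_ext].  Conversely, the
    image in the extension of [D] of a nilpotent endomorphism is nilpotent, so it
    is 0 by [division_reduced], which says that [w] is killed. *)
Theorem radrow_ext (F : fieldType) (hF : C1_field F) (I : Type) N (Y : I -> 'M[F]_N) :
  (forall x, mxhom Y Y x -> nilmx x \/ x \in unitmx) -> (0 < N)%N ->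
  exists w : 'rV[F]_N, forall (K : fieldType) (iota : {rmorphism F -> K}),
    separable_algebraic iota -> radrow (mapfam iota Y) (map_mx iota w).
Proof.
move=> hloc N0.
have [w [m [B [w0 fB hw hB]]]] := radical_row hloc N0.
exists w => K iota hK.
have hx i : exists2 y, mxhom Y Y y & row i B = w *m y by apply/hB; exact: row_sub.
pose X i := s2val (cid2 (hx i)).
have hX i : mxhom Y Y (X i) by rewrite /X; case: cid2.
have XE i : row i B = w *m X i by rewrite /X; case: cid2.
(* [rho y] is the matrix of [y] on the row space of [B]. *)
have [rho rhoE] : exists rho : 'M[F]_N -> 'M[F]_m,
    forall y, mxhom Y Y y -> rho y *m B = B *m y.
  exists (fun y => B *m y *m pinvmx B) => y hy.
  rewrite mulmxKpV //; apply/row_subP => i; rewrite row_mul XE -mulmxA.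
  by apply/hB; exists (X i *m y) => //; apply: mxhomM.
have Binj (P Q : 'M[F]_m) : P *m B = Q *m B -> P = Q by exact: (row_free_inj fB).
have rhoM y z : mxhom Y Y y -> mxhom Y Y z -> rho (y *m z) = rho y *m rho z.
  move=> hy hz; apply: Binj; rewrite rhoE; last exact: mxhomM.
  by rewrite -[RHS]mulmxA (rhoE z) // [RHS]mulmxA (rhoE y) // mulmxA.
have hXs c : mxhom Y Y (\sum_l c l *: X l).
  by apply: mxhom_sum => l; apply: mxhomZ.
have rhoD c : rho (\sum_l c l *: X l) = \sum_l c l *: rho (X l).
  apply: Binj; rewrite rhoE // mulmx_sumr mulmx_suml; apply: eq_bigr => l _.
  by rewrite -scalemxAr -scalemxAl rhoE.
have rhoB y z : mxhom Y Y y -> mxhom Y Y z -> rho (y - z) = rho y - rho z.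
  move=> hy hz; apply: Binj; rewrite rhoE; last exact: mxhomB.
  by rewrite mulmxBl !rhoE // mulmxBr.
have rho0 y : mxhom Y Y y -> w *m y = 0 -> rho y = 0.
  move=> hy wy; apply: Binj; rewrite mul0mx rhoE //; apply/row_matrixP => i.
  rewrite row_mul XE row0 -mulmxA; apply/(hw _ (mxhomM (hX i) hy)).
  apply: nilmxC; apply/(hw _ (mxhomM hy (hX i))); by rewrite mulmxA wy mul0mx.
(* Both [w *m y] and [rho y] depend only on [y] modulo the radical, where the [X l]
   form a basis because the rows [w *m X l] of [B] do. *)
have coord y : mxhom Y Y y -> exists c : 'I_m -> F,
    w *m y = w *m (\sum_l c l *: X l) /\ rho y = \sum_l c l *: rho (X l).
  move=> hy; have /submxP [D DE] : (w *m y <= B)%MS by apply/hB; exists y.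
  exists (fun l => D 0 l).
  have E : w *m y = w *m (\sum_l D 0 l *: X l).
    rewrite DE mulmx_sum_row mulmx_sumr; apply: eq_bigr => l _.
    by rewrite XE scalemxAr.
  split=> //; rewrite -rhoD; apply/eqP; rewrite -subr_eq0 -rhoB //.
  by rewrite rho0 ?mulmxBr ?E ?subrr //; apply: mxhomB.
have wX c : w *m (\sum_l c l *: X l) = 0 -> forall l, c l = 0.
  move=> h l; have : (\row_l c l) *m B = 0 *m B.
    rewrite mul0mx mulmx_sum_row -[RHS]h mulmx_sumr; apply: eq_bigr => k _.
    by rewrite mxE XE scalemxAr.
  by move/(row_free_inj fB)/rowP/(_ l); rewrite !mxE.
have hd : division_span (fun l => rho (X l)).
  split.
  - move=> i j; have [c [_ cE]] := coord _ (mxhomM (hX i) (hX j)).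
    by exists c; rewrite -cE rhoM.
  - have [c [_ cE]] := coord _ (@mxhom1 _ _ _ Y); exists c; rewrite -cE.
    by apply: Binj; rewrite rhoE ?mulmx1 ?mul1mx //; exact: mxhom1.
  move=> c; set y := \sum_l c l *: X l.
  have hy : mxhom Y Y y by exact: hXs.
  rewrite -rhoD -/y; case: (hloc _ hy) => [/(hw _ hy)|uy]; first by right; exact: wX.
  left; apply: (@mulmx1_unit _ _ _ (rho (invmx y)) _).1.
  rewrite -rhoM ?mulmxV //; last exact: mxhomV.
  by apply: Binj; rewrite rhoE ?mulmx1 ?mul1mx //; exact: mxhom1.
have dC : forall i j, rho (X i) *m rho (X j) = rho (X j) *m rho (X i).
  case: (pselect (infinite_field F)) => Finf.
    exact: infinite_division_comm hF Finf hd.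
  exact: finite_division_comm Finf hd.
move=> x /expand_hom [s [b [y [fb hy xE]]]]; split; last first.
  move=> wx; have wy l : w *m y l = 0.
    move: l; apply: (freefam_mx fb); rewrite -[RHS]wx xE mulmx_sumr.
    by apply: eq_bigr => l _; rewrite map_mxM scalemxAr.
  rewrite xE; apply: (radical_nil_ext hloc N0) => l; split=> //.
  by apply/(hw _ (hy l)).
move=> [e xe].
have hc l := coord _ (hy l).
pose c t l := sval (cid (hc t)) l.
have wc t : w *m y t = w *m (\sum_l c t l *: X l) by rewrite /c; case: cid => ? [].
have rc t : rho (y t) = \sum_l c t l *: rho (X l) by rewrite /c; case: cid => ? [].
pose kap l := \sum_t b t * iota (c t l).
pose z := \sum_l kap l *: map_mx iota (rho (X l)).
have zE : z = \sum_t b t *: map_mx iota (rho (y t)).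
  rewrite /z; under eq_bigr do rewrite /kap scaler_suml.
  rewrite exchange_big; apply: eq_bigr => t _; rewrite rc raddf_sum scaler_sumr.
  by apply: eq_bigr => l _; rewrite /= map_mxZ scalerA.
have zB : z *m map_mx iota B = map_mx iota B *m x.
  rewrite zE xE mulmx_suml mulmx_sumr; apply: eq_bigr => t _.
  by rewrite -scalemxAl -scalemxAr -!map_mxM rhoE.
have zX q : z ^+ q *m map_mx iota B = map_mx iota B *m x ^+ q.
  elim: q => [|q IH]; first by rewrite !expr0 mulmx1 mul1mx.
  by rewrite exprSr exprS -!mulmxE -mulmxA zB mulmxA IH -mulmxA !mulmxE -exprSr -exprS.
have nz : nilmx z.
  exists e; have fBK : row_free (map_mx iota B) by rewrite row_free_map.
  by apply: (row_free_inj fBK); rewrite /= zX xe mulmx0 mul0mx.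
have k0 l : kap l = 0.
  by apply: (division_reduced0 hK hd dC nz).
rewrite xE mulmx_sumr.
under eq_bigr => t _ do rewrite -scalemxAr -map_mxM wc mulmx_sumr raddf_sum scaler_sumr.
rewrite exchange_big big1 // => l _ /=.
under eq_bigr => t _ do rewrite -scalemxAr map_mxZ scalerA.
by rewrite -scaler_suml -/(kap l) k0 scale0r.
Qed.

(** * Fields of definition of a family of matrices *)

(** Both [Y] and [X] have the image [V] of [e] as a summand; [X2] is the rest of
    [X]. *)
Lemma linked_split (k : fieldType) (I : Type) n N (X : I -> 'M[k]_n) (Y : I -> 'M[k]_N) w e :
  linked X Y w e -> exists r (V : I -> 'M[k]_r) i p s (X2 : I -> 'M[k]_s),
    [/\ mxhom V Y i, mxhom Y V p, i *m p = 1%:M & p *m i = e] /\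
    mxdsum X V X2 /\ (e != 0 -> (s < n)%N).
Proof.
move=> le; have he := linked_hom le; have [ee [b [a [hb ha eE]]] _] := le.
have [V [i [p [hi hp ip pi]]]] := mxhom_split he ee.
have ip' : i *m b *m (a *m p) = 1%:M.
  have ie : i *m e = i by rewrite -[X in _ *m X = _]pi mulmxA ip mul1mx.
  by rewrite mulmxA -(mulmxA i) -eE ie ip.
have [s [X2 [ds sn]]] := mxdsum_split (mxhomM hi hb) (mxhomM ha hp) ip'.
exists (\rank e), V, i, p, s, X2; split=> //; split=> // e0.
by apply: sn; rewrite lt0n mxrank_eq0.
Qed.

Lemma mxdsum_map (k K : fieldType) (f : {rmorphism k -> K}) (I : Type) n n1 n2
    (X : I -> 'M[k]_n) (X1 : I -> 'M[k]_n1) (X2 : I -> 'M[k]_n2) :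
  mxdsum X X1 X2 -> mxdsum (mapfam f X) (mapfam f X1) (mapfam f X2).
Proof.
move=> [a [a' [b [b' [[ha ha' hb hb'] [e1 e2 e3 e4 e5]]]]]].
exists (map_mx f a), (map_mx f a'), (map_mx f b), (map_mx f b').
split; first by split; exact: mxhom_map.
by split; rewrite -!map_mxM -?map_mxD ?(e1, e2, e3, e4, e5) ?map_mx0 ?map_mx1.
Qed.

Section FamilyDescent.
Variables (F K : fieldType) (iota : {rmorphism F -> K}) (r : nat).
Hypotheses (hF : C1_field F) (hK : separable_algebraic iota).

Definition defined_over n (X : 'I_r -> 'M[K]_n) (L : intermediate_field iota) : Prop :=
  exists m (X0 : 'I_r -> 'M[ifield L]_m), mxiso X (mapfam (into_top L) X0).

Lemma separable_from_base (L : intermediate_field iota) : separable_algebraic (from_base L).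
Proof.
move=> x; have [p [irr rt sep]] := hK (into_top L x); exists p; split=> //.
rewrite -(fmorph_root (into_top L)) -map_poly_comp.
by rewrite (eq_map_poly (g := iota)).
Qed.

Lemma mapfam_base (L : intermediate_field iota) N (Y : 'I_r -> 'M[F]_N) :
  mapfam (into_top L) (mapfam (from_base L) Y) = mapfam iota Y.
Proof. by apply: funext => i; apply/matrixP => a b; rewrite !mxE. Qed.

Lemma map_base (L : intermediate_field iota) N (w : 'rV[F]_N) :
  map_mx (into_top L) (map_mx (from_base L) w) = map_mx iota w.
Proof. by apply/matrixP => a b; rewrite !mxE. Qed.

(** Lifting of idempotents: when [x] is idempotent modulo the radical, its Fitting
    idempotent is congruent to it. *)
Lemma radrow_lift_idem (k : fieldType) N (Y : 'I_r -> 'M[k]_N) (w u : 'rV[k]_N) x :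
  radrow Y w -> mxhom Y Y x -> w *m x = u -> w *m (x - x *m x) = 0 ->
  exists f, [/\ mxhom Y Y f, f *m f = f & w *m f = u].
Proof.
move=> hw hx wx xx; have [y] := mxhom_fitting hx.
set f := x *m y => - [hy yx ff nf].
have hf : mxhom Y Y f by exact: mxhomM.
have h1f : mxhom Y Y (1%:M - f) by apply: mxhomB => //; exact: mxhom1.
exists f; split=> //.
have E1 : w *m x = w *m (f *m x).
  have /(hw _ (mxhomM h1f hx)) := nf.
  by rewrite mulmxBl mul1mx mulmxBr => /eqP; rewrite subr_eq0 => /eqP.
have E2 : w *m f = w *m (f *m x).
  have hxx : mxhom Y Y (x - x *m x) by apply: mxhomB => //; exact: mxhomM.
  have := (radrowM hw hxx hy xx).2.
  have -> : y *m (x - x *m x) = f - f *m x by rewrite mulmxBr mulmxA -yx.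
  by rewrite mulmxBr => /eqP; rewrite subr_eq0 => /eqP.
by rewrite E2 -E1.
Qed.

(** The set [S] consists of the entries of [wK *m e], with [e] linked to [X], and of
    the set found for the complement [X2]. *)
Theorem family_descent n (X : 'I_r -> 'M[K]_n) :
  exists S : seq K, forall L : intermediate_field iota,
    defined_over X L <-> forall s, s \in S -> s \in L.
Proof.
elim/ltn_ind: n X => n IH X.
case: (posnP n) => [n0|n0].
  subst n; exists [::] => L; split=> // _; exists 0%N, (fun=> 0).
  exists 0, 0; split; try exact: mxhom0; by apply/matrixP => - [].
have [N [Y [hloc [al [be [hal hbe nab]]]]]] := linked_indecomposable hK X n0.
have N0 : (0 < N)%N.
  case: N Y hloc al be hal hbe nab => // Y _ al be _ _; case.
  by rewrite [al]thinmx0 mul0mx; exact: nil0mx.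
have [w hw] := radrow_ext hF hloc N0.
pose YK := mapfam iota Y; pose wK := map_mx iota w.
have hwK : radrow YK wK by exact: hw.
have [e le] := linked_exists X hwK.
have he := linked_hom le.
have e0 : e != 0.
  apply/negP => /eqP e0; apply: nab; apply: nilmxC.
  apply/(hwK _ (mxhomM hbe hal)).
  by have [_ _ /(_ _ _ hbe hal)] := le; rewrite e0 subr0 mul1mx.
have [q [V [i [p [s [X2 [[hi hp ip pi] [ds /(_ e0) sn]]]]]]]] := linked_split le.
have [S2 hS2] := IH s sn X2.
exists ([seq (wK *m e) 0 j | j : 'I_N] ++ S2) => L.
pose v := into_top L; pose YL := mapfam (from_base L) Y; pose wL := map_mx (from_base L) w.
have YLE : mapfam v YL = YK by exact: mapfam_base.
have wLE : map_mx v wL = wK by exact: map_base.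
have hwL : radrow YL wL by apply: hw; exact: separable_from_base.
split=> [[m [X0 iso]]|hS].
- have [e1 le1] := linked_exists X0 hwL.
  have leK : linked X YK wK (map_mx v e1).
    by apply: (linked_iso (mxiso_sym iso)); rewrite -YLE -wLE; exact: linked_map.
  have weE := linked_unique hwK le leK.
  move=> x; rewrite mem_cat => /orP [/imageP [j _ ->]|xS2].
    rewrite weE -wLE -map_mxM mxE; exact: valP.
  move: x xS2; apply/hS2.
  have [q' [V' [i' [p' [s' [X2' [[hi' hp' ip' pi'] [ds' _]]]]]]]] := linked_split le1.
  exists s', X2'.
  have dsK := mxdsum_iso (mxiso_sym iso) (mxdsum_map v ds').
  have isoV : mxiso (mapfam v V') V.
    apply: (@radrow_iso _ _ _ _ _ hwK _ _ _ _ (map_mx v i') (map_mx v p') i p) => //.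
    - by rewrite -YLE; exact: mxhom_map.
    - by rewrite -YLE; exact: mxhom_map.
    - by rewrite -map_mxM ip' map_mx1.
    - by rewrite -map_mxM pi' pi weE.
  exact: mxdsum_cancel (radrow_corner hwK hi hp ip) ds (mxdsum_isol isoV dsK).
have weL j : (wK *m e) 0 j \in L.
  by apply: hS; rewrite mem_cat image_f.
have [m [X20 iso2]] : defined_over X2 L.
  by apply/hS2 => x xS; apply: hS; rewrite mem_cat xS orbT.
(* The row [wK *m e] is defined over [L]; lift it to an endomorphism over [L], then
   to an idempotent, whose image is a form of [V]. *)
pose u : 'rV[ifield L]_N := \row_j IField (weL j).
have uE : map_mx v u = wK *m e.
  by apply/rowP => j; rewrite !mxE.
have [x hx wx] : exists2 x, mxhom YL YL x & wL *m x = u.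
  by apply: (@descend_hom _ _ v _ _ _ YL YL wL u e); rewrite ?YLE ?wLE.
have xx : wL *m (x - x *m x) = 0.
  apply: (map_mx_inj (f := v)); rewrite map_mx0 map_mxM wLE map_mxB map_mxM.
  have wxK : wK *m map_mx v x = wK *m e by rewrite -uE -wx map_mxM wLE.
  have hxK : mxhom YK YK (map_mx v x) by rewrite -YLE; exact: mxhom_map.
  have hj : mxhom YK YK (map_mx v x - e) by apply: mxhomB.
  have wj : wK *m (map_mx v x - e) = 0 by rewrite mulmxBr wxK subrr.
  have := (radrowM hwK hj he wj).2.
  have [ee _ _] := le.
  rewrite mulmxBr ee mulmxBr mulmxA => /eqP; rewrite subr_eq0 => /eqP E.
  by rewrite mulmxBr mulmxA wxK E subrr.
have [f [hf ff wf]] := radrow_lift_idem hwL hx wx xx.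
have [V1 [i1 [p1 [hi1 hp1 ip1 pi1]]]] := mxhom_split hf ff.
have isoV : mxiso V (mapfam v V1).
  apply: (@radrow_iso _ _ _ _ _ hwK _ _ _ _ i p (map_mx v i1) (map_mx v p1)) => //.
  - by rewrite -YLE; exact: mxhom_map.
  - by rewrite -YLE; exact: mxhom_map.
  - by rewrite -map_mxM ip1 map_mx1.
  - by rewrite -map_mxM pi1 pi -uE -wf map_mxM wLE.
exists (\rank f + m)%N, (fun t => block_mx (V1 t) 0 0 (X20 t)).
apply: mxdsum_unique (mxdsum_map v (mxdsum_block V1 X20)).
apply: mxdsum_isol isoV _; apply: mxdsum_sym.
by apply: mxdsum_isol iso2 _; apply: mxdsum_sym.
Qed.
End FamilyDescent.

(** * Modules and families of matrices *)

Section ModuleBasis.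
Variables (F k : fieldType) (i : {rmorphism F -> k}) (A : assoc_algebra F).
Variables (r : nat) (a : 'I_r -> A).
Hypothesis ha : forall x : A, exists c : 'I_r -> F, x = \sum_l alg_const A (c l) * a l.

(** [scalar_ext i A] is spanned over [k] by the generators [a l] of [A] over [F],
    so they determine the modules. *)
Lemma scalar_ext_ind (P : scalar_ext i A -> Prop) :
  (forall x y, P x -> P y -> P (x + y)) ->
  (forall s l, P (ext_const i A s * ext_tensor i 1 (a l))) -> P 0 -> forall z, P z.
Proof.
move=> PD Pg P0; apply: tensor_ind => // s v x Px; apply: (PD) => //.
have [pDl pDr pZ] := pure_tensor_balanced i (alg_module A).
have pt0 : pure_tensor i s (0 : alg_module A) = 0.
  by apply: (addrI (pure_tensor i s (0 : alg_module A))); rewrite -pDr !addr0.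
have [c cE] := ha v.
have -> : v = \sum_l c l *: (a l : alg_module A) by exact: cE.
rewrite (big_morph (pure_tensor i s) (fun u v => pDr s u v) pt0).
apply: (big_ind P P0 PD) => l _; rewrite -pZ.
have -> : pure_tensor i (s * i (c l)) (a l : alg_module A) =
          ext_const i A (s * i (c l)) * ext_tensor i 1 (a l).
  by rewrite ext_tensorM mulr1 mul1r.
exact: Pg.
Qed.

Variable M : lmodType (scalar_ext i A).

(** The field [k] acts on [M] through [ext_const]. *)
Definition mcomb n (b : 'I_n -> M) (c : 'rV[k]_n) : M :=
  \sum_j ext_const i A (c 0 j) *: b j.

Definition mbasis n (b : 'I_n -> M) : Prop :=
  (forall x, exists c, x = mcomb b c) /\ (forall c, mcomb b c = 0 -> c = 0).

Section Comb.
Variables (n : nat) (b : 'I_n -> M).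

Lemma mcomb0 : mcomb b 0 = 0.
Proof. by rewrite /mcomb big1 // => j _; rewrite mxE rmorph0 scale0r. Qed.

Lemma mcombD c d : mcomb b (c + d) = mcomb b c + mcomb b d.
Proof.
by rewrite /mcomb -big_split; apply: eq_bigr => j _; rewrite mxE rmorphD scalerDl.
Qed.

Lemma mcombZ s c : mcomb b (s *: c) = ext_const i A s *: mcomb b c.
Proof.
rewrite /mcomb scaler_sumr; apply: eq_bigr => j _.
by rewrite mxE rmorphM scalerA.
Qed.

Lemma mcombB c d : mcomb b (c - d) = mcomb b c - mcomb b d.
Proof. by rewrite mcombD -[- d]scaleN1r mcombZ rmorphN1 scaleN1r. Qed.

Lemma mcomb_delta j : mcomb b (delta_mx 0 j) = b j.
Proof.
rewrite /mcomb (bigD1 j) //= mxE !eqxx rmorph1 scale1r big1 ?addr0 // => l lj.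
by rewrite mxE eqxx (negbTE lj) rmorph0 scale0r.
Qed.

Lemma mcomb_mul m (P : 'M[k]_(m, n)) (c : 'rV[k]_m) :
  mcomb b (c *m P) = \sum_j ext_const i A (c 0 j) *: mcomb b (row j P).
Proof.
rewrite mulmx_sum_row (big_morph (mcomb b) mcombD mcomb0).
by apply: eq_bigr => j _; rewrite mcombZ.
Qed.

Lemma mbasis_inj c d : mbasis b -> mcomb b c = mcomb b d -> c = d.
Proof.
case=> _ fb cd; apply/eqP; rewrite -subr_eq0; apply/eqP/fb.
by rewrite mcombB cd subrr.
Qed.

Lemma ext_tensorC s x : ext_tensor i 1 x * ext_const i A s = ext_const i A s * ext_tensor i 1 x.
Proof. by rewrite !ext_tensorM !mul1r !mulr1. Qed.

Definition mmatrix (X : 'I_r -> 'M[k]_n) : Prop :=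
  forall l j, ext_tensor i 1 (a l) *: b j = mcomb b (row j (X l)).

Lemma mmatrixE X : mmatrix X -> forall l c,
  ext_tensor i 1 (a l) *: mcomb b c = mcomb b (c *m X l).
Proof.
move=> hX l c; rewrite mcomb_mul /mcomb scaler_sumr; apply: eq_bigr => j _.
by rewrite scalerA ext_tensorC -scalerA hX.
Qed.

Lemma mmatrix_exists : mbasis b -> exists X, mmatrix X.
Proof.
case=> sb _.
exists (fun l => \matrix_j sval (cid (sb (ext_tensor i 1 (a l) *: b j)))) => l j.
by rewrite rowK; case: cid.
Qed.
End Comb.

(** The products of generators of [M] with the [a l] span [M] over [k]; a smallest
    spanning family is a basis. *)
Lemma mbasis_exists : finitely_generated M -> exists n (b : 'I_n -> M), mbasis b.
Proof.
move=> [m [e he]].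
pose P n := `[< exists b : 'I_n -> M, forall x, exists c, x = mcomb b c >].
have exP : exists n, P n.
  pose J : finType := ('I_m * 'I_r)%type.
  pose g (j : J) := ext_tensor i 1 (a j.2) *: e j.1.
  exists #|J|; apply/asboolP; pose b (t : 'I_#|J|) := g (enum_val t); exists b => x.
  have [c ->] := he x.
  pose S y := exists c, y = mcomb b c.
  have S0 : S 0 by exists 0; rewrite mcomb0.
  have SD y z : S y -> S z -> S (y + z).
    by case=> d -> [d' ->]; exists (d + d'); rewrite mcombD.
  apply: (big_ind S S0 SD) => t _.
  elim/scalar_ext_ind: (c t) => [y z hy hz|s l|]; last by rewrite scale0r.
    by rewrite scalerDl; apply: SD.
  exists (s *: delta_mx 0 (enum_rank (t, l))); rewrite mcombZ mcomb_delta.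
  by rewrite /b enum_rankK /g scalerA.
case: (ex_minnP exP) => n /asboolP [b sb] nmin.
exists n, b; split=> // c c0; apply/eqP/negPn/negP => /eqP cn.
have [j0 cj0] : exists j, c 0 j != 0.
  apply: contrapT => h; apply: cn; apply/rowP => j; rewrite mxE.
  by apply/eqP/negPn/negP => cj; apply: h; exists j.
case: n b sb nmin c c0 cn j0 cj0 => [|n] b sb nmin c c0 cn j0 cj0; first by case: j0 cj0.
suff /nmin : P n by rewrite ltnn.
apply/asboolP; exists (fun t => b (lift j0 t)) => x; have [d ->] := sb x.
pose d' := d - (d 0 j0 / c 0 j0) *: c.
have -> : mcomb b d = mcomb b d' by rewrite mcombB mcombZ c0 scaler0 subr0.
exists (\row_t d' 0 (lift j0 t)); rewrite {1}/mcomb (bigD1_ord j0) //=.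
have -> : d' 0 j0 = 0 by rewrite !mxE divfK // subrr.
rewrite rmorph0 scale0r add0r; apply: eq_bigr => t _; by rewrite mxE.
Qed.
End ModuleBasis.

Lemma linear_mxiso (F k : fieldType) (i : {rmorphism F -> k}) (A : assoc_algebra F)
    (r : nat) (a : 'I_r -> A) (M M' : lmodType (scalar_ext i A)) n n'
    (b : 'I_n -> M) (b' : 'I_n' -> M') X X' (phi : {linear M -> M'}) :
  bijective phi -> mbasis b -> mbasis b' -> mmatrix a b X -> mmatrix a b' X' ->
  mxiso X X'.
Proof.
move=> bij hb hb' hX hX'; have [psi phiK psiK] := bij.
have phi_inj : injective phi by exact: can_inj phiK.
have [sb _] := hb; have [sb' _] := hb'.
pose P : 'M[k]_(n, n') := \matrix_j sval (cid (sb' (phi (b j)))).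
pose Q : 'M[k]_(n', n) := \matrix_j sval (cid (sb (psi (b' j)))).
have PE c : phi (mcomb b c) = mcomb b' (c *m P).
  rewrite mcomb_mul raddf_sum; apply: eq_bigr => j _ /=.
  by rewrite linearZ_LR rowK; case: cid => ? <-.
have QE j : mcomb b (row j Q) = psi (b' j) by rewrite rowK; case: cid => ? <-.
have hP : mxhom X X' P.
  move=> l; apply/row_matrixP => j; rewrite !row_mul; apply: (mbasis_inj hb').
  rewrite -PE -(hX l j) -(mmatrixE hX') linearZ_LR; congr (_ *: _).
  by rewrite -{1}(mcomb_delta b j) PE -rowE.
have QP : Q *m P = 1%:M.
  apply/row_matrixP => j; rewrite row_mul; apply: (mbasis_inj hb').
  by rewrite -PE QE psiK row1 mcomb_delta.
have PQ : P *m Q = 1%:M.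
  apply/row_matrixP => j; rewrite row_mul; apply: (mbasis_inj hb); apply: phi_inj.
  by rewrite !PE -!mulmxA QP mulmx1 row1 -rowE.
exists P, Q; split=> // l.
by rewrite -[LHS]mul1mx -QP -!mulmxA (mulmxA P) -hP -!mulmxA PQ mulmx1.
Qed.

Section ModuleExt.
Variables (F k K : fieldType) (i : {rmorphism F -> k}) (j : {rmorphism k -> K}).
Variables (ii : {rmorphism F -> K}) (kE : forall x, ii x = j (i x)).
Variables (A : assoc_algebra F) (r : nat) (a : 'I_r -> A).
Variable M0 : lmodType (scalar_ext i A).
Variables (n : nat) (b0 : 'I_n -> M0).
Hypothesis hb0 : mbasis b0.

Let E := module_ext M0 kE.
Let mt t m : E := @module_tensor _ _ _ i j ii kE A M0 t m.
Definition ext_basis l : E := mt 1 (b0 l).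

Let mtDr t x y : mt t (x + y) = mt t x + mt t y.
Proof. exact: (balancedDr (pure_tensor_balanced j (restrict_scalars (ext_const i A) M0))). Qed.

Let mtZ t s x : mt t (ext_const i A s *: x) = mt (t * j s) x.
Proof. exact: esym (balancedZ (pure_tensor_balanced j (restrict_scalars (ext_const i A) M0)) t s x). Qed.

Let mt0 t : mt t 0 = 0.
Proof. by apply: (addrI (mt t 0)); rewrite -mtDr !addr0. Qed.

Lemma ext_const_mt t u m : ext_const ii A t *: mt u m = mt (t * u) m.
Proof.
rewrite /mt module_ext_scaleE; congr module_tensor.
by rewrite -[ext_tensor i 1 1]/(1 : scalar_ext i A) scale1r.
Qed.

Lemma mt_mcomb t c : mt t (mcomb b0 c) = mcomb ext_basis (t *: map_mx j c).
Proof.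
rewrite /mcomb (big_morph (mt t) (mtDr t) (mt0 t)); apply: eq_bigr => l _.
by rewrite mtZ ext_const_mt mulr1 !mxE.
Qed.

Lemma ext_basis_span x : exists c, x = mcomb ext_basis c.
Proof.
move: x; apply: tensor_ind => [|t m x [c ->]].
  by exists 0; rewrite mcomb0.
have [sb _] := hb0; have [d dE] := sb m.
exists (t *: map_mx j d + c); rewrite mcombD -mt_mcomb -dE; by [].
Qed.

(** Freeness is tested with the map on the tensor product that comes from a
    coordinate [co] of [M0], a balanced map. *)
Lemma ext_basisP : mbasis ext_basis.
Proof.
split; first exact: ext_basis_span.
move=> c c0; apply/rowP => l; rewrite [RHS]mxE.
have [sb _] := hb0.
pose co (m : M0) := sval (cid (sb m)).
have coE m : mcomb b0 (co m) = m by rewrite /co; case: cid.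
have coD x y : co (x + y) = co x + co y.
  by apply: (mbasis_inj hb0); rewrite mcombD !coE.
have coZ s x : co (ext_const i A s *: x) = s *: co x.
  by apply: (mbasis_inj hb0); rewrite mcombZ !coE.
have cob q : co (b0 q) = delta_mx 0 q.
  by apply: (mbasis_inj hb0); rewrite coE mcomb_delta.
pose g (t : K) (m : restrict_scalars (ext_const i A) M0) : K := t * j (co m 0 l).
have bg : balanced j g.
  split=> [s t m|s x y|s t m]; rewrite /g.
  - by rewrite mulrDl.
  - by rewrite coD mxE rmorphD mulrDr.
  - by rewrite [co (t *: m)]coZ mxE rmorphM mulrA.
have := congr1 (tensor_lift j g) c0.
have g0 : tensor_lift j g 0 = 0.
  by apply: (addrI (tensor_lift j g 0)); rewrite -(tensor_liftD bg) !addr0.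
rewrite g0 /mcomb (big_morph (tensor_lift j g) (tensor_liftD bg) g0) => <-.
rewrite (bigD1 l) //= [X in _ + X]big1 ?addr0 => [|q ql].
  by rewrite ext_const_mt (tensor_liftE _ _ bg) /g cob mxE !eqxx rmorph1 !mulr1.
by rewrite ext_const_mt (tensor_liftE _ _ bg) /g cob mxE eqxx eq_sym (negbTE ql) rmorph0 mulr0.
Qed.

Lemma ext_basis_mmatrix X0 : mmatrix a b0 X0 -> mmatrix a ext_basis (mapfam j X0).
Proof.
move=> h l q; rewrite /ext_basis /mt module_ext_scaleE h mul1r.
rewrite -/(mt 1 _) mt_mcomb scale1r; congr mcomb.
by rewrite map_row.
Qed.
End ModuleExt.

(** Bundled, as for [mx_divring], to obtain the module structure on the
    corresponding subtype. *)
Record submodule (R : pzRingType) (V : lmodType R) := Submodule {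
  submodule_pred :> {pred V};
  submodule_closed : submod_closed submodule_pred
}.

Section SubmoduleType.
Variables (R : pzRingType) (V : lmodType R) (S : submodule V).

HB.instance Definition _ :=
  GRing.isSubmodClosed.Build R V (submodule_pred S) (submodule_closed S).

Record submod : Type := Submod { submod_val : V; _ : submod_val \in S }.
HB.instance Definition _ := [isSub for submod_val].
HB.instance Definition _ := [Choice of submod by <:].
HB.instance Definition _ := [SubChoice_isSubLmodule of submod by <:].

Lemma submod_val_inj : injective submod_val.
Proof. exact: val_inj. Qed.

Lemma submod_valP (x : submod) : submod_val x \in S.
Proof. exact: valP. Qed.
End SubmoduleType.

Section ScalarExtMap.
Variables (F k K : fieldType) (i : {rmorphism F -> k}) (j : {rmorphism k -> K}).
Variables (ii : {rmorphism F -> K}) (kE : forall x, ii x = j (i x)).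
Variable A : assoc_algebra F.

Definition ext_map of (forall x, ii x = j (i x)) := fun z : scalar_ext i A =>
  tensor_lift i (fun s (x : alg_module A) => ext_tensor ii (j s) (x : A)) z : scalar_ext ii A.
Local Notation em := (ext_map kE).

Fact ext_map_balanced : balanced i (fun s (x : alg_module A) => ext_tensor ii (j s) (x : A)).
Proof.
have [pDl pDr pZ] := pure_tensor_balanced ii (alg_module A).
split=> [s t x|s x y|s t x].
- by rewrite rmorphD; exact: pDl.
- exact: pDr.
- by rewrite rmorphM -kE; exact: pZ.
Qed.

Lemma ext_mapE s x : em (ext_tensor i s x) = ext_tensor ii (j s) x.
Proof. exact: tensor_liftE ext_map_balanced. Qed.

Lemma ext_mapD : {morph em : x y / x + y}.
Proof. exact: tensor_liftD ext_map_balanced. Qed.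

Fact ext_map_zmod_morphism : zmod_morphism em.
Proof. by move=> x y; apply: (addIr (em y)); rewrite -ext_mapD !subrK. Qed.

Fact ext_map_monoid_morphism : monoid_morphism em.
Proof.
split; first by rewrite [LHS]ext_mapE rmorph1.
move=> x y; move: x; apply: tensor_additive_ext => [u v|u v|s x].
- by rewrite mulrDl ext_mapD.
- by rewrite ext_mapD mulrDl.
move: y; apply: tensor_additive_ext => [u v|u v|t y].
- by rewrite mulrDr ext_mapD.
- by rewrite ext_mapD mulrDr.
by rewrite -/(ext_tensor i s x) -/(ext_tensor i t y) ext_tensorM !ext_mapE ext_tensorM rmorphM.
Qed.

HB.instance Definition _ := GRing.isZmodMorphism.Build _ _ em ext_map_zmod_morphism.
HB.instance Definition _ := GRing.isMonoidMorphism.Build _ _ em ext_map_monoid_morphism.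
End ScalarExtMap.

Section Form.
Variables (F k K : fieldType) (i : {rmorphism F -> k}) (j : {rmorphism k -> K}).
Variables (ii : {rmorphism F -> K}) (kE : forall x, ii x = j (i x)).
Variables (A : assoc_algebra F) (r : nat) (a : 'I_r -> A).
Hypothesis ha : forall x : A, exists c : 'I_r -> F, x = \sum_l alg_const A (c l) * a l.
Variables (M : lmodType (scalar_ext ii A)) (m : nat) (b : 'I_m -> M).
Hypothesis hb : mbasis b.
Variable X0 : 'I_r -> 'M[k]_m.
Hypothesis hX0 : mmatrix a b (mapfam j X0).

(** The combinations of [b] with coefficients in [k] are stable under the
    generators of [A], whose matrices have entries in [k], so they form a module
    [M0] over [k].  The natural map to [M] from its extension sends a basis to
    the basis [b]. *)
Lemma form_exists : exists M0 : lmodType (scalar_ext i A),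
  finitely_generated M0 /\ exists phi : {linear M -> module_ext M0 kE}, bijective phi.
Proof.
pose psi : {rmorphism scalar_ext i A -> scalar_ext ii A} := ext_map kE.
pose RM : lmodType (scalar_ext i A) := restrict_scalars psi M.
pose S : {pred RM} := fun x => `[< exists c : 'rV[k]_m, (x : M) = mcomb b (map_mx j c) >].
have SP (x : M) : reflect (exists c : 'rV[k]_m, x = mcomb b (map_mx j c)) ((x : RM) \in S).
  exact: asboolP.
have psiC s : psi (ext_const i A s) = ext_const ii A (j s) by exact: ext_mapE.
have psiT x : psi (ext_tensor i 1 x) = ext_tensor ii 1 x by rewrite -(rmorph1 j); exact: ext_mapE.
have S0 : (0 : RM) \in S by apply/(SP (0 : M)); exists 0; rewrite map_mx0 mcomb0.
have SD (x y : M) : (x : RM) \in S -> (y : RM) \in S -> ((x + y : M) : RM) \in S.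
  move=> /SP [c ->] /SP [d ->]; apply/SP; exists (c + d).
  by rewrite map_mxD mcombD.
have SZ z (x : M) : (x : RM) \in S -> ((psi z *: x : M) : RM) \in S.
  move=> hx; move: z.
  apply: (@scalar_ext_ind F k i A r a ha
    (fun z => ((psi z *: x : M) : RM) \in S)) => [y z hy hz|s l|].
  - by rewrite rmorphD scalerDl; apply: SD.
  - case/SP: hx => c ->; apply/SP; exists (s *: (c *m X0 l)).
    rewrite rmorphM /= -[ext_map kE (ext_const i A s)]/(psi _) psiC.
    rewrite -[ext_map kE (ext_tensor i 1 (a l))]/(psi _) psiT.
    by rewrite -scalerA (mmatrixE hX0) -mcombZ map_mxZ map_mxM.
  - by rewrite rmorph0 scale0r.
have cl : submod_closed S.
  by split=> // z x y hx hy; apply: SD => //; apply: SZ.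
pose M0 : lmodType (scalar_ext i A) := submod (Submodule cl).
have bS l : (b l : RM) \in S.
  by apply/SP; exists (delta_mx 0 l); rewrite map_delta_mx mcomb_delta.
pose b0 l : M0 := @Submod _ _ (Submodule cl) (b l) (bS l).
pose vl (x : M0) : M := submod_val x.
have vlI x y : vl x = vl y -> x = y.
  exact (@submod_val_inj _ _ (Submodule cl) x y).
have vlD x y : vl (x + y) = vl x + vl y by [].
have vlZ z x : vl (z *: x) = psi z *: vl x by [].
have vlcomb c : vl (mcomb b0 c) = mcomb b (map_mx j c).
  rewrite /mcomb (big_morph vl vlD (erefl : vl 0 = 0)); apply: eq_bigr => l _.
  by rewrite vlZ psiC mxE.
have hb0 : mbasis b0.
  split=> [x|c c0].
    have /SP [c cE] : (vl x : RM) \in S by exact: submod_valP.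
    by exists c; apply: vlI; rewrite vlcomb.
  have [_ fb] := hb; have := fb (map_mx j c); rewrite -vlcomb c0 => /(_ erefl) /eqP.
  by rewrite map_mx_eq0 => /eqP.
exists M0; split.
  exists m, b0 => x; have [sb _] := hb0; have [c cE] := sb x.
  by exists (fun l => ext_const i A (c 0 l)).
pose E := module_ext M0 kE.
have bg : balanced j (fun t (x : restrict_scalars (ext_const i A) M0) => ext_const ii A t *: vl x).
  split=> [s t x|s x y|s t x].
  - by rewrite rmorphD scalerDl.
  - by rewrite -[vl (x + y)]/(vl x + vl y) scalerDr.
  - rewrite -[vl (t *: x)]/(psi (ext_const i A t) *: vl x) psiC scalerA.
    by rewrite -rmorphM.
pose g : E -> M := tensor_lift j (fun t (x : restrict_scalars (ext_const i A) M0) => ext_const ii A t *: vl x).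
have gD x y : g (x + y) = g x + g y by exact: tensor_liftD.
have gE t x : g (module_tensor kE t x) = ext_const ii A t *: vl x by exact: tensor_liftE.
have g0 : g 0 = 0 by apply: (addrI (g 0)); rewrite -gD !addr0.
have gZ z x : g (z *: x) = z *: g x.
  move: z; apply: tensor_additive_ext => [y z|y z|s y].
  - by rewrite scalerDl gD.
  - by rewrite scalerDl.
  move: x; apply: tensor_additive_ext => [u v|u v|t u].
  - by rewrite scalerDr gD.
  - by rewrite gD scalerDr.
  rewrite -/(ext_tensor ii s y) -/(module_tensor kE t u) module_ext_scaleE !gE.
  rewrite vlZ psiT !scalerA; congr (_ *: _).
  by rewrite !ext_tensorM !mul1r !mulr1.
have gcomb c : g (mcomb (ext_basis kE b0) c) = mcomb b c.
  rewrite /mcomb (big_morph g gD g0); apply: eq_bigr => l _.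
  by rewrite gZ gE rmorph1 scale1r.
have gI : injective g.
  move=> x y; have [c ->] := ext_basis_span (kE := kE) hb0 x; have [d ->] := ext_basis_span (kE := kE) hb0 y.
  by rewrite !gcomb => /(mbasis_inj hb) ->.
have [sb _] := hb.
pose h (x : M) : E := mcomb (ext_basis kE b0) (sval (cid (sb x))).
have hK' x : g (h x) = x by rewrite gcomb; case: cid => c <-.
have hlin : linear h.
  by move=> z x y; apply: gI; rewrite gD gZ !hK'.
pose phi : {linear M -> E} := HB.pack h (GRing.isLinear.Build _ _ _ _ h hlin).
exists phi; exists g => x; first exact: hK'.
by apply: gI; rewrite hK'.
Qed.
End Form.

Section Descent.
Variables (F K : fieldType) (iota : {rmorphism F -> K}).
Variables (A : assoc_algebra F) (r : nat) (a : 'I_r -> A).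
Hypothesis ha : forall x : A, exists c : 'I_r -> F, x = \sum_l alg_const A (c l) * a l.
Variables (M : lmodType (scalar_ext iota A)) (n : nat) (b : 'I_n -> M).
Hypothesis hb : mbasis b.
Variable X : 'I_r -> 'M[K]_n.
Hypothesis hX : mmatrix a b X.

(** A module over [L] is a family over [L] in a basis; conversely, an isomorphism of
    [X] with a family over [L] is a change of basis of [M]. *)
Lemma field_of_definitionP (L : intermediate_field iota) :
  field_of_definition M L <-> defined_over X L.
Proof.
split=> [[M0 [fg [phi bij]]]|[m [X0 [P [Q [hP hQ PQ QP]]]]]].
  have [n0 [b0 hb0]] := mbasis_exists ha fg.
  have [X0 hX0] := mmatrix_exists a hb0.
  exists n0, X0.
  exact: linear_mxiso bij hb (ext_basisP _ hb0) hX (ext_basis_mmatrix _ hX0).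
pose b' t := mcomb b (row t Q).
have bE c : mcomb b' c = mcomb b (c *m Q) by rewrite mcomb_mul.
have hb' : mbasis b'.
  split=> [x|c].
    have [sb _] := hb; have [c ->] := sb x; exists (c *m P).
    by rewrite bE -mulmxA PQ mulmx1.
  rewrite bE => c0; have [_ fb] := hb.
  by rewrite -[c]mulmx1 -QP mulmxA (fb _ c0) mul0mx.
apply: (form_exists (from_baseK L) ha hb' (X0 := X0)) => l t.
by rewrite /b' (mmatrixE hX) bE -!row_mul hQ.
Qed.
End Descent.

Section Generated.
Variables (F K : fieldType) (iota : {rmorphism F -> K}).

Lemma generated_field (S : seq K) : exists L : intermediate_field iota,
  forall x, x \in L <-> forall L' : intermediate_field iota, (forall s, s \in S -> s \in L') -> x \in L'.
Proof.
pose P : {pred K} := fun x => `[< forall L' : intermediate_field iota,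
  (forall s, s \in S -> s \in L') -> x \in L' >].
have PP x : reflect (forall L' : intermediate_field iota,
  (forall s, s \in S -> s \in L') -> x \in L') (x \in P) by exact: asboolP.
have cl : divring_closed P.
  split; first by apply/PP => L' _; have [] := ifield_closed L'.
    move=> x y /PP hx /PP hy; apply/PP => L' hL; have [_ h _] := ifield_closed L'.
    by apply: h; [exact: hx | exact: hy].
  move=> x y /PP hx /PP hy; apply/PP => L' hL; have [_ _ h] := ifield_closed L'.
  by apply: h; [exact: hx | exact: hy].
have fl x : iota x \in P by apply/PP => L' _; exact: ifield_base.
by exists (IntermediateField cl fl) => x; split=> [/PP|hx] //; apply/PP.
Qed.

(** A subspace of a finite-dimensional space is finite-dimensional: the rows of
    coefficients of the elements of [L] form a row space. *)
Lemma finite_degree_span (L : intermediate_field iota) s (b : 'I_s -> K) :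
  (forall x, x \in L -> fspan iota b x) -> finite_degree (from_base L).
Proof.
move=> hL.
have [L1 LB LV] := ifield_closed L.
have LM x y : x \in L -> y \in L -> x * y \in L.
  move=> hx hy; rewrite -[y]invrK; apply: (LV) => //.
  by rewrite -[y^-1]mul1r; exact: LV.
have LD x y : x \in L -> y \in L -> x + y \in L.
  move=> hx hy; rewrite -[y]opprK; apply: (LB) => //.
  by rewrite -sub0r; apply: (LB) => //; rewrite -(subrr 1); exact: LB.
pose P (u : 'rV[F]_s) := \sum_l iota (u 0 l) * b l \in L.
have [||m [B [_ hB]]] := @subspace_mx F s P.
- rewrite /P big1 => [|l _]; last by rewrite mxE rmorph0 mul0r.
  by rewrite -(subrr 1); exact: LB.
- move=> c u v Pu Pv; rewrite /P.
  under eq_bigr => l _ do rewrite !mxE rmorphD rmorphM mulrDl -mulrA.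
  by rewrite big_split -mulr_sumr; apply: LD => //; apply: LM => //; exact: ifield_base.
have hrow t : P (row t B) by apply/hB; exact: row_sub.
exists m, (fun t => IField (hrow t)) => x.
have [u uE] := hL _ (valP x).
have /hB /submxP [c cE] : P (\row_l u l).
  rewrite /P; under eq_bigr do rewrite mxE.
  by rewrite -uE; exact: valP.
have uc l : u l = \sum_t c 0 t * B t l.
  by have /rowP/(_ l) := cE; rewrite !mxE.
exists (fun t => c 0 t); apply: (fmorph_inj (into_top L)).
apply: etrans uE _; rewrite raddf_sum.
under eq_bigr => l _ do rewrite uc rmorph_sum mulr_suml.
rewrite exchange_big; apply: eq_bigr => t _ /=.
rewrite -[RHS]/(iota (c 0 t) * \sum_l iota (row t B 0 l) * b l) mulr_sumr.
by apply: eq_bigr => l _; rewrite rmorphM mxE mulrA.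
Qed.
End Generated.

Theorem theorem1p1 (F : fieldType) (hF : C1_field F)
  (A : assoc_algebra F) (hA : finite_dimensional A)
  (K : fieldType) (iota : {rmorphism F -> K}) (hK : separable_algebraic iota)
  (M : lmodType (scalar_ext iota A)) (hM : finitely_generated M) :
  exists K0 : intermediate_field iota,
    minimal_field_of_definition M K0 /\ finite_degree (from_base K0).
Proof.
have [r [a ha]] := hA.
have [n [b hb]] := mbasis_exists ha hM.
have [X hX] := mmatrix_exists a hb.
have [S hS] := family_descent hF hK X.
have fodP L : field_of_definition M L <-> forall s, s \in S -> s \in L.
  by rewrite (field_of_definitionP ha hb hX) hS.
have [K0 hK0] := generated_field iota S.
exists K0; split.
  split; first by apply/fodP => s sS; apply/hK0 => L' ; exact.
  by move=> L' /fodP hL' x /hK0; exact.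
have [s [d [_ dR hd]]] := algebraic_span hK S.
have [L hL] := span_field hK dR.
apply: (@finite_degree_span _ _ _ K0 s d) => x /hK0 hx.
by apply/hL/hx => y /hd /hL.
Qed.
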